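(* Let $\lambda\in\mathbb{C}$ and $\mu>0$. Let $f(z)=z+a_2z^2+a_3z^3+\cdots\in\mathcal{C}_{\arcsin}$ and let $F_{\lambda,\mu}(f)=|a_3-\lambda a_2^2|-\mu|a_2|$. Then $$\Theta_1\le F_{\lambda,\mu}(f)\le \begin{cases} \dfrac{1}{3\pi^2}\left(|2-3\lambda|-3\pi\mu\right), & \text{if } |2-3\lambda|\ge\pi(1+3\mu),\\[2mm] \dfrac{1}{3\pi}, & \text{if } |2-3\lambda|<\pi(1+3\mu), \end{cases}$$ where $$\Theta_1= \begin{cases} \dfrac{1}{3\pi^2}\left(|2-3\lambda|-3\pi\mu\right), & \text{if } \frac{\pi}{2}(3\mu-2)\ge|2-3\lambda|,\\[3mm] -\dfrac{\mu}{\pi}\sqrt{\dfrac{\pi}{|2-3\lambda|+\pi}}, & \text{if } \frac{\pi}{4}\left(9\mu^2-4\right)\le|2-3\lambda|,\\[4mm] -\dfrac{1}{12\pi}\left(4+\dfrac{9\pi\mu^2}{|2-3\lambda|+\pi}\right), & \text{if } \frac{\pi}{4}\left(9\mu^2-4\right)>|2-3\lambda|>\frac{\pi}{2}(3\mu-2). \end{cases}$$ Both the lower bound $\Theta_1\le F_{\lambda,\mu}(f)$ and the upper bound on $F_{\lambda,\mu}(f)$ are sharp in each of their cases, i.e. for every such $\lambda,\mu$, each of the upper and the lower bound is attained with equality by some function in $\mathcal{C}_{\arcsin}$.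
   Context: Let $\Omega=\{z\in\mathbb{C}:|z|<1\}$. Let $\mathcal{A}$ be the family of analytic functions $f$ in $\Omega$ normalized by $f(z)=z+\sum_{n=2}^{\infty}a_nz^n$, and let $\mathcal{S}\subset\mathcal{A}$ be the subclass of univalent functions. A Schwarz function is an analytic $\omega:\Omega\to\mathbb{C}$ with $\omega(0)=0$ and $|\omega(z)|\le 1$ on $\Omega$. For analytic $g,h$ in $\Omega$, $g\prec h$ (subordination) means that there is a Schwarz function $\omega$ with $g(z)=h(\omega(z))$ for all $z\in\Omega$. With $\arcsin$ the principal branch ($\arcsin 0=0$), define $$\mathcal{C}_{\arcsin}=\left\{f\in\mathcal{S}:\ 1+\frac{zf''(z)}{f'(z)}\prec 1+\frac{2}{\pi}\arcsin z \text{ in } \Omega\right\}.$$ *)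

(* Defs.v *)
(* Stdlib real numbers, with Coquelicot's complex numbers and power series. *)
From Stdlib Require Import Reals ClassicalEpsilon.
From Coquelicot Require Import Coquelicot.
Open Scope R_scope.

Definition in_disk (z : C) : Prop := Cmod z < 1.

(* Analytic: given near every point of the disk by a convergent power series. *)
Definition analytic_in_disk (f : C -> C) : Prop :=
  forall z0 : C, in_disk z0 ->
    exists (r : R) (c : nat -> C),
      0 < r /\
      forall z : C, Cmod (z - z0) < r -> is_pseries c (z - z0)%C (f z).

(* f(z) = z + a_2 z^2 + a_3 z^3 + ... on the disk. *)
Definition normalized_expansion (f : C -> C) (a : nat -> C) : Prop :=
  a 0%nat = RtoC 0 /\ a 1%nat = RtoC 1 /\
  forall z : C, in_disk z -> is_pseries a z (f z).

Definition class_A (f : C -> C) : Prop :=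
  analytic_in_disk f /\ exists a : nat -> C, normalized_expansion f a.

Definition univalent (f : C -> C) : Prop :=
  forall z w : C, in_disk z -> in_disk w -> f z = f w -> z = w.

Definition class_S (f : C -> C) : Prop := class_A f /\ univalent f.

Definition schwarz_function (w : C -> C) : Prop :=
  analytic_in_disk w /\ w (RtoC 0) = RtoC 0 /\
  forall z : C, in_disk z -> Cmod (w z) <= 1.

Definition subordinate (g h : C -> C) : Prop :=
  exists w : C -> C,
    schwarz_function w /\ forall z : C, in_disk z -> g z = h (w z).

Definition Cexp (z : C) : C := (exp (Re z) * cos (Im z), exp (Re z) * sin (Im z)).

Definition Csin (z : C) : C :=
  ((Cexp (Ci * z) - Cexp (- (Ci * z))) / (2 * Ci))%C.

(* Principal arcsine.  For |z| <= 1 exactly one w with |Re w| <= PI/2 satisfies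
   Csin w = z; on the branch cuts, which lie outside the closed unit disk
   except for their endpoints 1 and -1, no particular value is prescribed. *)
Definition Carcsin (z : C) : C :=
  epsilon (inhabits (RtoC 0))
    (fun w : C => - (PI / 2) <= Re w <= PI / 2 /\ Csin w = z).

(* For univalent f the denominator f' has no zero in the disk. *)
Definition class_C_arcsin (f : C -> C) : Prop :=
  class_S f /\
  subordinate
    (fun z : C => 1 + z * C_derive (C_derive f) z / C_derive f z)%C
    (fun z : C => 1 + 2 / PI * Carcsin z)%C.

Definition F_functional (lambda : C) (mu : R) (a : nat -> C) : R :=
  Cmod (a 3%nat - lambda * a 2%nat ^ 2) - mu * Cmod (a 2%nat).

Definition upper_bound (lambda : C) (mu : R) : R :=
  let t := Cmod (2 - 3 * lambda) in
  if Rle_dec (PI * (1 + 3 * mu)) t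
  then 1 / (3 * PI ^ 2) * (t - 3 * PI * mu)
  else 1 / (3 * PI).

(* The first two conditions overlap only for mu = 2/3 and t = 0, where the two
   values agree; the last branch is  PI/4*(9*mu^2-4) > t > PI/2*(3*mu-2). *)
Definition Theta1 (lambda : C) (mu : R) : R :=
  let t := Cmod (2 - 3 * lambda) in
  if Rle_dec t (PI / 2 * (3 * mu - 2))
  then 1 / (3 * PI ^ 2) * (t - 3 * PI * mu)
  else if Rle_dec (PI / 4 * (9 * mu ^ 2 - 4)) t
  then - (mu / PI) * sqrt (PI / (t + PI))
  else - (1 / (12 * PI)) * (4 + 9 * PI * mu ^ 2 / (t + PI)).

(* Main.v *)
Require Import Defs.
From Stdlib Require Import Reals Ranalysis5 Lra Lia ClassicalEpsilon.
From Coquelicot Require Import Coquelicot.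
Open Scope R_scope.

(* If z f'' / f' = (2/pi) arcsin w with w = c_1 z + c_2 z^2 + ... a Schwarz
   function, then a_2 = c_1/pi and a_3 = (c_2 + 2 c_1^2/pi) / (3 pi), so that
   3 pi^2 F = |pi c_2 + (2 - 3 lambda) c_1^2| - 3 pi mu |c_1|, and
   |c_2| <= 1 - |c_1|^2 leaves a one-variable optimisation in |c_1|.

   The optimum is reached by w = z (x + e z) / (1 + x e z) with 0 <= x <= 1 and
   |e| = 1.  For these f' = exp L with z L' = (2/pi) arcsin w; as
   |arcsin w| <= (pi/2) |w| <= (pi/2) |z|, |L| < 1 < pi/2, hence Re f' > 0 and f
   is univalent.

   Cauchy's formula is obtained by shrinking the circle towards z: the integral
   of g(z + t (zeta - z)) zeta / (zeta - z) over the circle is constant in t. *)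

(** * Order-of-magnitude calculus and complex derivatives *)

(** The Schwarz function comes with local power series and a bound [<= 1] that might a priori be
    attained, while an extremal [f] needs one series valid in the whole disk. Cauchy's formula
    settles both: it turns differentiability in a disk into a single Taylor series there, and it
    writes each coefficient as a mean over every circle of radius below 1, which is where [|w| <= 1]
    can be used. The inequality for [c_2] then follows by averaging one pointwise estimate, with no
    maximum principle and no division of [w] by [z]. The arcsine of the statement is a mere choice
    of a preimage under [Csin]. In the open disk it is identified with an explicit series, built
    from a recursion for [(1 - u^2)^(-1/2)]. The coefficients are nonnegative with partial sums at
    most [PI / 2], which is the origin of the constant that cancels [2 / PI]. For the bounds only
    germs at 0 are compared, where [|w|] is small, so the arcsine is never evaluated on the unit
    circle. *)

Lemma Cmod_triangle_minus (x y : C) : Cmod (x - y) <= Cmod x + Cmod y.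
Proof.
  unfold Cminus. rewrite <- (Cmod_opp y). apply Cmod_triangle.
Qed.

Lemma Cmod_triangle_rev (x y : C) : Cmod x - Cmod y <= Cmod (x + y).
Proof.
  generalize (Cmod_triangle (x + y) (- y)). rewrite Cmod_opp.
  replace (x + y + - y)%C with x by ring. lra.
Qed.

Lemma Cmod_minus_sym (x y : C) : Cmod (x - y) = Cmod (y - x).
Proof. rewrite <- Cmod_opp. f_equal. ring. Qed.

Lemma im_le_Cmod (z : C) : Rabs (Im z) <= Cmod z.
Proof. apply (Rle_trans _ _ _ (Rmax_r _ _) (Rmax_Cmod z)). Qed.

Lemma Cmod_le_Re_Im (z : C) : Cmod z <= Rabs (Re z) + Rabs (Im z).
Proof.
  rewrite <- (Cmod_R (Re z)), <- (Cmod_R (Im z)).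
  replace (Cmod (RtoC (Im z))) with (Cmod (RtoC (Im z) * Ci)).
  2:{ rewrite Cmod_mult, Cmod_Ci. ring. }
  eapply Rle_trans; [|apply Cmod_triangle].
  right. f_equal. destruct z as [x y]. unfold Cplus, Cmult, Ci, RtoC, Re, Im; simpl.
  f_equal; ring.
Qed.

Lemma Cmod_sqr (z : C) : Cmod z ^ 2 = Re z ^ 2 + Im z ^ 2.
Proof. apply Cmod2_alt. Qed.

Lemma C_eq (z w : C) : Re z = Re w -> Im z = Im w -> z = w.
Proof. destruct z, w; simpl; intros; subst; reflexivity. Qed.

(** The estimate includes [h = 0]: for [n >= 1] it forces [e 0 = 0], and for [n = 0] it is
    boundedness near 0. *)
Definition bigO (n : nat) (e : C -> C) : Prop :=
  exists K d, 0 <= K /\ 0 < d /\ forall h, Cmod h < d -> Cmod (e h) <= K * Cmod h ^ n.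

Lemma bigO_ext_loc (n : nat) (e e' : C -> C) :
  (exists d, 0 < d /\ forall h, Cmod h < d -> e h = e' h) -> bigO n e -> bigO n e'.
Proof.
  intros [d0 [Hd0 E]] [K [d [HK [Hd H]]]].
  exists K, (Rmin d0 d). split; [exact HK|split; [apply Rmin_pos; lra|]].
  intros h Hh. rewrite <- E. apply H. eapply Rlt_le_trans; [exact Hh|apply Rmin_r].
  eapply Rlt_le_trans; [exact Hh|apply Rmin_l].
Qed.

Lemma bigO_ext (n : nat) (e e' : C -> C) :
  (forall h, e h = e' h) -> bigO n e -> bigO n e'.
Proof. intros E. apply bigO_ext_loc. exists 1. split; [lra|auto]. Qed.

Lemma bigO_plus (n : nat) (a b : C -> C) :
  bigO n a -> bigO n b -> bigO n (fun h => a h + b h)%C.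
Proof.
  intros [K [d [HK [Hd H]]]] [K' [d' [HK' [Hd' H']]]].
  exists (K + K'), (Rmin d d'). repeat split; [lra|apply Rmin_pos; lra|].
  intros h Hh. eapply Rle_trans; [apply Cmod_triangle|].
  assert (Cmod (a h) <= K * Cmod h ^ n) by (apply H; eapply Rlt_le_trans; [exact Hh|apply Rmin_l]).
  assert (Cmod (b h) <= K' * Cmod h ^ n) by (apply H'; eapply Rlt_le_trans; [exact Hh|apply Rmin_r]).
  lra.
Qed.

Lemma bigO_mult (m n : nat) (a b : C -> C) :
  bigO m a -> bigO n b -> bigO (m + n) (fun h => a h * b h)%C.
Proof.
  intros [K [d [HK [Hd H]]]] [K' [d' [HK' [Hd' H']]]].
  exists (K * K'), (Rmin d d'). repeat split; [now apply Rmult_le_pos|apply Rmin_pos; lra|].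
  intros h Hh. rewrite Cmod_mult, pow_add.
  replace (K * K' * (Cmod h ^ m * Cmod h ^ n)) with ((K * Cmod h ^ m) * (K' * Cmod h ^ n)) by ring.
  apply Rmult_le_compat; try apply Cmod_ge_0.
  - apply H; eapply Rlt_le_trans; [exact Hh|apply Rmin_l].
  - apply H'; eapply Rlt_le_trans; [exact Hh|apply Rmin_r].
Qed.

Lemma bigO_const (c : C) : bigO 0 (fun _ => c).
Proof.
  exists (Cmod c), 1. repeat split; [apply Cmod_ge_0|lra|]. intros; simpl; lra.
Qed.

Lemma bigO_id : bigO 1 (fun h => h).
Proof. exists 1, 1. repeat split; try lra. intros; simpl; lra. Qed.

Lemma bigO_zero (n : nat) : bigO n (fun _ => RtoC 0).
Proof.
  exists 0, 1. repeat split; try lra. intros; rewrite Cmod_0; lra.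
Qed.

Lemma bigO_scal (n : nat) (c : C) (a : C -> C) : bigO n a -> bigO n (fun h => c * a h)%C.
Proof. intros H. apply (bigO_mult 0 n _ _ (bigO_const c) H). Qed.

Lemma bigO_minus (n : nat) (a b : C -> C) :
  bigO n a -> bigO n b -> bigO n (fun h => a h - b h)%C.
Proof.
  intros Ha Hb. apply (bigO_ext n (fun h => a h + (-(1)) * b h)%C).
  - intros; ring.
  - apply bigO_plus; [exact Ha|]. now apply bigO_scal.
Qed.

Lemma bigO_pow (n : nat) : bigO n (fun h => h ^ n)%C.
Proof.
  exists 1, 1. repeat split; try lra. intros; rewrite Cmod_pow; lra.
Qed.

Lemma bigO_weaken (m n : nat) (a : C -> C) : (m <= n)%nat -> bigO n a -> bigO m a.
Proof.
  intros Hmn [K [d [HK [Hd H]]]].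
  exists K, (Rmin d 1). repeat split; [lra|apply Rmin_pos; lra|].
  intros h Hh. eapply Rle_trans; [apply H; eapply Rlt_le_trans; [exact Hh|apply Rmin_l]|].
  apply Rmult_le_compat_l; [exact HK|].
  assert (Cmod h <= 1) by (left; eapply Rlt_le_trans; [exact Hh|apply Rmin_r]).
  replace n with (m + (n - m))%nat by lia. rewrite pow_add.
  rewrite <- (Rmult_1_r (Cmod h ^ m)) at 2.
  apply Rmult_le_compat_l; [apply pow_le, Cmod_ge_0|].
  rewrite <- (pow1 (n - m)). apply pow_incr. split; [apply Cmod_ge_0|lra].
Qed.

Lemma bigO_small (a : C -> C) (eps : R) :
  bigO 1 a -> 0 < eps -> exists d, 0 < d /\ forall h, Cmod h < d -> Cmod (a h) < eps.
Proof.
  intros [K [d [HK [Hd H]]]] He.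
  exists (Rmin d (eps / (K + 1))). split.
  - apply Rmin_pos; [lra|]. apply Rdiv_lt_0_compat; lra.
  - intros h Hh. eapply Rle_lt_trans; [apply H; eapply Rlt_le_trans; [exact Hh|apply Rmin_l]|].
    assert (Hh' : Cmod h < eps / (K + 1)) by (eapply Rlt_le_trans; [exact Hh|apply Rmin_r]).
    apply (Rmult_lt_compat_r (K + 1)) in Hh'; [|lra].
    replace (eps / (K + 1) * (K + 1)) with eps in Hh' by (field; lra).
    generalize (Cmod_ge_0 h). simpl. nra.
Qed.

Lemma bigO_comp (n : nat) (a k : C -> C) :
  bigO n a -> bigO 1 k -> bigO n (fun h => a (k h)).
Proof.
  intros [K [d [HK [Hd H]]]] Hk.
  destruct (bigO_small k d Hk Hd) as [d1 [Hd1 Hs]].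
  destruct Hk as [K2 [d2 [HK2 [Hd2 H2]]]].
  exists (K * K2 ^ n), (Rmin d1 d2).
  split; [apply Rmult_le_pos; [lra|now apply pow_le]|split; [apply Rmin_pos; lra|]].
  intros h Hh.
  eapply Rle_trans; [apply H, Hs; eapply Rlt_le_trans; [exact Hh|apply Rmin_l]|].
  rewrite Rmult_assoc, <- Rpow_mult_distr. apply Rmult_le_compat_l; [exact HK|].
  apply pow_incr. split; [apply Cmod_ge_0|].
  rewrite <- (pow_1 (Cmod h)). apply H2; eapply Rlt_le_trans; [exact Hh|apply Rmin_r].
Qed.

Lemma bigO_coef_zero (n : nat) (c : C) : bigO (S n) (fun h => c * h ^ n)%C -> c = RtoC 0.
Proof.
  intros [K [d [HK [Hd H]]]].
  destruct (Req_dec (Cmod c) 0) as [E|E]; [now apply Cmod_eq_0|exfalso].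
  assert (Hc : 0 < Cmod c) by (generalize (Cmod_ge_0 c); lra).
  (* This [s] lies inside the radius [d] and makes [K * s < Cmod c]; the summand 1 covers
     [K = 0]. *)
  set (s := Rmin (d / 2) (Cmod c / (2 * (K + 1)))).
  assert (Hs : 0 < s).
  { apply Rmin_pos; [lra|]. apply Rdiv_lt_0_compat; lra. }
  assert (Hs1 : s <= d / 2) by apply Rmin_l.
  assert (Hs2 : s <= Cmod c / (2 * (K + 1))) by apply Rmin_r.
  assert (Es : Cmod (RtoC s) = s) by (rewrite Cmod_R; apply Rabs_pos_eq; lra).
  specialize (H (RtoC s)). rewrite Es in H.
  assert (H' := H ltac:(lra)). rewrite Cmod_mult, Cmod_pow, Es in H'. simpl in H'.
  assert (0 < s ^ n) by now apply pow_lt.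
  assert (H'' : Cmod c <= K * s).
  { apply (Rmult_le_reg_r (s ^ n)); [assumption|]. lra. }
  apply (Rmult_le_compat_r (2 * (K + 1))) in Hs2; [|lra].
  replace (Cmod c / (2 * (K + 1)) * (2 * (K + 1))) with (Cmod c) in Hs2 by (field; lra).
  nra.
Qed.

(* All functions below are analytic, so the remainder can be asked to be quadratic rather than [o(h)];
   derivative rules then reduce to algebraic identities between [bigO] terms. *)
Definition Lip (f : C -> C) (z : C) : Prop := bigO 1 (fun h => f (z + h) - f z)%C.

(** The Lipschitz clause makes the derivative continuous at [z], as needed to integrate it and to
    differentiate under the integral sign. *)
Definition Cdiff (f f' : C -> C) (z : C) : Prop :=
  bigO 2 (fun h => f (z + h) - f z - f' z * h)%C /\ Lip f' z.

Lemma Lip_plus (f g : C -> C) (z : C) :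
  Lip f z -> Lip g z -> Lip (fun x => f x + g x)%C z.
Proof.
  intros Hf Hg. eapply bigO_ext; [|apply (bigO_plus 1 _ _ Hf Hg)]. intros h; simpl; ring.
Qed.

Lemma Lip_bounded (f : C -> C) (z : C) : Lip f z -> bigO 0 (fun h => f (z + h)%C).
Proof.
  intros Hf. apply (bigO_ext 0 (fun h => (f (z + h) - f z) + f z)%C).
  - intros; ring.
  - apply bigO_plus; [|apply bigO_const]. apply (bigO_weaken 0 1); [lia|exact Hf].
Qed.

Lemma Lip_mult (f g : C -> C) (z : C) :
  Lip f z -> Lip g z -> Lip (fun x => f x * g x)%C z.
Proof.
  intros Hf Hg.
  apply (bigO_ext 1 (fun h => (f (z + h) - f z) * g (z + h) + f z * (g (z + h) - g z))%C).
  - intros; ring.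
  - apply bigO_plus.
    + apply (bigO_mult 1 0); [exact Hf|now apply Lip_bounded].
    + now apply bigO_scal.
Qed.

Lemma Lip_const (c z : C) : Lip (fun _ => c) z.
Proof. apply (bigO_ext 1 (fun _ => RtoC 0)); [intros; ring|apply bigO_zero]. Qed.

Lemma Lip_comp (f g : C -> C) (z : C) :
  Lip g z -> Lip f (g z) -> Lip (fun x => f (g x)) z.
Proof.
  intros Hg Hf. apply (bigO_ext 1 (fun h => f (g z + (g (z + h) - g z)) - f (g z))%C).
  - intros h. f_equal. f_equal. ring.
  - apply (bigO_comp 1 (fun k => f (g z + k) - f (g z))%C (fun h => g (z + h) - g z)%C Hf Hg).
Qed.

Lemma Lip_ext (f g : C -> C) (z : C) : (forall x, f x = g x) -> Lip f z -> Lip g z.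
Proof. intros E. apply bigO_ext. intros h. now rewrite !E. Qed.

Lemma Lip_ext_loc (f g : C -> C) (z : C) :
  (exists d, 0 < d /\ forall h, Cmod h < d -> f (z + h)%C = g (z + h)%C) -> Lip f z -> Lip g z.
Proof.
  intros [d [Hd E]]. apply bigO_ext_loc. exists d. split; [exact Hd|]. intros h Hh.
  assert (E0 := E (RtoC 0) ltac:(rewrite Cmod_0; exact Hd)). rewrite Cplus_0_r in E0.
  now rewrite E, E0 by exact Hh.
Qed.

Lemma Cdiff_Lip (f f' : C -> C) (z : C) : Cdiff f f' z -> Lip f z.
Proof.
  intros [H _].
  apply (bigO_ext 1 (fun h => (f (z + h) - f z - f' z * h) + f' z * h)%C).
  - intros; ring.
  - apply bigO_plus; [apply (bigO_weaken 1 2); [lia|exact H]|].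
    apply bigO_scal, bigO_id.
Qed.

Lemma Cdiff_ext (f g f' g' : C -> C) (z : C) :
  (forall x, f x = g x) -> (forall x, f' x = g' x) -> Cdiff f f' z -> Cdiff g g' z.
Proof.
  intros E E' [H L]. split.
  - eapply bigO_ext; [|exact H]. intros; simpl. now rewrite !E, E'.
  - now apply (Lip_ext f').
Qed.

Lemma Cdiff_ext_loc (f g f' g' : C -> C) (z : C) :
  (exists d, 0 < d /\ forall h, Cmod h < d ->
     f (z + h)%C = g (z + h)%C /\ f' (z + h)%C = g' (z + h)%C) ->
  Cdiff f f' z -> Cdiff g g' z.
Proof.
  intros [d [Hd E]] [H L].
  assert (E0 := E (RtoC 0) ltac:(rewrite Cmod_0; exact Hd)). rewrite Cplus_0_r in E0.
  destruct E0 as [E0 E1]. split.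
  - eapply bigO_ext_loc; [|exact H]. exists d. split; [exact Hd|].
    intros h Hh. destruct (E h Hh) as [E2 _]. now rewrite E0, E1, E2.
  - apply (Lip_ext_loc f'); [|exact L]. exists d. split; [exact Hd|].
    intros h Hh. now destruct (E h Hh).
Qed.

Lemma Cdiff_const (c z : C) : Cdiff (fun _ => c) (fun _ => RtoC 0) z.
Proof.
  split; [|apply Lip_const]. apply (bigO_ext 2 (fun _ => RtoC 0)); [intros; ring|apply bigO_zero].
Qed.

Lemma Cdiff_id (z : C) : Cdiff (fun x => x) (fun _ => RtoC 1) z.
Proof.
  split; [|apply Lip_const]. apply (bigO_ext 2 (fun _ => RtoC 0)); [intros; ring|apply bigO_zero].
Qed.

Lemma Cdiff_plus (f f' g g' : C -> C) (z : C) :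
  Cdiff f f' z -> Cdiff g g' z -> Cdiff (fun x => f x + g x)%C (fun x => f' x + g' x)%C z.
Proof.
  intros [Hf Lf] [Hg Lg]. split; [|now apply Lip_plus].
  eapply bigO_ext; [|apply (bigO_plus 2 _ _ Hf Hg)]. intros h; simpl; ring.
Qed.

Lemma Cdiff_mult (f f' g g' : C -> C) (z : C) :
  Cdiff f f' z -> Cdiff g g' z -> Cdiff (fun x => f x * g x)%C (fun x => f' x * g x + f x * g' x)%C z.
Proof.
  intros Df Dg. assert (Lf := Cdiff_Lip _ _ _ Df). assert (Lg := Cdiff_Lip _ _ _ Dg).
  destruct Df as [Hf Lf'], Dg as [Hg Lg'].
  split; [|apply Lip_plus; apply Lip_mult; assumption].
  apply (bigO_ext 2 (fun h => (f (z + h) - f z - f' z * h) * g (z + h)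
     + (f z * (g (z + h) - g z - g' z * h) + f' z * (h * (g (z + h) - g z))))%C).
  - intros; ring.
  - apply bigO_plus; [|apply bigO_plus].
    + apply (bigO_mult 2 0); [exact Hf|now apply Lip_bounded].
    + now apply bigO_scal.
    + apply bigO_scal. apply (bigO_mult 1 1); [apply bigO_id|exact Lg].
Qed.

Lemma Cdiff_scal (c : C) (f f' : C -> C) (z : C) :
  Cdiff f f' z -> Cdiff (fun x => c * f x)%C (fun x => c * f' x)%C z.
Proof.
  intros H. eapply Cdiff_ext; [| |apply (Cdiff_mult _ _ _ _ z (Cdiff_const c z) H)]; intros; simpl; ring.
Qed.

Lemma Cdiff_minus (f f' g g' : C -> C) (z : C) :
  Cdiff f f' z -> Cdiff g g' z -> Cdiff (fun x => f x - g x)%C (fun x => f' x - g' x)%C z.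
Proof.
  intros Hf Hg. apply (Cdiff_scal (-(1))%C) in Hg.
  eapply Cdiff_ext; [| |apply (Cdiff_plus _ _ _ _ z Hf Hg)]; intros; simpl; ring.
Qed.

Lemma Cdiff_comp (f f' g g' : C -> C) (z : C) :
  Cdiff g g' z -> Cdiff f f' (g z) -> Cdiff (fun x => f (g x)) (fun x => f' (g x) * g' x)%C z.
Proof.
  intros Dg Df. assert (Lg := Cdiff_Lip _ _ _ Dg).
  destruct Df as [Hf Lf'], Dg as [Hg Lg'].
  split; [|apply Lip_mult; [now apply Lip_comp|assumption]].
  apply (bigO_ext 2 (fun h => (f (g z + (g (z + h) - g z)) - f (g z) - f' (g z) * (g (z + h) - g z))
     + f' (g z) * (g (z + h) - g z - g' z * h))%C).
  - intros h. replace (g z + (g (z + h) - g z))%C with (g (z + h)%C) by ring. ring.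
  - apply bigO_plus; [|now apply bigO_scal].
    apply (bigO_comp 2 (fun k => f (g z + k) - f (g z) - f' (g z) * k)%C (fun h => g (z + h) - g z)%C Hf Lg).
Qed.

Lemma Lip_Cinv (z : C) : z <> RtoC 0 -> Lip Cinv z.
Proof.
  intros Hz. assert (Hm := proj1 (Cmod_gt_0 z) Hz).
  (* Within radius [|z| / 2] the modulus of [z + h] stays above [|z| / 2], whence the constant. *)
  exists (2 / (Cmod z * Cmod z)), (Cmod z / 2). split; [|split; [lra|]].
  { apply Rlt_le, Rdiv_lt_0_compat; [lra|nra]. }
  intros h Hh.
  assert (Hr := Cmod_triangle_rev z h).
  assert (Hzh : 0 < Cmod (z + h)) by lra.
  assert (Hn : (z + h)%C <> RtoC 0) by now apply Cmod_gt_0.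
  replace (/ (z + h) - / z)%C with (- (h / (z * (z + h))))%C by (field; auto).
  rewrite Cmod_opp, Cmod_div by now apply Cmult_neq_0. rewrite Cmod_mult, pow_1.
  unfold Rdiv. rewrite Rmult_comm. apply Rmult_le_compat_r; [apply Cmod_ge_0|].
  replace (2 * / (Cmod z * Cmod z)) with (/ (Cmod z * (Cmod z / 2))) by (field; lra).
  apply Rinv_le_contravar; nra.
Qed.

Lemma Cdiff_Cinv (z : C) : z <> RtoC 0 -> Cdiff Cinv (fun x => - (/ x * / x))%C z.
Proof.
  intros Hz. assert (L := Lip_Cinv z Hz). split.
  2:{ eapply Lip_ext; [|apply (Lip_mult _ _ z (Lip_const (-(1))%C z) (Lip_mult _ _ z L L))].
      intros; simpl; ring. }
  assert (Hm := proj1 (Cmod_gt_0 z) Hz).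
  (* The remainder factors as [h] times the increment of the inverse, each of order 1. *)
  apply (bigO_ext_loc 2 (fun h => (- / z) * (h * (/ (z + h) - / z)))%C).
  - exists (Cmod z). split; [exact Hm|]. intros h Hh.
    assert (Hr := Cmod_triangle_rev z h).
    assert (Hn : (z + h)%C <> RtoC 0) by (apply Cmod_gt_0; lra).
    field; auto.
  - apply bigO_scal. apply (bigO_mult 1 1); [apply bigO_id|exact L].
Qed.

Lemma Cdiff_inv (f f' : C -> C) (z : C) : f z <> RtoC 0 -> Cdiff f f' z ->
  Cdiff (fun x => / f x)%C (fun x => - (/ f x * / f x) * f' x)%C z.
Proof. intros Hz Hf. apply (Cdiff_comp Cinv (fun x => - (/ x * / x))%C f f' z Hf). now apply Cdiff_Cinv. Qed.

Lemma bigO_is_derive (f : C -> C) (z l : C) :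
  bigO 2 (fun h => f (z + h) - f z - l * h)%C ->
  is_derive (K := C_AbsRing) (V := C_NormedModule) f z l.
Proof.
  intros [K [d [HK [Hd H]]]]. split.
  - apply is_linear_scal_l.
  - intros y Hy.
    apply (@is_filter_lim_locally_unique C_AbsRing (AbsRing_NormedModule C_AbsRing)) in Hy. subst y.
    intros eps.
    assert (Hpos : 0 < Rmin d (eps / (K + 1))).
    { apply Rmin_pos; [lra|]. apply Rdiv_lt_0_compat; [apply eps|lra]. }
    exists (mkposreal _ Hpos). intros y Hy.
    change (Cmod (y - z) < Rmin d (eps / (K + 1))) in Hy.
    change (Cmod (f y - f z - (y - z) * l) <= eps * Cmod (y - z)).
    specialize (H (y - z)%C).
    assert (E : forall a b : C, (a + (b - a))%C = b) by (intros; ring).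
    rewrite E in H. rewrite (Cmult_comm (y - z) l).
    eapply Rle_trans; [apply H; eapply Rlt_le_trans; [exact Hy|apply Rmin_l]|].
    assert (Hh' : Cmod (y - z) < eps / (K + 1)) by (eapply Rlt_le_trans; [exact Hy|apply Rmin_r]).
    apply (Rmult_lt_compat_r (K + 1)) in Hh'; [|lra].
    replace (eps / (K + 1) * (K + 1)) with (pos eps) in Hh' by (field; lra).
    generalize (Cmod_ge_0 (y - z)). simpl. nra.
Qed.

Lemma Cdiff_C_derive (f f' : C -> C) (z : C) : Cdiff f f' z -> C_derive f z = f' z.
Proof. intros [H _]. apply is_C_derive_unique. now apply bigO_is_derive. Qed.

(** The passage to real analysis: mean value theorems and integrals are applied to real parts along
    the real axis, after multiplication by a suitable constant. *)
Lemma Cdiff_Re_derive (f f' : C -> C) (s : R) : Cdiff f f' (RtoC s) ->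
  is_derive (fun t : R => Re (f (RtoC t))) s (Re (f' (RtoC s))).
Proof.
  intros [[K [d [HK [Hd H]]]] _]. apply is_derive_Reals. intros eps Heps.
  assert (Hpos : 0 < Rmin d (eps / (K + 1))).
  { apply Rmin_pos; [lra|]. apply Rdiv_lt_0_compat; lra. }
  exists (mkposreal _ Hpos). intros h Hh0 Hh. simpl in Hh.
  specialize (H (RtoC h)). rewrite Cmod_R in H.
  assert (H1 := H ltac:(eapply Rlt_le_trans; [exact Hh|apply Rmin_l])).
  rewrite <- RtoC_plus in H1.
  assert (H2 := re_le_Cmod (f (RtoC (s + h)) - f (RtoC s) - f' (RtoC s) * RtoC h)).
  unfold Cminus in H2. rewrite !re_plus, !re_opp, re_scal_r in H2.
  replace ((Re (f (RtoC (s + h))) - Re (f (RtoC s))) / h - Re (f' (RtoC s)))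
    with ((Re (f (RtoC (s + h))) + - Re (f (RtoC s)) + - (Re (f' (RtoC s)) * h)) / h)
    by (field; exact Hh0).
  rewrite Rabs_div by exact Hh0.
  assert (Hah : 0 < Rabs h) by now apply Rabs_pos_lt.
  apply (Rmult_lt_reg_r (Rabs h)); [exact Hah|].
  unfold Rdiv. rewrite Rmult_assoc, Rinv_l, Rmult_1_r by lra.
  assert (Hh' : Rabs h < eps / (K + 1)) by (eapply Rlt_le_trans; [exact Hh|apply Rmin_r]).
  apply (Rmult_lt_compat_r (K + 1)) in Hh'; [|lra].
  replace (eps / (K + 1) * (K + 1)) with eps in Hh' by (field; lra).
  unfold Cminus in H1. simpl in H1. nra.
Qed.

(** * The complex exponential and power series *)

Lemma Rabs_sin_le (t : R) : Rabs (sin t) <= Rabs t.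
Proof.
  assert (P : forall u, 0 < u -> Rabs (sin u) <= u).
  { intros u Hu. destruct (Rle_lt_dec 1 u) as [H1|H1].
    - generalize (SIN_bound u). intros [? ?]. apply Rabs_le. lra.
    - assert (H2 := PI2_1). rewrite Rabs_pos_eq.
      + left; now apply sin_lt_x.
      + left. apply sin_gt_0; lra. }
  destruct (Rtotal_order t 0) as [H|[H|H]].
  - rewrite <- (Rabs_Ropp (sin t)), <- sin_neg, (Rabs_left t H). apply P. lra.
  - subst. rewrite sin_0, Rabs_R0. lra.
  - rewrite (Rabs_pos_eq t) by lra. now apply P.
Qed.

Lemma one_minus_cos_bound (y : R) : 0 <= 1 - cos y <= y ^ 2.
Proof.
  split; [generalize (COS_bound y); lra|].
  replace y with (2 * (y / 2)) at 1 by field. rewrite cos_2a_sin.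
  assert (H := Rabs_sin_le (y / 2)).
  apply Rsqr_le_abs_1 in H. unfold Rsqr in H. nra.
Qed.

Lemma sin_minus_id_bound (y : R) : Rabs y <= 1 -> Rabs (sin y - y) <= y ^ 2.
Proof.
  assert (P : forall u, 0 < u -> u <= 1 -> Rabs (sin u - u) <= u ^ 2).
  { intros u Hu Hu1.
    destruct (MVT_cor2 sin cos 0 u Hu) as [c [Hc [Hc0 Hcu]]].
    { intros; apply derivable_pt_lim_sin. }
    rewrite sin_0 in Hc.
    replace (sin u - u) with (- ((1 - cos c) * u)) by lra.
    generalize (one_minus_cos_bound c). intros [H1 H2].
    rewrite Rabs_Ropp, Rabs_pos_eq by nra. nra. }
  intros Hy. destruct (Rtotal_order y 0) as [H|[H|H]].
  - rewrite Rabs_left in Hy by exact H.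
    specialize (P (- y) ltac:(lra) ltac:(lra)). rewrite sin_neg in P.
    rewrite <- Rabs_Ropp. replace (- (sin y - y)) with (- sin y - - y) by ring.
    replace (y ^ 2) with ((- y) ^ 2) by ring. exact P.
  - subst. rewrite sin_0. replace (0 - 0) with 0 by ring. rewrite Rabs_R0. lra.
  - rewrite Rabs_pos_eq in Hy by lra. now apply P.
Qed.

Lemma exp_minus_bound (x : R) : Rabs x <= 1 / 2 -> 0 <= exp x - 1 - x <= 2 * x ^ 2.
Proof.
  intros Hx. apply Rabs_le_between in Hx.
  assert (H1 := exp_ineq1_le x). assert (H2 := exp_ineq1_le (- x)).
  assert (H3 : exp x * exp (- x) = 1) by (rewrite <- exp_plus; replace (x + - x) with 0 by ring; apply exp_0).
  split; [lra|]. assert (Hp := exp_pos x).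
  assert (exp x * (1 - x) <= 1) by nra.
  nra.
Qed.

Lemma Cexp_plus (z w : C) : Cexp (z + w) = (Cexp z * Cexp w)%C.
Proof.
  unfold Cexp. rewrite re_plus, im_plus, exp_plus, cos_plus, sin_plus.
  unfold Cmult; simpl. f_equal; ring.
Qed.

Lemma Cexp_0 : Cexp (RtoC 0) = RtoC 1.
Proof.
  unfold Cexp, RtoC, Re, Im; simpl. rewrite exp_0, cos_0, sin_0. f_equal; ring.
Qed.

Lemma Cexp_opp (z : C) : (Cexp z * Cexp (- z))%C = RtoC 1.
Proof. rewrite <- Cexp_plus. replace (z + - z)%C with (RtoC 0) by ring. apply Cexp_0. Qed.

Lemma Cexp_nonzero (z : C) : Cexp z <> RtoC 0.
Proof.
  intros E. generalize (Cexp_opp z). rewrite E, Cmult_0_l. intros H. apply C1_nz. now symmetry.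
Qed.

Lemma Cexp_bigO : bigO 2 (fun h => Cexp h - 1 - h)%C.
Proof.
  (* With [h = x + i y] the components contribute at most [2 x^2 + 3/2 y^2] and
     [5/2 x^2 + 2 y^2]. *)
  exists 5, (1 / 2). repeat split; try lra.
  intros h Hh.
  assert (Hx : Rabs (Re h) <= 1 / 2) by (generalize (re_le_Cmod h); lra).
  assert (Hy : Rabs (Im h) <= 1 / 2) by (generalize (im_le_Cmod h); lra).
  rewrite Cmod_sqr. eapply Rle_trans; [apply Cmod_le_Re_Im|].
  unfold Cminus. rewrite !re_plus, !im_plus, !re_opp, !im_opp, re_RtoC, im_RtoC.
  unfold Cexp; simpl Re at 1; simpl Im at 1.
  set (x := Re h) in *. set (y := Im h) in *.
  change (Rabs (exp x * cos y + - (1) + - x) + Rabs (exp x * sin y + - 0 + - y) <= 5 * (x ^ 2 + y ^ 2)).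
  assert (H1 := exp_minus_bound x Hx). assert (H2 := one_minus_cos_bound y).
  assert (H3 := sin_minus_id_bound y ltac:(lra)). apply Rabs_le_between in H3.
  assert (Hc := COS_bound y). assert (Hs := SIN_bound y).
  apply Rabs_le_between in Hx. apply Rabs_le_between in Hy.
  assert (A1 : Rabs (exp x * cos y + - (1) + - x) <= 2 * x ^ 2 + 3 / 2 * y ^ 2).
  { replace (exp x * cos y + - (1) + - x) with ((exp x - 1 - x) * cos y - (1 + x) * (1 - cos y)) by ring.
    apply Rabs_le. split; nra. }
  assert (A2 : Rabs (exp x * sin y + - 0 + - y) <= 2 * x ^ 2 + 3 / 2 * y ^ 2 + (x ^ 2 + y ^ 2) / 2).
  { replace (exp x * sin y + - 0 + - y) with ((exp x - 1 - x) * sin y + (1 + x) * (sin y - y) + x * y) by ring.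
    assert (B : Rabs (x * y) <= (x ^ 2 + y ^ 2) / 2).
    { assert (Q1 := Rle_0_sqr (x + y)). assert (Q2 := Rle_0_sqr (x - y)). unfold Rsqr in Q1, Q2.
      apply Rabs_le. split; lra. }
    assert (B1 : Rabs ((exp x - 1 - x) * sin y) <= 2 * x ^ 2) by (apply Rabs_le; split; nra).
    assert (B2 : Rabs ((1 + x) * (sin y - y)) <= 3 / 2 * y ^ 2) by (apply Rabs_le; split; nra).
    eapply Rle_trans; [apply Rabs_triang|].
    eapply Rle_trans; [apply Rplus_le_compat_r, Rabs_triang|]. lra. }
  nra.
Qed.

Lemma Cdiff_Cexp (z : C) : Cdiff Cexp Cexp z.
Proof.
  assert (H : bigO 2 (fun h => Cexp (z + h) - Cexp z - Cexp z * h)%C).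
  { apply (bigO_ext 2 (fun h => Cexp z * (Cexp h - 1 - h))%C).
    - intros h. rewrite Cexp_plus. ring.
    - apply bigO_scal, Cexp_bigO. }
  split; [exact H|].
  apply (bigO_ext 1 (fun h => (Cexp (z + h) - Cexp z - Cexp z * h) + Cexp z * h)%C).
  - intros; ring.
  - apply bigO_plus; [apply (bigO_weaken 1 2); [lia|exact H]|apply bigO_scal, bigO_id].
Qed.

(** * Complex series and power series *)

Fixpoint Cpartial (a : nat -> C) (n : nat) : C :=
  match n with O => RtoC 0 | S m => (Cpartial a m + a m)%C end.

Fixpoint Rpartial (a : nat -> R) (n : nat) : R :=
  match n with O => 0 | S m => Rpartial a m + a m end.

Definition Cseries (a : nat -> C) (l : C) : Prop :=
  forall eps, 0 < eps -> exists N, forall n, (N <= n)%nat -> Cmod (Cpartial a n - l) < eps.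

(** The indices differ by one: [Cpartial a n] has [n] terms, so inductions start at the empty
    sum. *)
Lemma sum_n_Cpartial (a : nat -> C) (n : nat) :
  sum_n (G := C_AbelianMonoid) a n = Cpartial a (S n).
Proof.
  induction n as [|n IH].
  - rewrite sum_O. simpl. ring.
  - rewrite sum_Sn, IH. reflexivity.
Qed.

Lemma sum_n_Rpartial (a : nat -> R) (n : nat) : sum_n a n = Rpartial a (S n).
Proof.
  induction n as [|n IH].
  - rewrite sum_O. simpl. ring.
  - rewrite sum_Sn, IH. reflexivity.
Qed.

Lemma Cseries_is_series (a : nat -> C) (l : C) :
  Cseries a l <-> is_series (K := C_AbsRing) (V := C_NormedModule) a l.
Proof.
  split.
  - intros H P [eps HP]. destruct (H eps (cond_pos eps)) as [N HN].
    exists N. intros n Hn. apply HP. rewrite sum_n_Cpartial.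
    apply C_NormedModule_mixin_compat1. apply HN. lia.
  - intros H eps Heps.
    (* Balls of [C] are taken componentwise, so each component gets half of [eps]. *)
    assert (He : 0 < eps / 2) by lra.
    destruct (H (fun y => ball l (mkposreal _ He) y)) as [N HN].
    { exists (mkposreal _ He). auto. }
    exists (S N). intros n Hn. destruct n as [|n]; [lia|].
    specialize (HN n ltac:(lia)). rewrite sum_n_Cpartial in HN. destruct HN as [H1 H2].
    change (Rabs (Re (Cpartial a (S n)) - Re l) < eps / 2) in H1.
    change (Rabs (Im (Cpartial a (S n)) - Im l) < eps / 2) in H2.
    eapply Rle_lt_trans; [apply Cmod_le_Re_Im|].
    unfold Cminus. rewrite re_plus, im_plus, re_opp, im_opp.
    unfold Rminus in H1, H2. lra.
Qed.

Lemma Cseries_ext (a b : nat -> C) (l : C) : (forall n, a n = b n) -> Cseries a l -> Cseries b l.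
Proof.
  intros E H eps He. destruct (H eps He) as [N HN]. exists N. intros n Hn.
  replace (Cpartial b n) with (Cpartial a n); [now apply HN|].
  clear - E. induction n; simpl; congruence.
Qed.

Lemma pow_n_Cpow (z : C) (n : nat) : pow_n (K := C_Ring) z n = (z ^ n)%C.
Proof. induction n as [|n IH]; [reflexivity|]. simpl. now rewrite IH. Qed.

Lemma Cseries_is_pseries (c : nat -> C) (z l : C) :
  Cseries (fun n => c n * z ^ n)%C l <-> is_pseries (K := C_AbsRing) (V := C_NormedModule) c z l.
Proof.
  unfold is_pseries.
  assert (E : forall n, (c n * z ^ n)%C = scal (V := C_NormedModule) (pow_n (K := C_Ring) z n) (c n)).
  { intros n. rewrite Cmult_comm, <- pow_n_Cpow. reflexivity. }
  split.
  - intros H. apply Cseries_is_series. now apply (Cseries_ext _ _ _ E).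
  - intros H. apply Cseries_is_series in H. apply (Cseries_ext _ _ _ (fun n => eq_sym (E n)) H).
Qed.

Lemma Cseries_unique (a : nat -> C) (l m : C) : Cseries a l -> Cseries a m -> l = m.
Proof.
  intros H1 H2. apply Ceq_minus, Cmod_eq_0. apply Rle_antisym; [|apply Cmod_ge_0].
  apply le_epsilon. intros eps He. rewrite Rplus_0_l.
  destruct (H1 (eps / 2)) as [N1 HN1]; [lra|]. destruct (H2 (eps / 2)) as [N2 HN2]; [lra|].
  specialize (HN1 (max N1 N2) ltac:(lia)). specialize (HN2 (max N1 N2) ltac:(lia)).
  rewrite Cmod_minus_sym in HN1. set (p := Cpartial a (max N1 N2)) in *.
  replace (l - m)%C with ((l - p) + (p - m))%C by ring.
  eapply Rle_trans; [apply Cmod_triangle|]. lra.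
Qed.

Lemma Cseries_plus (a b : nat -> C) (l m : C) :
  Cseries a l -> Cseries b m -> Cseries (fun n => a n + b n)%C (l + m)%C.
Proof.
  intros H1 H2 eps He.
  destruct (H1 (eps / 2)) as [N1 HN1]; [lra|]. destruct (H2 (eps / 2)) as [N2 HN2]; [lra|].
  exists (max N1 N2). intros n Hn.
  specialize (HN1 n ltac:(lia)). specialize (HN2 n ltac:(lia)).
  replace (Cpartial (fun n => a n + b n)%C n) with (Cpartial a n + Cpartial b n)%C.
  2:{ clear. induction n; simpl; [ring|]. rewrite <- IHn. ring. }
  replace (Cpartial a n + Cpartial b n - (l + m))%C
    with ((Cpartial a n - l) + (Cpartial b n - m))%C by ring.
  eapply Rle_lt_trans; [apply Cmod_triangle|]. lra.
Qed.

Lemma Cpartial_scal (k : C) (a : nat -> C) (n : nat) :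
  Cpartial (fun n => k * a n)%C n = (k * Cpartial a n)%C.
Proof. induction n as [|n IH]; simpl; [ring|]. rewrite IH. ring. Qed.

Lemma Cseries_scal (k : C) (a : nat -> C) (l : C) :
  Cseries a l -> Cseries (fun n => k * a n)%C (k * l)%C.
Proof.
  intros H eps He. assert (Hk := Cmod_ge_0 k).
  destruct (H (eps / (Cmod k + 1))) as [N HN]; [apply Rdiv_lt_0_compat; lra|].
  exists N. intros n Hn. specialize (HN n Hn). rewrite Cpartial_scal.
  replace (k * Cpartial a n - k * l)%C with (k * (Cpartial a n - l))%C by ring.
  rewrite Cmod_mult.
  apply (Rmult_lt_compat_r (Cmod k + 1)) in HN; [|lra].
  replace (eps / (Cmod k + 1) * (Cmod k + 1)) with eps in HN by (field; lra).
  generalize (Cmod_ge_0 (Cpartial a n - l)). nra.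
Qed.

Lemma Cseries_minus (a b : nat -> C) (l m : C) :
  Cseries a l -> Cseries b m -> Cseries (fun n => a n - b n)%C (l - m)%C.
Proof.
  intros H1 H2. apply (Cseries_scal (-(1))%C) in H2.
  assert (H := Cseries_plus _ _ _ _ H1 H2).
  replace (l - m)%C with (l + - (1) * m)%C by ring.
  eapply Cseries_ext; [|exact H]. intros; simpl; ring.
Qed.

Lemma Cpartial_shift (a : nat -> C) (n : nat) :
  Cpartial a (S n) = (a 0%nat + Cpartial (fun k => a (S k)) n)%C.
Proof.
  induction n as [|n IH]; [simpl; ring|].
  change (Cpartial a (S (S n))) with (Cpartial a (S n) + a (S n))%C. rewrite IH. simpl. ring.
Qed.

Lemma Cseries_shift (a : nat -> C) (l : C) :
  Cseries a l <-> Cseries (fun n => a (S n)) (l - a 0%nat)%C.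
Proof.
  split; intros H eps He; destruct (H eps He) as [N HN].
  - exists N. intros n Hn. specialize (HN (S n) ltac:(lia)). rewrite Cpartial_shift in HN.
    match goal with |- Cmod ?x < _ => match type of HN with Cmod ?y < _ => replace x with y by ring end end.
    exact HN.
  - exists (S N). intros n Hn. destruct n as [|n]; [lia|]. specialize (HN n ltac:(lia)).
    rewrite Cpartial_shift.
    match goal with |- Cmod ?x < _ => match type of HN with Cmod ?y < _ => replace x with y by ring end end.
    exact HN.
Qed.

Lemma Cseries_bound (a : nat -> C) (l : C) (B : R) :
  Cseries a l -> (forall n, Cmod (Cpartial a n) <= B) -> Cmod l <= B.
Proof.
  intros H HB. apply le_epsilon. intros eps He. destruct (H eps He) as [N HN].
  specialize (HN N (le_n N)). specialize (HB N).
  replace l with (Cpartial a N + - (Cpartial a N - l))%C by ring.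
  eapply Rle_trans; [apply Cmod_triangle|]. rewrite Cmod_opp. lra.
Qed.

Lemma Cpartial_Rpartial (a : nat -> C) (b : nat -> R) (n : nat) :
  (forall k, Cmod (a k) <= b k) -> Cmod (Cpartial a n) <= Rpartial b n.
Proof.
  intros H. induction n as [|n IH]; simpl; [rewrite Cmod_0; lra|].
  eapply Rle_trans; [apply Cmod_triangle|]. specialize (H n). lra.
Qed.

Lemma Rpartial_le (a b : nat -> R) (n : nat) :
  (forall k, a k <= b k) -> Rpartial a n <= Rpartial b n.
Proof. intros H. induction n as [|n IH]; simpl; [lra|]. specialize (H n). lra. Qed.

Lemma Rpartial_scal (k : R) (a : nat -> R) (n : nat) :
  Rpartial (fun n => k * a n) n = k * Rpartial a n.
Proof. induction n as [|n IH]; simpl; [ring|]. rewrite IH. ring. Qed.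

Lemma Rpartial_shift (a : nat -> R) (n : nat) :
  Rpartial a (S n) = a 0%nat + Rpartial (fun k => a (S k)) n.
Proof.
  induction n as [|n IH]; [simpl; ring|].
  change (Rpartial a (S (S n))) with (Rpartial a (S n) + a (S n)). rewrite IH. simpl. ring.
Qed.

Lemma Rpartial_geom (q : R) (n : nat) : 0 <= q < 1 -> Rpartial (fun k => q ^ k) n <= / (1 - q).
Proof.
  intros Hq. assert (E : (1 - q) * Rpartial (fun k => q ^ k) n = 1 - q ^ n).
  { induction n as [|n IH]; simpl; [ring|]. rewrite Rmult_plus_distr_l, IH. ring. }
  assert (0 <= q ^ n) by (apply pow_le; lra).
  apply (Rmult_le_reg_l (1 - q)); [lra|]. rewrite E, Rinv_r by lra. lra.
Qed.

(** Each of the [n] terms [q^k] with [k < n] is at least [q^n], so the geometric sum dominates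
    [n q^n]. *)
Lemma INR_pow_bound (q : R) (n : nat) : 0 <= q < 1 -> INR n * q ^ n <= / (1 - q).
Proof.
  intros Hq. eapply Rle_trans; [|apply (Rpartial_geom q n Hq)].
  assert (P : forall m, (m <= n)%nat -> INR m * q ^ n <= Rpartial (fun k => q ^ k) m).
  { induction m as [|m IH]; intros Hm; [simpl; lra|].
    rewrite S_INR. simpl. specialize (IH ltac:(lia)).
    assert (q ^ n <= q ^ m).
    { replace n with (m + (n - m))%nat by lia. rewrite pow_add.
      rewrite <- (Rmult_1_r (q ^ m)) at 2. apply Rmult_le_compat_l; [apply pow_le; lra|].
      rewrite <- (pow1 (n - m)). apply pow_incr. lra. }
    lra. }
  now apply P.
Qed.

(** A total function; absolute convergence is what makes it the actual sum. *)
Definition Csum (a : nat -> C) : C :=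
  (Series (fun n => Re (a n)), Series (fun n => Im (a n))).

Lemma Cseries_abs (a : nat -> C) (b : nat -> R) :
  (forall n, Cmod (a n) <= b n) -> ex_series b -> Cseries a (Csum a).
Proof.
  intros Hab Hb.
  assert (H1 : is_series (fun n => Re (a n)) (Re (Csum a))).
  { apply Series_correct. apply (ex_series_le (V := R_CompleteNormedModule) _ b); [|exact Hb].
    intros n. eapply Rle_trans; [apply re_le_Cmod|apply Hab]. }
  assert (H2 : is_series (fun n => Im (a n)) (Im (Csum a))).
  { apply Series_correct. apply (ex_series_le (V := R_CompleteNormedModule) _ b); [|exact Hb].
    intros n. eapply Rle_trans; [apply im_le_Cmod|apply Hab]. }
  intros eps He. assert (He2 : 0 < eps / 2) by lra.
  destruct (H1 (fun y => Rabs (y - Re (Csum a)) < eps / 2)) as [N1 HN1].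
  { exists (mkposreal _ He2). intros y Hy. exact Hy. }
  destruct (H2 (fun y => Rabs (y - Im (Csum a)) < eps / 2)) as [N2 HN2].
  { exists (mkposreal _ He2). intros y Hy. exact Hy. }
  exists (S (max N1 N2)). intros n Hn. destruct n as [|n]; [lia|].
  specialize (HN1 n ltac:(lia)). specialize (HN2 n ltac:(lia)).
  rewrite sum_n_Rpartial in HN1, HN2.
  assert (E1 : forall m, Re (Cpartial a m) = Rpartial (fun n => Re (a n)) m).
  { induction m as [|m IH]; [reflexivity|]. simpl Cpartial. rewrite re_plus, IH. reflexivity. }
  assert (E2 : forall m, Im (Cpartial a m) = Rpartial (fun n => Im (a n)) m).
  { induction m as [|m IH]; [reflexivity|]. simpl Cpartial. rewrite im_plus, IH. reflexivity. }
  eapply Rle_lt_trans; [apply Cmod_le_Re_Im|].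
  unfold Cminus. rewrite re_plus, im_plus, re_opp, im_opp, E1, E2.
  unfold Rminus in HN1, HN2. lra.
Qed.

(* The radius of convergence is at least [R0]. *)
Definition cvdisk (c : nat -> C) (R0 : R) : Prop :=
  forall rho, 0 < rho < R0 -> exists M, forall n, Cmod (c n) * rho ^ n <= M.

Lemma Cseries_terms_bounded (a : nat -> C) (l : C) :
  Cseries a l -> exists M, forall n, Cmod (a n) <= M.
Proof.
  intros H. destruct (H 1 ltac:(lra)) as [N HN].
  assert (P : forall m, exists M, 0 <= M /\ forall n, (n < m)%nat -> Cmod (a n) <= M).
  { induction m as [|m [M [HM IH]]]; [exists 0; split; [lra|lia]|].
    exists (M + Cmod (a m)). generalize (Cmod_ge_0 (a m)). intros ?. split; [lra|].
    intros n Hn. destruct (Nat.eq_dec n m) as [->|Hne]; [lra|].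
    specialize (IH n ltac:(lia)). lra. }
  destruct (P N) as [M [HM HP]]. exists (M + 2). intros n.
  destruct (Compare_dec.le_lt_dec N n) as [Hn|Hn].
  - assert (H1 := HN n Hn). assert (H2 := HN (S n) ltac:(lia)). simpl in H2.
    replace (a n) with ((Cpartial a n + a n - l) - (Cpartial a n - l))%C by ring.
    eapply Rle_trans; [apply Cmod_triangle_minus|]. lra.
  - specialize (HP n Hn). lra.
Qed.

Lemma Cseries_cvdisk (c : nat -> C) (f : C -> C) (R0 : R) :
  (forall z, Cmod z < R0 -> Cseries (fun n => c n * z ^ n)%C (f z)) -> cvdisk c R0.
Proof.
  intros H rho Hrho.
  assert (E : Cmod (RtoC rho) = rho) by (rewrite Cmod_R; apply Rabs_pos_eq; lra).
  destruct (Cseries_terms_bounded _ _ (H (RtoC rho) ltac:(lra))) as [M HM].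
  exists M. intros n. specialize (HM n). now rewrite Cmod_mult, Cmod_pow, E in HM.
Qed.

Lemma cvdisk_abs (c : nat -> C) (R0 s : R) : cvdisk c R0 -> 0 <= s < R0 ->
  exists M q, 0 <= M /\ 0 <= q < 1 /\ forall n, Cmod (c n) * s ^ n <= M * q ^ n.
Proof.
  intros H Hs. set (rho := (s + R0) / 2). assert (Hr : s < rho < R0) by (unfold rho; lra).
  destruct (H rho ltac:(lra)) as [M HM].
  exists M, (s / rho). split; [|split].
  - specialize (HM 0%nat). simpl in HM. generalize (Cmod_ge_0 (c 0%nat)). lra.
  - split; [apply Rdiv_le_0_compat; lra|]. apply (Rmult_lt_reg_r rho); [lra|].
    unfold Rdiv. rewrite Rmult_assoc, Rinv_l; lra.
  - intros n. replace s with (rho * (s / rho)) at 1 by (field; lra).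
    rewrite Rpow_mult_distr, <- Rmult_assoc. apply Rmult_le_compat_r; [|apply HM].
    apply pow_le, Rdiv_le_0_compat; lra.
Qed.

Lemma cvdisk_abs_sum (c : nat -> C) (R0 s : R) : cvdisk c R0 -> 0 <= s < R0 ->
  exists B, forall N, Rpartial (fun n => Cmod (c n) * s ^ n) N <= B.
Proof.
  intros H Hs. destruct (cvdisk_abs c R0 s H Hs) as [M [q [HM [Hq Hb]]]].
  exists (M * / (1 - q)). intros N. eapply Rle_trans; [apply Rpartial_le, Hb|].
  rewrite Rpartial_scal. apply Rmult_le_compat_l; [exact HM|]. now apply Rpartial_geom.
Qed.

Definition PS (c : nat -> C) (z : C) : C := Csum (fun n => c n * z ^ n)%C.

Lemma PS_correct (c : nat -> C) (R0 : R) (z : C) :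
  cvdisk c R0 -> Cmod z < R0 -> Cseries (fun n => c n * z ^ n)%C (PS c z).
Proof.
  intros H Hz. destruct (cvdisk_abs c R0 (Cmod z) H) as [M [q [HM [Hq Hb]]]].
  { split; [apply Cmod_ge_0|exact Hz]. }
  apply (Cseries_abs _ (fun n => M * q ^ n)).
  - intros n. rewrite Cmod_mult, Cmod_pow. apply Hb.
  - apply (ex_series_scal_l M (fun n => q ^ n)). apply ex_series_geom. rewrite Rabs_pos_eq; lra.
Qed.

Lemma cvdisk_INR (c : nat -> C) (R0 : R) :
  cvdisk c R0 -> cvdisk (fun n => RtoC (INR n) * c n)%C R0.
Proof.
  intros H rho Hrho. destruct (cvdisk_abs c R0 rho H ltac:(lra)) as [M [q [HM [Hq Hb]]]].
  exists (M * / (1 - q)). intros n. rewrite Cmod_mult, Cmod_R, Rabs_pos_eq by apply pos_INR.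
  rewrite Rmult_assoc.
  apply (Rle_trans _ (M * (INR n * q ^ n))).
  - replace (M * (INR n * q ^ n)) with (INR n * (M * q ^ n)) by ring.
    apply Rmult_le_compat_l; [apply pos_INR|apply Hb].
  - apply Rmult_le_compat_l; [exact HM|now apply INR_pow_bound].
Qed.

Lemma cvdisk_shift (c : nat -> C) (R0 : R) : cvdisk c R0 -> cvdisk (fun n => c (S n)) R0.
Proof.
  intros H rho Hrho. destruct (H rho Hrho) as [M HM]. exists (M / rho). intros n.
  apply (Rmult_le_reg_r rho); [lra|]. unfold Rdiv. rewrite (Rmult_assoc M), Rinv_l, Rmult_1_r by lra.
  specialize (HM (S n)). simpl in HM. lra.
Qed.

Definition dcoef (c : nat -> C) (n : nat) : C := (RtoC (INR (S n)) * c (S n))%C.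

Lemma cvdisk_dcoef (c : nat -> C) (R0 : R) : cvdisk c R0 -> cvdisk (dcoef c) R0.
Proof. intros H. exact (cvdisk_shift _ _ (cvdisk_INR c R0 H)). Qed.

(** The remainders satisfy [G_(n+1) = (z + h) G_n + (n + 1) z^n h^2]. The factor [s] on the left
    avoids the exponent [n - 1] on the right, which would be truncated at [n = 0]. *)
Lemma Cpow_Taylor_bound (z h : C) (s : R) (n : nat) :
  0 < s -> Cmod z <= s -> Cmod (z + h) <= s ->
  Cmod ((z + h) ^ S n - z ^ S n - RtoC (INR (S n)) * z ^ n * h) * s
    <= INR n * INR (S n) * Cmod h ^ 2 * s ^ n.
Proof.
  intros Hs Hz Hzh. induction n as [|n IH].
  - replace ((z + h) ^ 1 - z ^ 1 - RtoC (INR 1) * z ^ 0 * h)%C with (RtoC 0).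
    2:{ simpl. ring. }
    rewrite Cmod_0. simpl. lra.
  - set (G := ((z + h) ^ S n - z ^ S n - RtoC (INR (S n)) * z ^ n * h)%C) in *.
    replace ((z + h) ^ S (S n) - z ^ S (S n) - RtoC (INR (S (S n))) * z ^ S n * h)%C
      with ((z + h) * G + RtoC (INR (S n)) * z ^ n * h ^ 2)%C.
    2:{ unfold G. rewrite (S_INR (S n)), RtoC_plus. simpl. ring. }
    assert (H1 : Cmod ((z + h) * G + RtoC (INR (S n)) * z ^ n * h ^ 2)
       <= s * Cmod G + INR (S n) * s ^ n * Cmod h ^ 2).
    { eapply Rle_trans; [apply Cmod_triangle|]. rewrite !Cmod_mult, !Cmod_pow, Cmod_R.
      rewrite (Rabs_pos_eq (INR (S n))) by apply pos_INR.
      apply Rplus_le_compat.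
      - apply Rmult_le_compat_r; [apply Cmod_ge_0|exact Hzh].
      - apply Rmult_le_compat_r; [apply pow_le, Cmod_ge_0|].
        apply Rmult_le_compat_l; [apply pos_INR|].
        apply pow_incr. split; [apply Cmod_ge_0|exact Hz]. }
    apply (Rmult_le_compat_r s) in H1; [|lra].
    eapply Rle_trans; [exact H1|].
    apply (Rmult_le_compat_r s) in IH; [|lra].
    rewrite (S_INR (S n)), (S_INR n) in *. simpl (s ^ S n).
    assert (Hn := pos_INR n). assert (0 <= Cmod h ^ 2) by (apply pow_le, Cmod_ge_0).
    assert (0 < s ^ n) by now apply pow_lt.
    assert (0 <= Cmod h ^ 2 * s ^ n * s) by (apply Rmult_le_pos; [apply Rmult_le_pos|]; lra).
    nra.
Qed.

(** Sums [Cpow_Taylor_bound] over the terms. Its quadratic factor in the index is harmless because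
    [cvdisk_INR] can be applied twice. The zeroth terms are dropped first, so that the series of
    values aligns with that of the derivative. *)
Lemma PS_bigO (c : nat -> C) (R0 : R) (z : C) : cvdisk c R0 -> Cmod z < R0 ->
  bigO 2 (fun h => PS c (z + h) - PS c z - PS (dcoef c) z * h)%C.
Proof.
  intros H Hz. set (s := (Cmod z + R0) / 2).
  assert (Hz0 := Cmod_ge_0 z).
  assert (Hs : Cmod z < s < R0) by (unfold s; lra).
  destruct (cvdisk_abs_sum _ R0 s (cvdisk_INR _ _ (cvdisk_INR _ _ H)) ltac:(lra)) as [B HB].
  exists (B / (s * s)), (s - Cmod z). split; [|split; [lra|]].
  { apply Rdiv_le_0_compat; [|nra]. specialize (HB 0%nat). simpl in HB. lra. }
  intros h Hh.
  assert (Hzh : Cmod (z + h) <= s) by (generalize (Cmod_triangle z h); lra).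
  assert (S1 := proj1 (Cseries_shift _ _) (PS_correct c R0 (z + h) H ltac:(lra))).
  assert (S2 := proj1 (Cseries_shift _ _) (PS_correct c R0 z H Hz)).
  assert (S3 := Cseries_scal h _ _ (PS_correct _ R0 z (cvdisk_dcoef _ _ H) Hz)).
  assert (S4 := Cseries_minus _ _ _ _ (Cseries_minus _ _ _ _ S1 S2) S3). clear S1 S2 S3.
  replace (PS c (z + h) - PS c z - PS (dcoef c) z * h)%C with
    (PS c (z + h) - c 0%nat * (z + h) ^ 0 - (PS c z - c 0%nat * z ^ 0) - h * PS (dcoef c) z)%C
    by (simpl; ring).
  apply (Cseries_bound _ _ _ S4). clear S4. intros N.
  eapply Rle_trans.
  { apply (Cpartial_Rpartial _ (fun n => (Cmod h ^ 2 / (s * s)) *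
      (Cmod (RtoC (INR (S n)) * (RtoC (INR (S n)) * c (S n))) * s ^ S n))).
    intros n.
    replace (c (S n) * (z + h) ^ S n - c (S n) * z ^ S n - h * (dcoef c n * z ^ n))%C
      with (c (S n) * ((z + h) ^ S n - z ^ S n - RtoC (INR (S n)) * z ^ n * h))%C
      by (unfold dcoef; ring).
    rewrite !Cmod_mult, Cmod_R, Rabs_pos_eq by apply pos_INR.
    assert (T := Cpow_Taylor_bound z h s n ltac:(lra) ltac:(lra) Hzh).
    set (G := Cmod ((z + h) ^ S n - z ^ S n - RtoC (INR (S n)) * z ^ n * h)) in *.
    replace (Cmod h ^ 2 / (s * s) * (INR (S n) * (INR (S n) * Cmod (c (S n))) * s ^ S n))
      with (Cmod (c (S n)) * (INR (S n) * INR (S n) * Cmod h ^ 2 * s ^ n / s))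
      by (simpl; field; lra).
    apply Rmult_le_compat_l; [apply Cmod_ge_0|].
    apply (Rmult_le_reg_r s); [lra|]. unfold Rdiv. rewrite (Rmult_assoc _ (/ s)), Rinv_l, Rmult_1_r by lra.
    eapply Rle_trans; [exact T|].
    assert (0 <= Cmod h ^ 2 * s ^ n).
    { apply Rmult_le_pos; apply pow_le; [apply Cmod_ge_0|lra]. }
    rewrite !(Rmult_assoc (_ * INR (S n))). apply Rmult_le_compat_r; [assumption|].
    apply Rmult_le_compat_r; [apply pos_INR|]. rewrite S_INR. lra. }
  rewrite Rpartial_scal.
  assert (Rpartial (fun n => Cmod (RtoC (INR (S n)) * (RtoC (INR (S n)) * c (S n))) * s ^ S n) N <= B).
  { specialize (HB (S N)). rewrite Rpartial_shift in HB.
    assert (0 <= Cmod (RtoC (INR 0) * (RtoC (INR 0) * c 0%nat)) * s ^ 0).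
    { simpl pow. rewrite Rmult_1_r. apply Cmod_ge_0. }
    lra. }
  replace (B / (s * s) * Cmod h ^ 2) with (Cmod h ^ 2 / (s * s) * B) by (field; lra).
  apply Rmult_le_compat_l; [|assumption].
  apply Rdiv_le_0_compat; [apply pow_le, Cmod_ge_0|nra].
Qed.

Lemma Cdiff_PS (c : nat -> C) (R0 : R) (z : C) : cvdisk c R0 -> Cmod z < R0 ->
  Cdiff (PS c) (PS (dcoef c)) z.
Proof.
  intros H Hz. split; [now apply (PS_bigO c R0)|].
  apply cvdisk_dcoef in H. assert (B := PS_bigO _ R0 z H Hz).
  apply (bigO_ext 1 (fun h => (PS (dcoef c) (z + h) - PS (dcoef c) z - PS (dcoef (dcoef c)) z * h)
    + PS (dcoef (dcoef c)) z * h)%C).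
  - intros; ring.
  - apply bigO_plus; [apply (bigO_weaken 1 2); [lia|exact B]|apply bigO_scal, bigO_id].
Qed.

Lemma PS_0 (c : nat -> C) (R0 : R) : 0 < R0 -> cvdisk c R0 -> PS c (RtoC 0) = c 0%nat.
Proof.
  intros HR H. apply (Cseries_unique (fun n => c n * (RtoC 0) ^ n)%C).
  - apply (PS_correct c R0); [exact H|rewrite Cmod_0; exact HR].
  - intros eps He. exists 1%nat. intros n Hn. destruct n as [|n]; [lia|].
    rewrite Cpartial_shift.
    replace (Cpartial (fun k => (c (S k) * RtoC 0 ^ S k)%C) n) with (RtoC 0).
    + simpl. replace (c 0%nat * 1 + 0 - c 0%nat)%C with (RtoC 0) by ring. now rewrite Cmod_0.
    + clear. induction n as [|n IH]; [reflexivity|].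
      change (RtoC 0 = (Cpartial (fun k => (c (S k) * RtoC 0 ^ S k)%C) n + c (S n) * RtoC 0 ^ S n)%C).
      rewrite <- IH. simpl. ring.
Qed.

(** * Uniqueness of coefficients and circular means *)

(** The point 0 is left out of the hypothesis because the induction in [Cseries_zero_coef] divides
    the shifted series by [z]. *)
Lemma Cseries_zero_coef0 (e : nat -> C) (r : R) : 0 < r ->
  (forall z, z <> RtoC 0 -> Cmod z < r -> Cseries (fun n => e n * z ^ n)%C (RtoC 0)) ->
  e 0%nat = RtoC 0.
Proof.
  intros Hr H.
  assert (Hcv : cvdisk e r).
  { intros rho Hrho.
    assert (E : Cmod (RtoC rho) = rho) by (rewrite Cmod_R; apply Rabs_pos_eq; lra).
    destruct (Cseries_terms_bounded _ _ (H (RtoC rho) ltac:(intros X; apply RtoC_inj in X; lra) ltac:(lra))) as [M HM].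
    exists M. intros k. specialize (HM k). now rewrite Cmod_mult, Cmod_pow, E in HM. }
  assert (L : Lip (PS e) (RtoC 0)).
  { apply (Cdiff_Lip _ (PS (dcoef e))), (Cdiff_PS e r); [exact Hcv|now rewrite Cmod_0]. }
  (* Multiplying by [h] lets the estimate ignore the point [h = 0], where nothing is assumed. *)
  apply (bigO_coef_zero 1).
  apply (bigO_ext_loc 2 (fun h => - (1) * (h * (PS e (0 + h) - PS e 0)))%C).
  - exists r. split; [exact Hr|]. intros h Hh.
    rewrite (PS_0 e r Hr Hcv), Cplus_0_l.
    destruct (Ceq_dec h (RtoC 0)) as [->|Hh0]; [simpl; ring|].
    replace (PS e h) with (RtoC 0); [simpl; ring|].
    apply (Cseries_unique (fun n => e n * h ^ n)%C); [now apply H|now apply (PS_correct e r)].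
  - apply bigO_scal. apply (bigO_mult 1 1); [apply bigO_id|exact L].
Qed.

Lemma Cseries_zero_coef (e : nat -> C) (r : R) (n : nat) : 0 < r ->
  (forall z, z <> RtoC 0 -> Cmod z < r -> Cseries (fun n => e n * z ^ n)%C (RtoC 0)) ->
  e n = RtoC 0.
Proof.
  intros Hr. revert e. induction n as [|n IH]; intros e H; [now apply (Cseries_zero_coef0 e r)|].
  apply (IH (fun k => e (S k))). intros z Hz Hzr.
  assert (E0 := Cseries_zero_coef0 e r Hr H).
  assert (S := proj1 (Cseries_shift _ _) (H z Hz Hzr)). simpl in S. rewrite E0 in S.
  apply (Cseries_scal (/ z)%C) in S.
  replace (/ z * (0 - 0 * 1))%C with (RtoC 0) in S by ring.
  eapply Cseries_ext; [|exact S]. intros k; simpl. field. exact Hz.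
Qed.

Lemma Cseries_coef_unique (c d : nat -> C) (f : C -> C) (r : R) (n : nat) : 0 < r ->
  (forall z, Cmod z < r -> Cseries (fun n => c n * z ^ n)%C (f z)) ->
  (forall z, Cmod z < r -> Cseries (fun n => d n * z ^ n)%C (f z)) ->
  c n = d n.
Proof.
  intros Hr Hc Hd. apply Ceq_minus.
  apply (Cseries_zero_coef (fun n => c n - d n)%C r n Hr). intros z _ Hz.
  assert (S := Cseries_minus _ _ _ _ (Hc z Hz) (Hd z Hz)).
  replace (f z - f z)%C with (RtoC 0) in S by ring.
  eapply Cseries_ext; [|exact S]. intros k; simpl; ring.
Qed.

(** * Means over circles *)

Lemma Lip_continuous_Re (G : C -> C) (t : R) :
  Lip G (RtoC t) -> continuous (fun s : R => Re (G (RtoC s))) t.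
Proof.
  intros L. apply continuity_pt_filterlim. intros eps He.
  destruct (bigO_small _ eps L He) as [d [Hd H]]. exists d. split; [exact Hd|].
  intros s [_ Hs]. simpl in *. unfold R_dist in *. unfold Rminus.
  rewrite <- re_opp, <- re_plus. eapply Rle_lt_trans; [apply re_le_Cmod|].
  specialize (H (RtoC (s - t))). rewrite Cmod_R in H. specialize (H Hs).
  rewrite <- RtoC_plus in H. replace (t + (s - t)) with s in H by ring. exact H.
Qed.

(** The angle is a complex variable of [G], although only real angles enter, so that [Lip] and
    [Cdiff] apply to integrands directly. *)
Definition mean (G : C -> C) : C :=
  (RInt (fun t => Re (G (RtoC t))) 0 (2 * PI) / (2 * PI),
   RInt (fun t => Im (G (RtoC t))) 0 (2 * PI) / (2 * PI)).

Definition LipR (G : C -> C) : Prop := forall t : R, Lip G (RtoC t).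

Lemma LipR_ex_RInt (G : C -> C) (a b : R) : LipR G -> ex_RInt (fun t => Re (G (RtoC t))) a b.
Proof.
  intros L. apply (ex_RInt_continuous (V := R_CompleteNormedModule)).
  intros t _. now apply Lip_continuous_Re.
Qed.

(** Integral facts are proved for real parts only; replacing [G] by [-i G] transfers them to
    imaginary parts. *)
Lemma Im_as_Re (z : C) : Im z = Re (- Ci * z)%C.
Proof. rewrite re_mult. unfold Ci; simpl. ring. Qed.

Lemma LipR_scal (k : C) (G : C -> C) : LipR G -> LipR (fun s => k * G s)%C.
Proof. intros L t. apply Lip_mult; [apply Lip_const|apply L]. Qed.

Lemma LipR_plus (G H : C -> C) : LipR G -> LipR H -> LipR (fun s => G s + H s)%C.
Proof. intros LG LH t. now apply Lip_plus. Qed.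

Lemma LipR_mult (G H : C -> C) : LipR G -> LipR H -> LipR (fun s => G s * H s)%C.
Proof. intros LG LH t. now apply Lip_mult. Qed.

Lemma LipR_ex_RInt_Im (G : C -> C) (a b : R) : LipR G -> ex_RInt (fun t => Im (G (RtoC t))) a b.
Proof.
  intros L. apply (ex_RInt_ext (fun t => Re (- Ci * G (RtoC t))%C)).
  - intros; symmetry; apply Im_as_Re.
  - now apply (LipR_ex_RInt (fun s => - Ci * G s)%C), LipR_scal.
Qed.

Lemma mean_ext (G H : C -> C) : (forall t : R, G (RtoC t) = H (RtoC t)) -> mean G = mean H.
Proof.
  intros E. unfold mean. f_equal; f_equal; apply RInt_ext; intros t _; now rewrite E.
Qed.

Lemma RInt_ext_R (f g : R -> R) (a b : R) : (forall t, f t = g t) -> RInt f a b = RInt g a b.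
Proof. intros E. apply RInt_ext. intros; apply E. Qed.

Lemma RInt_plus_R (f g : R -> R) (a b : R) : ex_RInt f a b -> ex_RInt g a b ->
  RInt (fun t => f t + g t) a b = RInt f a b + RInt g a b.
Proof. intros. now apply (RInt_plus (V := R_CompleteNormedModule)). Qed.

Lemma RInt_scal_R (k : R) (f : R -> R) (a b : R) : ex_RInt f a b ->
  RInt (fun t => k * f t) a b = k * RInt f a b.
Proof. intros. now apply (RInt_scal (V := R_CompleteNormedModule)). Qed.

Lemma mean_plus (G H : C -> C) : LipR G -> LipR H ->
  mean (fun s => G s + H s)%C = (mean G + mean H)%C.
Proof.
  intros LG LH. assert (HPI := PI_RGT_0). unfold mean.
  rewrite (RInt_ext_R _ (fun t => Re (G (RtoC t)) + Re (H (RtoC t)))) by (intros; apply re_plus).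
  rewrite (RInt_ext_R (fun t => Im (G (RtoC t) + H (RtoC t))) (fun t => Im (G (RtoC t)) + Im (H (RtoC t))))
    by (intros; apply im_plus).
  assert (G1 := LipR_ex_RInt G 0 (2 * PI) LG). assert (G2 := LipR_ex_RInt_Im G 0 (2 * PI) LG).
  assert (H1 := LipR_ex_RInt H 0 (2 * PI) LH). assert (H2 := LipR_ex_RInt_Im H 0 (2 * PI) LH).
  rewrite (RInt_plus_R _ _ _ _ G1 H1), (RInt_plus_R _ _ _ _ G2 H2).
  unfold Cplus; simpl. f_equal; field; lra.
Qed.

Lemma mean_scal (k : C) (G : C -> C) : LipR G -> mean (fun s => k * G s)%C = (k * mean G)%C.
Proof.
  intros LG. assert (HPI := PI_RGT_0). unfold mean.
  assert (E1 := LipR_ex_RInt G 0 (2 * PI) LG). assert (E2 := LipR_ex_RInt_Im G 0 (2 * PI) LG).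
  rewrite (RInt_ext_R _ (fun t => Re k * Re (G (RtoC t)) + (- Im k) * Im (G (RtoC t))))
    by (intros; rewrite re_mult; ring).
  rewrite (RInt_ext_R (fun t => Im (k * G (RtoC t))) (fun t => Re k * Im (G (RtoC t)) + Im k * Re (G (RtoC t))))
    by (intros; rewrite im_mult; ring).
  set (gr := fun t => Re (G (RtoC t))) in *. set (gi := fun t => Im (G (RtoC t))) in *.
  rewrite (RInt_plus_R (fun t => Re k * gr t) (fun t => - Im k * gi t)),
    (RInt_plus_R (fun t => Re k * gi t) (fun t => Im k * gr t))
    by (apply (ex_RInt_scal (V := R_CompleteNormedModule)); assumption).
  rewrite (RInt_scal_R (Re k) gr), (RInt_scal_R (- Im k) gi), (RInt_scal_R (Re k) gi),
    (RInt_scal_R (Im k) gr) by assumption.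
  unfold Cmult, Re, Im; simpl. f_equal; field; lra.
Qed.

Lemma mean_const (k : C) : mean (fun _ => k) = k.
Proof.
  assert (HPI := PI_RGT_0). unfold mean. rewrite !RInt_const.
  apply C_eq; unfold scal, mult; simpl; unfold mult; simpl; field; lra.
Qed.

Lemma mean_Re_le (G : C -> C) (M : R) : LipR G ->
  (forall t : R, 0 <= t <= 2 * PI -> Re (G (RtoC t)) <= M) ->
  Re (mean G) <= M.
Proof.
  intros LG H. assert (HPI := PI_RGT_0). unfold mean; simpl.
  assert (I : RInt (fun t => Re (G (RtoC t))) 0 (2 * PI) <= RInt (fun _ => M) 0 (2 * PI)).
  { apply RInt_le; [lra|now apply LipR_ex_RInt|apply ex_RInt_const|].
    intros; apply H; lra. }
  rewrite RInt_const in I. unfold scal in I; simpl in I; unfold mult in I; simpl in I.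
  apply (Rmult_le_reg_r (2 * PI)); [lra|]. unfold Rdiv. rewrite Rmult_assoc, Rinv_l by lra. lra.
Qed.

(** Turns a modulus into a real part, to which linear operations such as integrals and real mean
    value theorems apply. *)
Lemma exists_rotation (m : C) : exists u : C, Cmod u = 1 /\ (u * m)%C = RtoC (Cmod m).
Proof.
  destruct (Ceq_dec m (RtoC 0)) as [->|Hm].
  - exists (RtoC 1). rewrite Cmod_1, Cmod_0. split; [reflexivity|ring].
  - assert (Hp := proj1 (Cmod_gt_0 m) Hm).
    assert (Hn : RtoC (Cmod m) <> RtoC 0) by (intros X; apply RtoC_inj in X; lra).
    exists (Cconj m / RtoC (Cmod m))%C. split.
    + rewrite Cmod_div, Cmod_conj, Cmod_R, Rabs_pos_eq by (try assumption; lra). field; lra.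
    + assert (E := Cmod2_conj m). rewrite RtoC_pow in E.
      replace (Cconj m / RtoC (Cmod m) * m)%C with (m * Cconj m / RtoC (Cmod m))%C by (field; exact Hn).
      rewrite <- E. simpl. field. exact Hn.
Qed.

Lemma mean_Cmod_le (G : C -> C) (M : R) : LipR G ->
  (forall t : R, 0 <= t <= 2 * PI -> Cmod (G (RtoC t)) <= M) ->
  Cmod (mean G) <= M.
Proof.
  intros LG H. destruct (exists_rotation (mean G)) as [u [Hu E]].
  rewrite <- (re_RtoC (Cmod (mean G))), <- E, <- mean_scal by exact LG.
  apply mean_Re_le; [now apply LipR_scal|]. intros t Ht.
  eapply Rle_trans; [apply Rle_abs|]. eapply Rle_trans; [apply re_le_Cmod|].
  rewrite Cmod_mult, Hu, Rmult_1_l. now apply H.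
Qed.

Lemma RInt_periodic_derivative (H H' : C -> C) :
  (forall t : R, Cdiff H H' (RtoC t)) -> H (RtoC (2 * PI)) = H (RtoC 0) ->
  RInt (fun t => Re (H' (RtoC t))) 0 (2 * PI) = 0.
Proof.
  intros HD E. apply is_RInt_unique.
  assert (I := is_RInt_derive (V := R_CompleteNormedModule) (fun t => Re (H (RtoC t))) (fun t => Re (H' (RtoC t))) 0 (2 * PI)).
  simpl in I. rewrite E in I. unfold minus, plus, opp in I; simpl in I.
  replace (Re (H (RtoC 0)) + - Re (H (RtoC 0))) with 0 in I by ring. apply I.
  - intros t _. now apply Cdiff_Re_derive.
  - intros t _. apply Lip_continuous_Re. apply HD.
Qed.

Lemma mean_periodic_derivative (H H' : C -> C) :
  (forall t : R, Cdiff H H' (RtoC t)) -> H (RtoC (2 * PI)) = H (RtoC 0) -> mean H' = RtoC 0.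
Proof.
  intros HD E. unfold mean.
  rewrite (RInt_periodic_derivative H H' HD E).
  rewrite (RInt_ext_R (fun t => Im (H' (RtoC t))) (fun t => Re (- Ci * H' (RtoC t))%C)) by (intros; apply Im_as_Re).
  rewrite (RInt_periodic_derivative (fun s => - Ci * H s)%C (fun s => - Ci * H' s)%C).
  - apply C_eq; simpl; unfold Rdiv; ring.
  - intros t. now apply Cdiff_scal.
  - now rewrite E.
Qed.

Definition circ (r : R) (s : C) : C := (RtoC r * Cexp (Ci * s))%C.

Lemma Cdiff_circ (r : R) (s : C) : Cdiff (circ r) (fun s => Ci * circ r s)%C s.
Proof.
  assert (D1 : Cdiff (fun s => Ci * s)%C (fun _ => Ci * 1)%C s) by apply (Cdiff_scal Ci _ _ _ (Cdiff_id s)).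
  assert (D2 := Cdiff_scal (RtoC r) _ _ _ (Cdiff_comp Cexp Cexp _ _ s D1 (Cdiff_Cexp _))).
  eapply Cdiff_ext; [| |exact D2]; intros; unfold circ; simpl; ring.
Qed.

Lemma circ_period (r : R) : circ r (RtoC (2 * PI)) = circ r (RtoC 0).
Proof.
  unfold circ. f_equal. unfold Cexp.
  assert (E1 : (Ci * RtoC (2 * PI))%C = (0, 2 * PI)) by (apply C_eq; simpl; ring).
  assert (E2 : (Ci * RtoC 0)%C = (0, 0)) by (apply C_eq; simpl; ring).
  rewrite E1, E2; simpl. now rewrite cos_2PI, sin_2PI, cos_0, sin_0.
Qed.

Lemma Cmod_circ (r t : R) : 0 <= r -> Cmod (circ r (RtoC t)) = r.
Proof.
  intros Hr. unfold circ. rewrite Cmod_mult, Cmod_R, Rabs_pos_eq by exact Hr.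
  assert (E1 : (Ci * RtoC t)%C = (0, t)) by (apply C_eq; simpl; ring).
  rewrite E1. unfold Cexp, Cmod; simpl. rewrite exp_0.
  replace (1 * cos t * (1 * cos t * 1) + 1 * sin t * (1 * sin t * 1)) with 1.
  - rewrite sqrt_1. ring.
  - generalize (sin2_cos2 t). unfold Rsqr. lra.
Qed.

Lemma circ_nonzero (r : R) (s : C) : r <> 0 -> circ r s <> RtoC 0.
Proof.
  intros Hr. apply Cmult_neq_0; [|apply Cexp_nonzero]. intros E; apply RtoC_inj in E; lra.
Qed.

Lemma Cdiff_pow (f f' : C -> C) (z : C) (n : nat) : Cdiff f f' z ->
  Cdiff (fun x => f x ^ n)%C (fun x => RtoC (INR n) * f x ^ (pred n) * f' x)%C z.
Proof.
  intros H. induction n as [|n IH].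
  - apply (Cdiff_ext (fun _ => RtoC 1) _ (fun _ => RtoC 0) _ z); [reflexivity|intros; simpl; ring|apply Cdiff_const].
  - eapply Cdiff_ext; [| |apply (Cdiff_mult _ _ _ _ z H IH)]; intros x; [reflexivity|].
    cbv beta. rewrite S_INR, RtoC_plus. simpl pred. destruct n; simpl; ring.
Qed.

(** In the angle, [zeta^n] has the periodic primitive [zeta^n / (i n)]. *)
Lemma mean_circ_pow (r : R) (n : nat) : r <> 0 -> n <> 0%nat -> mean (fun s => circ r s ^ n)%C = RtoC 0.
Proof.
  intros Hr Hn.
  assert (Hn' : RtoC (INR n) <> RtoC 0).
  { intros E; apply RtoC_inj in E. revert E. now apply not_0_INR. }
  apply (mean_periodic_derivative (fun s => / (Ci * RtoC (INR n)) * circ r s ^ n)%C).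
  - intros t. eapply Cdiff_ext; [| |apply (Cdiff_scal (/ (Ci * RtoC (INR n)))%C _ _ _ (Cdiff_pow _ _ _ n (Cdiff_circ r (RtoC t))))]; intros x; [reflexivity|].
    cbv beta. destruct n as [|n]; [easy|]. simpl pred. simpl Cpow. field. split; [exact Hn'|apply Ci_nz].
  - now rewrite circ_period.
Qed.

Lemma mean_circ_inv_pow (r : R) (n : nat) : r <> 0 -> n <> 0%nat ->
  mean (fun s => (/ circ r s) ^ n)%C = RtoC 0.
Proof.
  intros Hr Hn.
  assert (Hn' : RtoC (INR n) <> RtoC 0).
  { intros E; apply RtoC_inj in E. revert E. now apply not_0_INR. }
  apply (mean_periodic_derivative (fun s => - / (Ci * RtoC (INR n)) * (/ circ r s) ^ n)%C).
  - intros t. assert (Hc : forall s, circ r s <> RtoC 0) by (intros; now apply circ_nonzero).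
    eapply Cdiff_ext; [| |apply (Cdiff_scal (- / (Ci * RtoC (INR n)))%C _ _ _ (Cdiff_pow _ _ _ n (Cdiff_inv _ _ _ (Hc _) (Cdiff_circ r (RtoC t)))))]; intros x; [reflexivity|].
    cbv beta. destruct n as [|n]; [easy|]. simpl pred. simpl Cpow. field.
    repeat split; [apply Hc|exact Hn'|apply Ci_nz].
  - now rewrite circ_period.
Qed.

(** * Cauchy's formula and Schwarz functions *)

(** Joint continuity in contraction parameter and angle, as required for differentiating under the
    integral sign. *)
Definition cont2 (P : R -> R -> C) (x y : R) : Prop :=
  continuity_2d_pt (fun u v => Re (P u v)) x y /\ continuity_2d_pt (fun u v => Im (P u v)) x y.

Lemma cont2_Lip (f : C -> C) (P : R -> R -> C) (x y : R) :
  cont2 P x y -> Lip f (P x y) -> cont2 (fun u v => f (P u v)) x y.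
Proof.
  intros [H1 H2] L.
  assert (K : forall eps : posreal, exists d : posreal, forall u v, Rabs (u - x) < d -> Rabs (v - y) < d ->
    Cmod (f (P u v) - f (P x y)) < eps).
  { intros eps. destruct (bigO_small _ eps L (cond_pos eps)) as [d [Hd H]].
    assert (Hd2 : 0 < d / 2) by lra.
    destruct (H1 (mkposreal _ Hd2)) as [d1 K1]. destruct (H2 (mkposreal _ Hd2)) as [d2 K2].
    assert (Hm : 0 < Rmin d1 d2) by (apply Rmin_pos; apply cond_pos).
    exists (mkposreal _ Hm). intros u v Hu Hv. simpl in *.
    specialize (K1 u v (Rlt_le_trans _ _ _ Hu (Rmin_l _ _)) (Rlt_le_trans _ _ _ Hv (Rmin_l _ _))).
    specialize (K2 u v (Rlt_le_trans _ _ _ Hu (Rmin_r _ _)) (Rlt_le_trans _ _ _ Hv (Rmin_r _ _))).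
    specialize (H (P u v - P x y)%C).
    replace (P x y + (P u v - P x y))%C with (P u v) in H by ring. apply H.
    eapply Rle_lt_trans; [apply Cmod_le_Re_Im|]. unfold Cminus.
    rewrite re_plus, im_plus, re_opp, im_opp. unfold Rminus in K1, K2. lra. }
  split; intros eps; destruct (K eps) as [d Hd]; exists d; intros u v Hu Hv;
    eapply Rle_lt_trans; [|now apply (Hd u v)| |now apply (Hd u v)]; unfold Cminus, Rminus.
  - rewrite <- re_opp, <- re_plus. apply re_le_Cmod.
  - rewrite <- im_opp, <- im_plus. apply im_le_Cmod.
Qed.

Lemma cont2_const (c : C) (x y : R) : cont2 (fun _ _ => c) x y.
Proof. split; apply continuity_2d_pt_const. Qed.

Lemma cont2_plus (P Q : R -> R -> C) (x y : R) :
  cont2 P x y -> cont2 Q x y -> cont2 (fun u v => P u v + Q u v)%C x y.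
Proof.
  intros [H1 H2] [H3 H4]. split.
  - apply (continuity_2d_pt_ext (fun u v => Re (P u v) + Re (Q u v))).
    + intros; symmetry; apply re_plus.
    + now apply continuity_2d_pt_plus.
  - apply (continuity_2d_pt_ext (fun u v => Im (P u v) + Im (Q u v))).
    + intros; symmetry; apply im_plus.
    + now apply continuity_2d_pt_plus.
Qed.

Lemma cont2_mult (P Q : R -> R -> C) (x y : R) :
  cont2 P x y -> cont2 Q x y -> cont2 (fun u v => P u v * Q u v)%C x y.
Proof.
  intros [H1 H2] [H3 H4]. split.
  - apply (continuity_2d_pt_ext (fun u v => Re (P u v) * Re (Q u v) - Im (P u v) * Im (Q u v))).
    + intros; symmetry; apply re_mult.
    + apply continuity_2d_pt_minus; now apply continuity_2d_pt_mult.
  - apply (continuity_2d_pt_ext (fun u v => Re (P u v) * Im (Q u v) + Im (P u v) * Re (Q u v))).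
    + intros; symmetry; apply im_mult.
    + apply continuity_2d_pt_plus; now apply continuity_2d_pt_mult.
Qed.

Lemma cont2_fst (x y : R) : cont2 (fun u _ => RtoC u) x y.
Proof.
  split; simpl; [apply continuity_2d_pt_id1|apply continuity_2d_pt_const].
Qed.

Lemma cont2_snd (x y : R) : cont2 (fun _ v => RtoC v) x y.
Proof.
  split; simpl; [apply continuity_2d_pt_id2|apply continuity_2d_pt_const].
Qed.

Section Cauchy.

Variables (g g' : C -> C) (R0 r : R) (z : C).
Hypothesis Hg : forall x, Cmod x < R0 -> Cdiff g g' x.
Hypothesis Hr : 0 < r < R0.
Hypothesis Hz : Cmod z < r.

Let segment (t : R) (s : C) : C := (z + RtoC t * (circ r s - z))%C.

(** Two-sided derivatives at [t = 0] and [t = 1] need some room outside [[0, 1]]. For [t] within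
    [eta] of that interval the segment stays within [r (1 + 2 eta) = (r + R0) / 2 < R0]. *)
Let eta := (R0 - r) / (4 * r).

Lemma segment_in (t0 t s : R) : 0 <= t0 <= 1 -> Rabs (t - t0) < eta -> Cmod (segment t (RtoC s)) < R0.
Proof.
  intros Ht0 Ht. unfold segment.
  replace (z + RtoC t * (circ r (RtoC s) - z))%C with (RtoC (1 - t) * z + RtoC t * circ r (RtoC s))%C
    by (rewrite RtoC_minus; ring).
  eapply Rle_lt_trans; [apply Cmod_triangle|].
  rewrite !Cmod_mult, !Cmod_R, Cmod_circ by lra.
  assert (He : eta * (4 * r) = R0 - r) by (unfold eta; field; lra).
  assert (Rabs (1 - t) <= 1 - t0 + eta).
  { apply Rabs_def2 in Ht. apply Rabs_le. lra. }
  assert (Rabs t <= t0 + eta).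
  { apply Rabs_def2 in Ht. apply Rabs_le. lra. }
  assert (Hp0 := Rabs_pos (1 - t)). assert (Hp1 := Cmod_ge_0 z).
  assert (Rabs (1 - t) * Cmod z <= (1 - t0 + eta) * r) by (apply Rmult_le_compat; lra).
  assert (Rabs t * r <= (t0 + eta) * r) by (apply Rmult_le_compat_r; lra).
  lra.
Qed.

Lemma circ_minus_nonzero (s : R) : (circ r (RtoC s) - z)%C <> RtoC 0.
Proof.
  intros E. apply Ceq_minus in E. assert (C := Cmod_circ r s ltac:(lra)). rewrite E in C. lra.
Qed.

(** The Cauchy kernel in terms of the angle: with [d zeta = i zeta ds], the form
    [d zeta / (2 PI i (zeta - z))] becomes [kernel s ds / (2 PI)]. *)
Let kernel (s : C) : C := (circ r s / (circ r s - z))%C.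

Lemma eta_pos : 0 < eta.
Proof. unfold eta. apply Rdiv_lt_0_compat; lra. Qed.

Lemma LipR_kernel : LipR kernel.
Proof.
  intros t. unfold kernel, Cdiv. assert (L := Cdiff_Lip _ _ _ (Cdiff_circ r (RtoC t))).
  apply Lip_mult; [exact L|].
  apply (Lip_comp Cinv (fun s => circ r s - z)%C).
  - apply (Lip_ext (fun s => circ r s + - z)%C); [reflexivity|]. apply Lip_plus; [exact L|apply Lip_const].
  - apply Lip_Cinv, circ_minus_nonzero.
Qed.

Lemma LipR_g_circ : LipR (fun s => g (circ r s)).
Proof.
  intros t. apply Lip_comp; [apply (Cdiff_Lip _ _ _ (Cdiff_circ r (RtoC t)))|].
  apply (Cdiff_Lip g g'), Hg. rewrite Cmod_circ; lra.
Qed.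

Let integrand (k : C) (t s : R) : R := Re (k * g (segment t (RtoC s)) * kernel (RtoC s)).

Lemma Cdiff_segment (t : R) (s : C) : Cdiff (segment t) (fun s => RtoC t * (Ci * circ r s))%C s.
Proof.
  assert (H := Cdiff_plus _ _ _ _ s (Cdiff_const z s)
    (Cdiff_scal (RtoC t) _ _ s (Cdiff_minus _ _ _ _ s (Cdiff_circ r s) (Cdiff_const z s)))).
  eapply Cdiff_ext; [| |exact H]; intros x; unfold segment; ring.
Qed.

(** The factor [zeta - z] from the chain rule cancels the denominator of the kernel, so the
    derivative in [t] is free of singularities. *)
Lemma integrand_derive (k : C) (t s : R) : Cmod (segment t (RtoC s)) < R0 ->
  is_derive (fun u => integrand k u s) t (Re (k * g' (segment t (RtoC s)) * circ r (RtoC s))).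
Proof.
  intros Hin.
  assert (HD : Cdiff (fun u => z + u * (circ r (RtoC s) - z))%C (fun _ => circ r (RtoC s) - z)%C (RtoC t)).
  { eapply Cdiff_ext; [| |apply (Cdiff_plus _ _ _ _ _ (Cdiff_const z (RtoC t))
      (Cdiff_mult _ _ _ _ _ (Cdiff_id (RtoC t)) (Cdiff_const (circ r (RtoC s) - z)%C (RtoC t))))]; intros; simpl; ring. }
  assert (HD2 := Cdiff_scal (k * kernel (RtoC s))%C _ _ _ (Cdiff_comp g g' _ _ _ HD (Hg _ Hin))).
  apply Cdiff_Re_derive in HD2. cbv beta in HD2.
  replace (k * g' (segment t (RtoC s)) * circ r (RtoC s))%C with
    (k * kernel (RtoC s) * (g' (z + RtoC t * (circ r (RtoC s) - z)) * (circ r (RtoC s) - z)))%C.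
  - eapply is_derive_ext; [|exact HD2]. intros u. unfold integrand, segment. f_equal. ring.
  - unfold kernel, segment. field. apply circ_minus_nonzero.
Qed.

(** Up to the factor [1 / (t i)] this integrand is the angular derivative of the periodic function
    [g (segment t s)]. Dividing by [t] excludes [t = 0], which is harmless: the mean value theorem
    evaluates the derivative at an interior point only. *)
Lemma integrand_derivative_integral (k : C) (t : R) : 0 < t <= 1 ->
  RInt (fun s => Re (k * g' (segment t (RtoC s)) * circ r (RtoC s))) 0 (2 * PI) = 0.
Proof.
  intros Ht. assert (Ht0 : RtoC t <> RtoC 0) by (intros E; apply RtoC_inj in E; lra).
  etransitivity; [|apply (RInt_periodic_derivative (fun s => k / (RtoC t * Ci) * g (segment t s))%C
    (fun s => k / (RtoC t * Ci) * (g' (segment t s) * (RtoC t * (Ci * circ r s))))%C)].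
  - apply RInt_ext_R. intros s. f_equal. field. split; [apply Ci_nz|exact Ht0].
  - intros s. apply Cdiff_scal. apply Cdiff_comp; [apply Cdiff_segment|]. apply Hg.
    apply (segment_in t); [lra|]. replace (t - t) with 0 by ring. rewrite Rabs_R0. apply eta_pos.
  - unfold segment. now rewrite circ_period.
Qed.

Lemma Cauchy_kernel_Re (k : C) :
  RInt (integrand k 1) 0 (2 * PI) = RInt (integrand k 0) 0 (2 * PI).
Proof.
  assert (He := eta_pos). assert (HPI := PI_RGT_0).
  set (F' := fun t => RInt (fun s => Derive (fun u => integrand k u s) t) 0 (2 * PI)).
  destruct (MVT_cor2 (fun t => RInt (integrand k t) 0 (2 * PI)) F' 0 1) as [c [Hc Hc01]]; [lra| |].
  - intros t Ht. apply is_derive_Reals. unfold F'.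
    apply (is_derive_RInt_param (fun t s => integrand k t s) 0 (2 * PI) t).
    + exists (mkposreal _ He). intros u Hu s _.
      eexists. apply integrand_derive. now apply (segment_in t).
    + intros s _.
      (* Near [(t, s)] the formal [Derive] equals an explicit expression, whose joint continuity
         follows from the rules for [cont2]. *)
      apply (continuity_2d_pt_ext_loc (fun u v => Re (k * g' (segment u (RtoC v)) * circ r (RtoC v)))).
      * exists (mkposreal _ He). intros u v Hu Hv. symmetry. apply is_derive_unique.
        apply integrand_derive. now apply (segment_in t).
      * assert (Hcirc : cont2 (fun u v => circ r (RtoC v)) t s).
        { apply (cont2_Lip (circ r) (fun u v => RtoC v)); [apply cont2_snd|].
          apply (Cdiff_Lip _ _ _ (Cdiff_circ r (RtoC s))). }
        assert (Hseg : cont2 (fun u v => segment u (RtoC v)) t s).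
        { unfold segment, Cminus. apply cont2_plus; [apply cont2_const|].
          apply cont2_mult; [apply cont2_fst|]. apply cont2_plus; [exact Hcirc|apply cont2_const]. }
        assert (Hall : cont2 (fun u v => k * g' (segment u (RtoC v)) * circ r (RtoC v))%C t s).
        { apply cont2_mult; [|exact Hcirc]. apply cont2_mult; [apply cont2_const|].
          apply (cont2_Lip g' (fun u v => segment u (RtoC v))); [exact Hseg|].
          apply Hg. apply (segment_in t); [lra|]. replace (t - t) with 0 by ring. now rewrite Rabs_R0. }
        exact (proj1 Hall).
    + exists (mkposreal _ He). intros u Hu.
      apply (ex_RInt_continuous (V := R_CompleteNormedModule)). intros s _.
      apply (Lip_continuous_Re (fun s => k * g (segment u s) * kernel s)%C).
      apply Lip_mult; [|apply LipR_kernel]. apply Lip_mult; [apply Lip_const|].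
      apply Lip_comp; [apply (Cdiff_Lip _ _ _ (Cdiff_segment u (RtoC s)))|].
      apply (Cdiff_Lip g g'), Hg. now apply (segment_in t).
  - replace (F' c) with 0 in Hc; [lra|]. unfold F'.
    symmetry. etransitivity; [|apply (integrand_derivative_integral k c); lra].
    apply RInt_ext_R. intros s.
    apply is_derive_unique, integrand_derive. apply (segment_in c); [lra|].
    replace (c - c) with 0 by ring. now rewrite Rabs_R0.
Qed.

(** The mean of the kernel stays unevaluated here; its geometric expansion shows in [mean_kernel]
    that it is 1. *)
Lemma Cauchy_kernel : mean (fun s => g (circ r s) * kernel s)%C = (g z * mean kernel)%C.
Proof.
  assert (HPI := PI_RGT_0).
  assert (E : forall k, RInt (fun s => Re (k * g (circ r (RtoC s)) * kernel (RtoC s))) 0 (2 * PI)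
     = RInt (fun s => Re (k * g z * kernel (RtoC s))) 0 (2 * PI)).
  { intros k. assert (H := Cauchy_kernel_Re k). unfold integrand, segment in H.
    rewrite (RInt_ext_R _ (fun s => Re (k * g (circ r (RtoC s)) * kernel (RtoC s)))) in H.
    2:{ intros s. replace (z + 1 * (circ r (RtoC s) - z))%C with (circ r (RtoC s)) by ring. reflexivity. }
    rewrite H. apply RInt_ext_R. intros s.
    replace (z + 0 * (circ r (RtoC s) - z))%C with z by ring. reflexivity. }
  rewrite <- mean_scal by exact LipR_kernel. unfold mean. f_equal; f_equal.
  - specialize (E (RtoC 1)).
    rewrite (RInt_ext_R _ (fun s => Re (g (circ r (RtoC s)) * kernel (RtoC s)))) in E
      by (intros; f_equal; ring).
    rewrite E. apply RInt_ext_R. intros; f_equal; ring.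
  - specialize (E (- Ci)%C).
    rewrite (RInt_ext_R _ (fun s => Im (g (circ r (RtoC s)) * kernel (RtoC s)))) in E
      by (intros; rewrite Im_as_Re; f_equal; ring).
    rewrite E. apply RInt_ext_R. intros; rewrite Im_as_Re; f_equal; ring.
Qed.

Lemma LipR_circ_inv_pow (n : nat) : LipR (fun s => (/ circ r s) ^ n)%C.
Proof.
  intros t. eapply Cdiff_Lip. apply Cdiff_pow. apply Cdiff_inv; [|apply Cdiff_circ].
  apply circ_nonzero; lra.
Qed.

(** The geometric series in [z / zeta] with its exact remainder, so that limit and integral need not
    be exchanged. *)
Lemma kernel_expansion (s : R) (N : nat) :
  kernel (RtoC s) = (Cpartial (fun n => z ^ n * (/ circ r (RtoC s)) ^ n) N
    + z ^ N * ((/ circ r (RtoC s)) ^ N * kernel (RtoC s)))%C.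
Proof.
  assert (H1 := circ_minus_nonzero s). assert (H2 := circ_nonzero r (RtoC s) ltac:(lra)).
  induction N as [|N IH]; [simpl; ring|]. rewrite IH at 1.
  simpl Cpartial. unfold kernel. simpl Cpow. field. split; assumption.
Qed.

Lemma Cmod_kernel (s : R) : Cmod (kernel (RtoC s)) <= r / (r - Cmod z).
Proof.
  unfold kernel. rewrite Cmod_div by apply circ_minus_nonzero. rewrite Cmod_circ by lra.
  apply Rmult_le_compat_l; [lra|]. apply Rinv_le_contravar; [lra|].
  assert (T := Cmod_triangle (circ r (RtoC s) - z) z).
  replace (circ r (RtoC s) - z + z)%C with (circ r (RtoC s)) in T by ring.
  rewrite Cmod_circ in T by lra. lra.
Qed.

Lemma LipR_zero : LipR (fun _ => RtoC 0).
Proof. intros t. apply Lip_const. Qed.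

Lemma LipR_partial (H : C -> C) (N : nat) : LipR H ->
  LipR (fun s => Cpartial (fun n => z ^ n * (H s * (/ circ r s) ^ n)) N)%C.
Proof.
  intros LH. induction N as [|N IH]; simpl; [apply LipR_zero|].
  apply LipR_plus; [exact IH|]. apply LipR_scal, LipR_mult; [exact LH|apply LipR_circ_inv_pow].
Qed.

Lemma mean_partial (H : C -> C) (N : nat) : LipR H ->
  mean (fun s => Cpartial (fun n => z ^ n * (H s * (/ circ r s) ^ n)) N)%C
   = Cpartial (fun n => z ^ n * mean (fun s => H s * (/ circ r s) ^ n))%C N.
Proof.
  intros LH. induction N as [|N IH]; simpl; [apply mean_const|].
  rewrite mean_plus.
  - rewrite IH, mean_scal; [reflexivity|]. apply LipR_mult; [exact LH|apply LipR_circ_inv_pow].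
  - now apply LipR_partial.
  - apply LipR_scal, LipR_mult; [exact LH|apply LipR_circ_inv_pow].
Qed.

(** The remainder is at most [M (r / (r - |z|)) (|z| / r)^N], which tends to 0. Leaving [H]
    arbitrary serves twice: [H = 1] evaluates the mean of the kernel, and [g] on the circle gives
    its Taylor series. *)
Lemma mean_kernel_series (H : C -> C) (M : R) : LipR H ->
  (forall t : R, 0 <= t <= 2 * PI -> Cmod (H (RtoC t)) <= M) ->
  Cseries (fun n => mean (fun s => H s * (/ circ r s) ^ n) * z ^ n)%C (mean (fun s => H s * kernel s)%C).
Proof.
  intros LH HM.
  assert (HM0 : 0 <= M).
  { assert (HPI := PI_RGT_0). eapply Rle_trans; [apply Cmod_ge_0|apply (HM 0)]. lra. }
  assert (Hz0 := Cmod_ge_0 z). set (q := Cmod z / r).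
  assert (Hq : 0 <= q < 1).
  { unfold q. split; [apply Rdiv_le_0_compat; lra|]. apply (Rmult_lt_reg_r r); [lra|].
    unfold Rdiv; rewrite Rmult_assoc, Rinv_l; lra. }
  set (B := M * (r / (r - Cmod z))).
  assert (HB : 0 <= B) by (apply Rmult_le_pos; [exact HM0|apply Rdiv_le_0_compat; lra]).
  apply (Cseries_ext (fun n => z ^ n * mean (fun s => H s * (/ circ r s) ^ n))%C).
  { intros; apply Cmult_comm. }
  intros eps Heps.
  assert (Hlim : is_lim_seq (fun n => B * q ^ n) 0).
  { replace (Finite 0) with (Rbar_mult B 0) by (simpl; f_equal; ring).
    apply is_lim_seq_scal_l. apply is_lim_seq_geom. rewrite Rabs_pos_eq; lra. }
  apply is_lim_seq_Reals in Hlim. destruct (Hlim eps Heps) as [N0 HN0].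
  exists N0. intros N HN. specialize (HN0 N HN). unfold R_dist in HN0.
  rewrite Rminus_0_r in HN0. apply Rabs_def2 in HN0.
  set (E := fun s => (z ^ N * (H s * ((/ circ r s) ^ N * kernel s)))%C).
  assert (LE : LipR E).
  { apply LipR_scal, LipR_mult; [exact LH|]. apply LipR_mult; [apply LipR_circ_inv_pow|exact LipR_kernel]. }
  assert (Es : mean (fun s => H s * kernel s)%C =
    (Cpartial (fun n => z ^ n * mean (fun s => H s * (/ circ r s) ^ n))%C N + mean E)%C).
  { rewrite <- mean_partial by exact LH. rewrite <- mean_plus; [|now apply LipR_partial|exact LE].
    apply mean_ext. intros t. rewrite (kernel_expansion t N) at 1. unfold E.
    rewrite Cmult_plus_distr_l, <- Cpartial_scal. f_equal; [|ring].
    generalize N. induction N1 as [|N1 IH]; simpl; [reflexivity|]. rewrite IH. ring. }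
  rewrite Es, Cmod_minus_sym.
  match goal with |- Cmod (?a + ?b - ?a) < _ => replace (a + b - a)%C with b by ring end.
  eapply Rle_lt_trans; [|exact (proj1 HN0)]. apply mean_Cmod_le; [exact LE|].
  intros t Ht. unfold E. rewrite !Cmod_mult, !Cmod_pow, Cmod_inv, Cmod_circ by (try apply circ_nonzero; lra).
  replace (B * q ^ N) with (Cmod z ^ N * (M * ((/ r) ^ N * (r / (r - Cmod z))))).
  2:{ unfold B, q, Rdiv. rewrite Rpow_mult_distr. ring. }
  apply Rmult_le_compat_l; [now apply pow_le|].
  assert (0 <= (/ r) ^ N) by (apply pow_le, Rlt_le, Rinv_0_lt_compat; lra).
  apply Rmult_le_compat; [apply Cmod_ge_0| |now apply HM|].
  - apply Rmult_le_pos; [assumption|apply Cmod_ge_0].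
  - apply Rmult_le_compat_l; [assumption|apply Cmod_kernel].
Qed.

(** For [H = 1] the means of [zeta^(-n)] with [n >= 1] vanish, and only the constant term of the
    series survives. *)
Lemma mean_kernel : mean kernel = RtoC 1.
Proof.
  assert (HS := mean_kernel_series (fun _ => RtoC 1) 1 (fun t => Lip_const _ _) ltac:(intros; cbv beta; rewrite Cmod_1; lra)).
  cbv beta in HS. rewrite (mean_ext (fun s => 1 * kernel s)%C kernel) in HS by (intros; ring).
  apply (Cseries_unique _ _ _ HS).
  apply Cseries_shift.
  replace (1 - mean (fun s => 1 * (/ circ r s) ^ 0) * z ^ 0)%C with (RtoC 0).
  - apply (Cseries_ext (fun _ => RtoC 0)).
    + intros n. rewrite (mean_ext _ (fun s => (/ circ r s) ^ S n)%C) by (intros; apply Cmult_1_l).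
      rewrite mean_circ_inv_pow by (try lia; lra). ring.
    + intros eps He. exists 0%nat. intros n _.
      replace (Cpartial (fun _ => RtoC 0) n) with (RtoC 0).
      * replace (RtoC 0 - RtoC 0)%C with (RtoC 0) by ring. now rewrite Cmod_0.
      * clear. induction n as [|n IH]; simpl; [reflexivity|]. rewrite <- IH. ring.
  - rewrite (mean_ext _ (fun _ => RtoC 1)) by (intros; simpl; ring). rewrite mean_const. simpl. ring.
Qed.

End Cauchy.

Lemma LipR_bounded (H : C -> C) (a b : R) : LipR H -> a <= b ->
  exists M, forall t : R, a <= t <= b -> Cmod (H (RtoC t)) <= M.
Proof.
  intros LH Hab.
  assert (B : forall G, LipR G -> exists M, forall t, a <= t <= b -> Re (G (RtoC t)) <= M).
  { intros G LG. destruct (continuity_ab_maj (fun t => Re (G (RtoC t))) a b) as [x [Hx _]]; [exact Hab| |].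
    - intros c _. apply continuity_pt_filterlim. now apply Lip_continuous_Re.
    - now exists (Re (G (RtoC x))). }
  destruct (B _ LH) as [M1 H1]. destruct (B _ (LipR_scal (-(1))%C _ LH)) as [M2 H2].
  destruct (B _ (LipR_scal (- Ci)%C _ LH)) as [M3 H3]. destruct (B _ (LipR_scal (Ci)%C _ LH)) as [M4 H4].
  exists (Rmax M1 M2 + Rmax M3 M4). intros t Ht.
  specialize (H1 t Ht). specialize (H2 t Ht). specialize (H3 t Ht). specialize (H4 t Ht).
  rewrite re_mult in H2, H3, H4. simpl in H2, H3, H4.
  eapply Rle_trans; [apply Cmod_le_Re_Im|].
  assert (K1 := Rmax_l M1 M2). assert (K2 := Rmax_r M1 M2).
  assert (K3 := Rmax_l M3 M4). assert (K4 := Rmax_r M3 M4).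
  apply Rplus_le_compat; apply Rabs_le; unfold Re, Im in *; lra.
Qed.

(** * Taylor series in a disk and the coefficient inequality *)

Definition Cauchy_coef (g : C -> C) (r : R) (n : nat) : C :=
  mean (fun s => g (circ r s) * (/ circ r s) ^ n)%C.

Lemma Cauchy_Taylor (g g' : C -> C) (R0 r : R) (z : C) :
  (forall x, Cmod x < R0 -> Cdiff g g' x) -> 0 < r < R0 -> Cmod z < r ->
  Cseries (fun n => Cauchy_coef g r n * z ^ n)%C (g z).
Proof.
  intros Hg Hr Hz. assert (HPI := PI_RGT_0).
  assert (L := LipR_g_circ g g' R0 r Hg Hr).
  destruct (LipR_bounded _ 0 (2 * PI) L ltac:(lra)) as [M HM].
  assert (HS := mean_kernel_series R0 r z Hr Hz _ M L HM).
  cbv beta in HS. rewrite (Cauchy_kernel g g' R0 r z Hg Hr Hz), (mean_kernel R0 r z Hr Hz), Cmult_1_r in HS.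
  exact HS.
Qed.

(** Uniqueness of coefficients makes the Cauchy integrals independent of [r], so one sequence serves
    the whole disk. The second conclusion keeps the integral formula on every circle, for letting
    [r] tend to 1 later. *)
Lemma Cauchy_Taylor_global (g g' : C -> C) (R0 : R) : 0 < R0 ->
  (forall x, Cmod x < R0 -> Cdiff g g' x) ->
  exists c, (forall z, Cmod z < R0 -> Cseries (fun n => c n * z ^ n)%C (g z)) /\
    (forall r, 0 < r < R0 -> forall n, Cauchy_coef g r n = c n).
Proof.
  intros HR Hg.
  assert (U : forall r, 0 < r < R0 -> forall n, Cauchy_coef g r n = Cauchy_coef g (R0 / 2) n).
  { intros r Hr n. apply (Cseries_coef_unique _ _ g (Rmin r (R0 / 2))).
    - apply Rmin_pos; lra.
    - intros z Hz. apply (Cauchy_Taylor g g' R0); [exact Hg|exact Hr|].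
      eapply Rlt_le_trans; [exact Hz|apply Rmin_l].
    - intros z Hz. apply (Cauchy_Taylor g g' R0); [exact Hg|lra|].
      eapply Rlt_le_trans; [exact Hz|apply Rmin_r]. }
  exists (Cauchy_coef g (R0 / 2)). split; [|exact U].
  intros z Hz. assert (Hz0 := Cmod_ge_0 z). set (r := (Cmod z + R0) / 2).
  assert (Hr : Cmod z < r < R0) by (unfold r; lra).
  apply (Cseries_ext (fun n => Cauchy_coef g r n * z ^ n)%C).
  - intros n. rewrite U by lra. reflexivity.
  - apply (Cauchy_Taylor g g' R0); [exact Hg|lra|lra].
Qed.

Lemma analytic_of_Cdiff (g g' : C -> C) :
  (forall z, Cmod z < 1 -> Cdiff g g' z) -> analytic_in_disk g.
Proof.
  intros Hg z0 Hz0. unfold in_disk in Hz0.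
  assert (HT : forall x, Cmod x < 1 - Cmod z0 -> Cdiff (fun x => g (z0 + x)%C) (fun x => g' (z0 + x)%C) x).
  { intros x Hx.
    assert (T := Cmod_triangle z0 x).
    eapply Cdiff_ext; [| |apply (Cdiff_comp g g' _ _ x (Cdiff_plus _ _ _ _ x (Cdiff_const z0 x) (Cdiff_id x)))].
    - reflexivity.
    - intros; simpl; ring.
    - apply Hg. lra. }
  destruct (Cauchy_Taylor_global _ _ (1 - Cmod z0) ltac:(lra) HT) as [c [Hc _]].
  exists (1 - Cmod z0), c. split; [lra|]. intros z Hz. apply Cseries_is_pseries.
  specialize (Hc (z - z0)%C Hz). cbv beta in Hc.
  replace (z0 + (z - z0))%C with z in Hc by ring. exact Hc.
Qed.

Lemma Cdiff_of_analytic (g : C -> C) : analytic_in_disk g -> forall z, Cmod z < 1 -> Cdiff g (C_derive g) z.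
Proof.
  intros Hg z0 Hz0. destruct (Hg z0 Hz0) as [r [c [Hr Hc]]].
  assert (Hs : forall x, Cmod x < r -> Cseries (fun n => c n * x ^ n)%C (g (z0 + x)%C)).
  { intros x Hx. apply Cseries_is_pseries. specialize (Hc (z0 + x)%C).
    replace (z0 + x - z0)%C with x in Hc by ring. now apply Hc. }
  assert (Hcv := Cseries_cvdisk c _ r Hs).
  (* A derivative at [z0] alone would not do: the Lipschitz clause of [Cdiff] needs [C_derive g] at
     all nearby points. *)
  assert (Hloc : forall x, Cmod x < r -> Cdiff g (fun y => PS (dcoef c) (y - z0)%C) (z0 + x)%C).
  { intros x Hx.
    apply (Cdiff_ext_loc (fun y => PS c (y - z0)%C) _ (fun y => PS (dcoef c) (y - z0)%C)).
    - exists (r - Cmod x). split; [lra|]. intros h Hh. split; [|reflexivity].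
      assert (T := Cmod_triangle x h).
      assert (E : (z0 + x + h - z0)%C = (x + h)%C) by ring. rewrite E.
      assert (E' : (z0 + x + h)%C = (z0 + (x + h))%C) by ring. rewrite E'.
      apply (Cseries_unique (fun n => c n * (x + h) ^ n)%C);
        [apply (PS_correct c r); [exact Hcv|lra]|apply Hs; lra].
    - eapply Cdiff_ext; [| |apply (Cdiff_comp (PS c) (PS (dcoef c)) _ _ _
        (Cdiff_minus _ _ _ _ _ (Cdiff_id (z0 + x)%C) (Cdiff_const z0 (z0 + x)%C)))].
      + reflexivity.
      + intros; simpl; ring.
      + apply (Cdiff_PS c r); [exact Hcv|]. replace (z0 + x - z0)%C with x by ring. exact Hx. }
  apply (Cdiff_ext_loc g g (fun y => PS (dcoef c) (y - z0)%C)).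
  - exists r. split; [exact Hr|]. intros h Hh. split; [reflexivity|].
    symmetry. apply (Cdiff_C_derive g (fun y => PS (dcoef c) (y - z0)%C)). now apply Hloc.
  - assert (HD := Hloc (RtoC 0) ltac:(rewrite Cmod_0; exact Hr)). now rewrite Cplus_0_r in HD.
Qed.

(** A duality argument: [|w| <= 1] is tested against the square of a linear polynomial on the circle
    and averaged. *)
Lemma mean_Schwarz_Pick (w w' : C -> C) (c : nat -> C) (r : R) :
  (forall z, Cmod z < 1 -> Cdiff w w' z) -> (forall z, Cmod z < 1 -> Cmod (w z) <= 1) ->
  0 < r < 1 -> (forall n, Cauchy_coef w r n = c n) -> c 0%nat = RtoC 0 ->
  r ^ 2 * Cmod (c 2%nat) <= 1 - r ^ 2 * Cmod (c 1%nat) ^ 2.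
Proof.
  intros Hw Hb Hr Hc Hc0.
  destruct (exists_rotation (c 2%nat)) as [e [He Ee]].
  assert (Hee : (e * Cconj e)%C = RtoC 1) by (rewrite <- Cmod2_conj, He; f_equal; ring).
  (* This choice maximises [2 Re (b r c_1) - |b|^2], the contribution of [c_1] to the final
     inequality. *)
  set (b := (RtoC r * Cconj (c 1%nat))%C). set (e' := Cconj e).
  set (rho := RtoC r). assert (Hrho : rho <> RtoC 0) by (intros E; apply RtoC_inj in E; lra).
  assert (LW : forall n, LipR (fun s => w (circ r s) * (/ circ r s) ^ n)%C).
  { intros n. apply LipR_mult; [apply (LipR_g_circ w w' 1 r Hw Hr)|].
    now apply (LipR_circ_inv_pow 1). }
  assert (LC : LipR (circ r)) by (intros t; apply (Cdiff_Lip _ _ _ (Cdiff_circ r (RtoC t)))).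
  (* On the circle [G = w e (r/zeta)^2 h^2 - 2 (h - 1)] with [h = 1 + b e' zeta/r], so [|w| <= 1] gives
     [Re G <= |h|^2 - 2 Re (h - 1) = 1 + |b|^2]; the mean of [G] is [2 |b|^2 + r^2 |c_2|]. *)
  set (G := fun s => ((2 * b * rho) * (w (circ r s) * (/ circ r s) ^ 1)
     + ((e * rho ^ 2) * (w (circ r s) * (/ circ r s) ^ 2)
     + ((b ^ 2 * e') * (w (circ r s) * (/ circ r s) ^ 0)
     + (- (2 * b * e' / rho)) * circ r s ^ 1)))%C).
  assert (LP : LipR (fun s => circ r s ^ 1)%C).
  { intros t. eapply Lip_ext; [|apply (LC t)]. intros; simpl; ring. }
  assert (E : mean G = RtoC (2 * (r ^ 2 * Cmod (c 1%nat) ^ 2) + r ^ 2 * Cmod (c 2%nat))).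
  { unfold G. rewrite !mean_plus by (repeat first [apply LipR_plus | apply LipR_scal]; auto).
    rewrite !mean_scal by auto.
    rewrite mean_circ_pow by (try lra; lia).
    change (2 * b * rho * Cauchy_coef w r 1 + (e * rho ^ 2 * Cauchy_coef w r 2
      + (b ^ 2 * e' * Cauchy_coef w r 0 + - (2 * b * e' / rho) * 0)) =
      RtoC (2 * (r ^ 2 * Cmod (c 1%nat) ^ 2) + r ^ 2 * Cmod (c 2%nat)))%C.
    rewrite !Hc, Hc0. rewrite !RtoC_plus, !RtoC_mult, <- Ee, RtoC_pow.
    rewrite Cmod2_conj. unfold b, rho. ring. }
  assert (I : Re (mean G) <= 1 + r ^ 2 * Cmod (c 1%nat) ^ 2).
  { apply mean_Re_le.
    { unfold G. repeat first [apply LipR_plus | apply LipR_scal]; auto. }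
    intros t _. set (zeta := circ r (RtoC t)).
    assert (Hz : zeta <> RtoC 0) by (apply circ_nonzero; lra).
    assert (Hm : Cmod zeta = r) by (apply Cmod_circ; lra).
    set (h := (1 + b * e' * zeta / rho)%C).
    assert (Hh : Cmod h ^ 2 = 1 + Cmod b ^ 2 + 2 * Re (b * e' * zeta / rho)%C).
    { assert (Hx : Cmod (b * e' * zeta / rho) = Cmod b).
      { unfold e', rho. rewrite Cmod_div by exact Hrho. rewrite !Cmod_mult, Cmod_conj, He, Hm, Cmod_R, Rabs_pos_eq by lra.
        field. lra. }
      rewrite <- Hx. rewrite !Cmod_sqr. unfold h. rewrite re_plus, im_plus, re_RtoC, im_RtoC. ring. }
    assert (EG : G (RtoC t) = (w zeta * (e * (rho / zeta) ^ 2 * h ^ 2) - 2 * (b * e' * zeta / rho))%C).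
    { unfold G. fold zeta. unfold h.
      replace (e * (rho / zeta) ^ 2 * (1 + b * e' * zeta / rho) ^ 2)%C with
        (e * (rho / zeta) ^ 2 + 2 * (e * e') * b * (rho / zeta) + (e * e') * e' * b ^ 2)%C
        by (field; auto).
      unfold e' at 3 4. rewrite Hee. field. auto. }
    rewrite EG. unfold Cminus. rewrite re_plus, re_opp.
    replace (Re (2 * (b * e' * zeta / rho))) with (2 * Re (b * e' * zeta / rho)) by (rewrite re_scal_l; ring).
    assert (B : Re (w zeta * (e * (rho / zeta) ^ 2 * h ^ 2)) <= Cmod h ^ 2).
    { eapply Rle_trans; [apply Rle_abs|]. eapply Rle_trans; [apply re_le_Cmod|].
      rewrite !Cmod_mult, !Cmod_pow, He, Cmod_div, Hm by exact Hz. unfold rho. rewrite Cmod_R, Rabs_pos_eq by lra.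
      replace (r / r) with 1 by (field; lra). rewrite pow1, !Rmult_1_l.
      rewrite <- (Rmult_1_l (Cmod h ^ 2)) at 2. apply Rmult_le_compat_r; [apply pow_le, Cmod_ge_0|].
      apply Hb. lra. }
    assert (Hbm : Cmod b ^ 2 = r ^ 2 * Cmod (c 1%nat) ^ 2).
    { unfold b. rewrite Cmod_mult, Cmod_conj, Cmod_R, Rabs_pos_eq by lra. ring. }
    lra. }
  rewrite E, re_RtoC in I. lra.
Qed.

Lemma Schwarz_Pick_coef (w w' : C -> C) (c : nat -> C) :
  (forall z, Cmod z < 1 -> Cdiff w w' z) -> (forall z, Cmod z < 1 -> Cmod (w z) <= 1) ->
  (forall r, 0 < r < 1 -> forall n, Cauchy_coef w r n = c n) -> c 0%nat = RtoC 0 ->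
  Cmod (c 2%nat) <= 1 - Cmod (c 1%nat) ^ 2.
Proof.
  intros Hw Hb Hc Hc0.
  assert (H2 := Cmod_ge_0 (c 2%nat)). assert (H1 := pow2_ge_0 (Cmod (c 1%nat))).
  set (A := Cmod (c 2%nat) + Cmod (c 1%nat) ^ 2).
  assert (HA : 0 <= A) by (unfold A; lra).
  assert (P : forall r, 0 < r < 1 -> r ^ 2 * A <= 1).
  { intros r Hr. assert (HS := mean_Schwarz_Pick w w' c r Hw Hb Hr (Hc r Hr) Hc0). unfold A. lra. }
  destruct (Rle_lt_dec A 1) as [HA1|HA1]; [unfold A in HA1; lra|exfalso].
  assert (Hi : 0 < / A < 1).
  { split; [apply Rinv_0_lt_compat; lra|]. rewrite <- Rinv_1. apply Rinv_lt_contravar; lra. }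
  (* If [A > 1], the arithmetic mean [r] of 1 and [1 / A] has [r^2 > 1 / A], contradicting
     [r^2 A <= 1]. *)
  specialize (P ((1 + / A) / 2) ltac:(lra)).
  assert (E : / A * A = 1) by (apply Rinv_l; lra).
  assert (0 < (/ A - 1) ^ 2) by (apply pow2_gt_0; lra).
  assert (/ A < ((1 + / A) / 2) ^ 2) by nra.
  nra.
Qed.

(** * The arcsine *)

(** The real mean value theorem along the radius to [z], applied to the real part after rotating the
    increment to the positive axis. *)
Lemma Cdiff_mean_value (f f' : C -> C) (R0 M : R) (z : C) :
  (forall x, Cmod x < R0 -> Cdiff f f' x) -> (forall x, Cmod x < R0 -> Cmod (f' x) <= M) ->
  Cmod z < R0 -> Cmod (f z - f (RtoC 0)) <= M * Cmod z.
Proof.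
  intros Hf HM Hz. destruct (exists_rotation (f z - f (RtoC 0))%C) as [u [Hu Eu]].
  assert (Ht : forall t, 0 <= t <= 1 -> Cmod (RtoC t * z) < R0).
  { intros t Ht. rewrite Cmod_mult, Cmod_R, Rabs_pos_eq by lra. generalize (Cmod_ge_0 z). nra. }
  destruct (MVT_cor2 (fun t => Re (u * f (RtoC t * z))%C) (fun t => Re (u * (f' (RtoC t * z) * z))%C) 0 1)
    as [c [Hc Hc01]]; [lra| |].
  - intros t Ht01. apply is_derive_Reals.
    apply (Cdiff_Re_derive (fun s => u * f (s * z))%C (fun s => u * (f' (s * z) * z))%C).
    apply Cdiff_scal. eapply Cdiff_ext; [| |apply (Cdiff_comp f f' _ _ (RtoC t)
      (Cdiff_mult _ _ _ _ _ (Cdiff_id (RtoC t)) (Cdiff_const z (RtoC t))))].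
    + reflexivity.
    + intros; simpl; ring.
    + now apply Hf, Ht.
  - rewrite <- (re_RtoC (Cmod _)), <- Eu.
    replace (u * (f z - f (RtoC 0)))%C with (u * f (RtoC 1 * z) - u * f (RtoC 0 * z))%C
      by (rewrite Cmult_1_l, Cmult_0_l; ring).
    unfold Cminus. rewrite re_plus, re_opp.
    replace (Re (u * f (RtoC 1 * z))%C + - Re (u * f (RtoC 0 * z))%C)
      with (Re (u * (f' (RtoC c * z) * z))%C) by lra.
    eapply Rle_trans; [apply Rle_abs|]. eapply Rle_trans; [apply re_le_Cmod|].
    rewrite !Cmod_mult, Hu, Rmult_1_l. apply Rmult_le_compat_r; [apply Cmod_ge_0|].
    apply HM, Ht. lra.
Qed.

Lemma Cdiff_constant (f f' : C -> C) (R0 : R) (z : C) :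
  (forall x, Cmod x < R0 -> Cdiff f f' x) -> (forall x, Cmod x < R0 -> f' x = RtoC 0) ->
  Cmod z < R0 -> f z = f (RtoC 0).
Proof.
  intros Hf H0 Hz. apply Ceq_minus, Cmod_eq_0. apply Rle_antisym; [|apply Cmod_ge_0].
  eapply Rle_trans; [|right; apply (Rmult_0_l (Cmod z))]. apply (Cdiff_mean_value f f' R0); [exact Hf| |exact Hz].
  intros x Hx. rewrite H0, Cmod_0 by exact Hx. lra.
Qed.

Lemma Csum_ext (a b : nat -> C) : (forall n, a n = b n) -> Csum a = Csum b.
Proof. intros E. unfold Csum. f_equal; apply Series_ext; intros n; now rewrite E. Qed.

Lemma PS_ext (c d : nat -> C) (z : C) : (forall n, c n = d n) -> PS c z = PS d z.
Proof. intros E. apply Csum_ext. intros n. now rewrite E. Qed.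

(* [(d n, d (n+1))], where [d] is the coefficient sequence of [(1 - u^2)^(-1/2)]. *)
Fixpoint dpair (n : nat) : R * R :=
  match n with
  | O => (1, 0)
  | S m => (snd (dpair m), fst (dpair m) * (INR (S m) / INR (S (S m))))
  end.

Definition dseq (n : nat) : R := fst (dpair n).

Lemma dseq_SS (n : nat) : dseq (S (S n)) = dseq n * (INR (S n) / INR (S (S n))).
Proof. reflexivity. Qed.

Lemma INR_S_pos (n : nat) : 0 < INR (S n).
Proof. apply lt_0_INR. lia. Qed.

Lemma dseq_bound (n : nat) : 0 <= dseq n <= 1.
Proof.
  assert (P : 0 <= fst (dpair n) <= 1 /\ 0 <= snd (dpair n) <= 1); [|exact (proj1 P)].
  induction n as [|n [H1 H2]]; [simpl; lra|].
  change (dpair (S n)) with (snd (dpair n), fst (dpair n) * (INR (S n) / INR (S (S n)))).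
  cbn [fst snd]. split; [exact H2|].
  assert (Hn := INR_S_pos n). assert (Hn' := INR_S_pos (S n)).
  assert (0 <= INR (S n) / INR (S (S n)) <= 1).
  { split; [apply Rdiv_le_0_compat; lra|]. apply (Rmult_le_reg_r (INR (S (S n)))); [lra|].
    unfold Rdiv; rewrite Rmult_assoc, Rinv_l by lra. rewrite (S_INR (S n)). lra. }
  nra.
Qed.

Definition bcoef (n : nat) : C := RtoC (dseq n).

Definition aseq (n : nat) : R := match n with O => 0 | S m => dseq m / INR (S m) end.

Definition acoef (n : nat) : C := RtoC (aseq n).

Lemma aseq_bound (n : nat) : 0 <= aseq n <= 1.
Proof.
  destruct n as [|n]; [simpl; lra|]. change (aseq (S n)) with (dseq n / INR (S n)). assert (H := dseq_bound n). assert (Hn := INR_S_pos n).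
  split; [apply Rdiv_le_0_compat; lra|]. apply (Rmult_le_reg_r (INR (S n))); [lra|].
  unfold Rdiv; rewrite Rmult_assoc, Rinv_l by lra. rewrite S_INR. generalize (pos_INR n). lra.
Qed.

Lemma cvdisk_bounded (c : nat -> C) : (forall n, Cmod (c n) <= 1) -> cvdisk c 1.
Proof.
  intros H rho Hr. exists 1. intros n. specialize (H n).
  assert (rho ^ n <= 1) by (rewrite <- (pow1 n); apply pow_incr; lra).
  assert (0 <= rho ^ n) by (apply pow_le; lra). generalize (Cmod_ge_0 (c n)). nra.
Qed.

Lemma cvdisk_bcoef : cvdisk bcoef 1.
Proof.
  apply cvdisk_bounded. intros n. unfold bcoef. assert (H := dseq_bound n).
  rewrite Cmod_R, Rabs_pos_eq; lra.
Qed.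

Lemma cvdisk_acoef : cvdisk acoef 1.
Proof.
  apply cvdisk_bounded. intros n. unfold acoef. assert (H := aseq_bound n).
  rewrite Cmod_R, Rabs_pos_eq; lra.
Qed.

Definition arcsin_ps : C -> C := PS acoef.
Definition rsqrt_ps : C -> C := PS bcoef.

Lemma Cdiff_arcsin_ps (u : C) : Cmod u < 1 -> Cdiff arcsin_ps rsqrt_ps u.
Proof.
  intros Hu. eapply Cdiff_ext; [| |apply (Cdiff_PS acoef 1 u cvdisk_acoef Hu)]; [reflexivity|].
  intros x. apply PS_ext. intros n. unfold dcoef, acoef, bcoef. change (aseq (S n)) with (dseq n / INR (S n)).
  rewrite <- RtoC_mult. f_equal. assert (Hn := INR_S_pos n). field. lra.
Qed.

(** The recursion [dseq_SS] is the coefficient form of [B' = u (u B' + B)]. *)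
Lemma rsqrt_ps_ode (u : C) : Cmod u < 1 ->
  (PS (dcoef bcoef) u * (1 - u * u))%C = (u * rsqrt_ps u)%C.
Proof.
  intros Hu. set (B' := PS (dcoef bcoef) u). set (B := rsqrt_ps u).
  assert (HB : Cseries (fun n => bcoef n * u ^ n)%C B) by now apply (PS_correct _ 1 u cvdisk_bcoef).
  assert (HB' : Cseries (fun n => dcoef bcoef n * u ^ n)%C B')
    by now apply (PS_correct _ 1 u (cvdisk_dcoef _ _ cvdisk_bcoef)).
  assert (H1 : Cseries (fun n => RtoC (INR n) * bcoef n * u ^ n)%C (u * B')%C).
  { apply Cseries_shift. replace (u * B' - RtoC (INR 0) * bcoef 0 * u ^ 0)%C with (u * B')%C by (simpl; ring).
    eapply Cseries_ext; [|apply (Cseries_scal u _ _ HB')]. intros n. unfold dcoef. simpl Cpow. ring. }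
  assert (H2 := Cseries_scal u _ _ (Cseries_plus _ _ _ _ H1 HB)).
  assert (H3 := proj1 (Cseries_shift _ _) HB').
  (* Since [dseq 1 = 0], shifting the series of [B'] loses no term. *)
  assert (E : (B' - dcoef bcoef 0 * u ^ 0)%C = B').
  { unfold dcoef, bcoef. change (dseq 1) with 0. simpl. ring. }
  cbv beta in H3. rewrite E in H3.
  assert (E2 : B' = (u * (u * B' + B))%C).
  { apply (Cseries_unique _ _ _ H3). eapply Cseries_ext; [|exact H2].
    intros n. cbv beta. unfold dcoef, bcoef. rewrite dseq_SS.
    assert (Hn := INR_S_pos (S n)).
    replace (RtoC (INR (S (S n))) * RtoC (dseq n * (INR (S n) / INR (S (S n)))))%C
      with (RtoC (INR n) * RtoC (dseq n) + RtoC (dseq n))%C.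
    - simpl Cpow. ring.
    - rewrite <- !RtoC_mult, <- RtoC_plus. f_equal. rewrite (S_INR n). field. lra. }
  replace (B' * (1 - u * u))%C with (B' - u * u * B')%C by ring. rewrite E2 at 1. ring.
Qed.

Lemma rsqrt_ps_0 : rsqrt_ps (RtoC 0) = RtoC 1.
Proof. unfold rsqrt_ps. rewrite (PS_0 bcoef 1); [reflexivity|lra|exact cvdisk_bcoef]. Qed.

Lemma arcsin_ps_0 : arcsin_ps (RtoC 0) = RtoC 0.
Proof. unfold arcsin_ps. rewrite (PS_0 acoef 1); [reflexivity|lra|exact cvdisk_acoef]. Qed.

Lemma Cdiff_rsqrt_ps (u : C) : Cmod u < 1 -> Cdiff rsqrt_ps (PS (dcoef bcoef)) u.
Proof. intros Hu. exact (Cdiff_PS bcoef 1 u cvdisk_bcoef Hu). Qed.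

Lemma Cdiff_one_minus_sqr (u : C) : Cdiff (fun u => 1 - u * u)%C (fun u => - (2 * u))%C u.
Proof.
  eapply Cdiff_ext; [| |apply (Cdiff_minus _ _ _ _ u (Cdiff_const (RtoC 1) u) (Cdiff_mult _ _ _ _ u (Cdiff_id u) (Cdiff_id u)))];
    intros; simpl; ring.
Qed.

(** By the differential equation the left side has derivative 0. Squaring identifies the series
    without choosing a branch of the square root. *)
Lemma rsqrt_ps_sqr (u : C) : Cmod u < 1 -> (rsqrt_ps u * rsqrt_ps u * (1 - u * u))%C = RtoC 1.
Proof.
  intros Hu.
  assert (HD : forall x, Cmod x < 1 -> Cdiff (fun u => rsqrt_ps u * rsqrt_ps u * (1 - u * u))%C
     (fun u => (PS (dcoef bcoef) u * rsqrt_ps u + rsqrt_ps u * PS (dcoef bcoef) u) * (1 - u * u)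
        + rsqrt_ps u * rsqrt_ps u * - (2 * u))%C x).
  { intros x Hx. assert (DB := Cdiff_rsqrt_ps x Hx).
    exact (Cdiff_mult _ _ _ _ x (Cdiff_mult _ _ _ _ x DB DB) (Cdiff_one_minus_sqr x)). }
  rewrite (Cdiff_constant _ _ 1 u HD); [|  |exact Hu].
  - rewrite rsqrt_ps_0. ring.
  - intros x Hx. cbv beta. assert (E := rsqrt_ps_ode x Hx).
    replace ((PS (dcoef bcoef) x * rsqrt_ps x + rsqrt_ps x * PS (dcoef bcoef) x) * (1 - x * x)
        + rsqrt_ps x * rsqrt_ps x * - (2 * x))%C
      with (2 * rsqrt_ps x * (PS (dcoef bcoef) x * (1 - x * x)) - 2 * x * rsqrt_ps x * rsqrt_ps x)%C by ring.
    rewrite E. ring.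
Qed.

(** This is [exp (i arcsin u) = sqrt (1 - u^2) + i u], with the root written as [(1 - u^2)] times
    the series of its inverse. The product has derivative 0. *)
Lemma Cexp_arcsin_ps (u : C) : Cmod u < 1 ->
  (((1 - u * u) * rsqrt_ps u + Ci * u) * Cexp (- Ci * arcsin_ps u))%C = RtoC 1.
Proof.
  intros Hu.
  assert (Ci2 : (Ci * Ci)%C = (- (1))%C) by (apply C_eq; simpl; ring).
  assert (HD : forall x, Cmod x < 1 ->
    Cdiff (fun u => ((1 - u * u) * rsqrt_ps u + Ci * u) * Cexp (- Ci * arcsin_ps u))%C
     (fun u => ((- (2 * u) * rsqrt_ps u + (1 - u * u) * PS (dcoef bcoef) u) + Ci * 1) * Cexp (- Ci * arcsin_ps u)
       + ((1 - u * u) * rsqrt_ps u + Ci * u) * (Cexp (- Ci * arcsin_ps u) * (- Ci * rsqrt_ps u)))%C x).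
  { intros x Hx.
    apply Cdiff_mult; [apply Cdiff_plus; [apply Cdiff_mult; [apply Cdiff_one_minus_sqr|now apply Cdiff_rsqrt_ps]|]|].
    - apply (Cdiff_scal Ci _ _ _ (Cdiff_id x)).
    - apply (Cdiff_comp Cexp Cexp); [|apply Cdiff_Cexp]. apply Cdiff_scal. now apply Cdiff_arcsin_ps. }
  rewrite (Cdiff_constant _ _ 1 u HD); [|  |exact Hu].
  - rewrite rsqrt_ps_0, arcsin_ps_0. replace (- Ci * RtoC 0)%C with (RtoC 0) by ring. rewrite Cexp_0. ring.
  - intros x Hx. cbv beta. assert (E := rsqrt_ps_ode x Hx). assert (E2 := rsqrt_ps_sqr x Hx).
    set (b := rsqrt_ps x) in *. set (b' := PS (dcoef bcoef) x) in *. set (e := Cexp (- Ci * arcsin_ps x)).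
    replace ((- (2 * x) * b + (1 - x * x) * b' + Ci * 1) * e + ((1 - x * x) * b + Ci * x) * (e * (- Ci * b)))%C
      with (e * (- (2 * x) * b + b' * (1 - x * x) + Ci - Ci * (b * b * (1 - x * x)) - (Ci * Ci) * x * b))%C by ring.
    rewrite E, E2, Ci2. ring.
Qed.

Lemma Csin_arcsin_ps (u : C) : Cmod u < 1 -> Csin (arcsin_ps u) = u.
Proof.
  intros Hu. assert (E := Cexp_arcsin_ps u Hu). assert (E2 := rsqrt_ps_sqr u Hu).
  assert (Ci2 : (Ci * Ci)%C = (- (1))%C) by (apply C_eq; simpl; ring).
  assert (Eo := Cexp_opp (Ci * arcsin_ps u)).
  set (p := ((1 - u * u) * rsqrt_ps u + Ci * u)%C) in *.
  (* [p] and [m] play [sqrt (1 - u^2) + i u] and [sqrt (1 - u^2) - i u], inverse to each other,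
     hence [exp (i arcsin u)] and [exp (- i arcsin u)]. *)
  set (m := ((1 - u * u) * rsqrt_ps u - Ci * u)%C).
  assert (Hpm : (p * m)%C = RtoC 1).
  { unfold p, m. replace (((1 - u * u) * rsqrt_ps u + Ci * u) * ((1 - u * u) * rsqrt_ps u - Ci * u))%C
      with ((1 - u * u) * (rsqrt_ps u * rsqrt_ps u * (1 - u * u)) - (Ci * Ci) * u * u)%C by ring.
    rewrite E2, Ci2. ring. }
  replace (- Ci * arcsin_ps u)%C with (- (Ci * arcsin_ps u))%C in E by ring.
  set (e1 := Cexp (Ci * arcsin_ps u)) in *. set (e2 := Cexp (- (Ci * arcsin_ps u))) in *.
  assert (H1 : e1 = p).
  { replace p with (p * (e1 * e2))%C by (rewrite Eo; ring).
    replace (p * (e1 * e2))%C with (e1 * (p * e2))%C by ring. rewrite E. ring. }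
  assert (H2 : e2 = m).
  { replace e2 with ((p * m) * e2)%C by (rewrite Hpm; ring).
    replace (p * m * e2)%C with (m * (p * e2))%C by ring. rewrite E. ring. }
  unfold Csin. fold e1 e2. rewrite H1, H2. unfold p, m. field.
  apply Ci_nz.
Qed.

Lemma Re_Csin (v : C) : Re (Csin v) = sin (Re v) * cosh (Im v).
Proof.
  unfold Csin. destruct v as [x y].
  assert (E1 : (Ci * (x, y))%C = (- y, x)) by (apply C_eq; simpl; ring).
  rewrite E1. unfold Cexp. simpl (Re (- y, x)). simpl (Im (- y, x)).
  simpl (Re (- (- y, x))). simpl (Im (- (- y, x))).
  rewrite cos_neg, sin_neg, Ropp_involutive.
  replace (((exp (- y) * cos x)%R, (exp (- y) * sin x)%R) - ((exp y * cos x)%R, (exp y * - sin x)%R))%C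
    with (2 * Ci * ((sin x * cosh y)%R, (cos x * sinh y)%R))%C.
  - assert (Q : forall X : C, (2 * Ci * X / (2 * Ci))%C = X) by (intros; field; apply Ci_nz).
    now rewrite Q.
  - unfold cosh, sinh. apply C_eq; simpl; field.
Qed.

Lemma sin_zero_strip (x : R) : - PI < x < PI -> sin x = 0 -> x = 0.
Proof.
  intros Hx Hs. destruct (Rtotal_order x 0) as [H|[H|H]]; [|exact H|].
  - assert (0 < sin (- x)) by (apply sin_gt_0; lra). rewrite sin_neg in *. lra.
  - assert (0 < sin x) by (apply sin_gt_0; lra). lra.
Qed.

(** With [e_j = exp (i v_j)] the equation becomes [(e1 - e2) (1 + e1 e2) = 0]. The second factor
    cannot vanish because [Re v1 + Re v2] lies strictly between [-PI] and [PI]. One strict strip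
    suffices for that, and the value chosen by [Carcsin] is only known to lie in the closed one. *)
Lemma Csin_injective (v1 v2 : C) :
  - (PI / 2) < Re v1 < PI / 2 -> - (PI / 2) <= Re v2 <= PI / 2 -> Csin v1 = Csin v2 -> v1 = v2.
Proof.
  intros Hv1 Hv2 E. assert (HPI := PI_RGT_0).
  set (e1 := Cexp (Ci * v1)). set (e2 := Cexp (Ci * v2)).
  assert (I1 : Cexp (- (Ci * v1)) = (/ e1)%C).
  { assert (H := Cexp_opp (Ci * v1)). fold e1 in H. assert (N : e1 <> RtoC 0) by apply Cexp_nonzero.
    replace (Cexp (- (Ci * v1))) with (/ e1 * (e1 * Cexp (- (Ci * v1))))%C by (field; exact N).
    rewrite H. ring. }
  assert (I2 : Cexp (- (Ci * v2)) = (/ e2)%C).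
  { assert (H := Cexp_opp (Ci * v2)). fold e2 in H. assert (N : e2 <> RtoC 0) by apply Cexp_nonzero.
    replace (Cexp (- (Ci * v2))) with (/ e2 * (e2 * Cexp (- (Ci * v2))))%C by (field; exact N).
    rewrite H. ring. }
  assert (N1 : e1 <> RtoC 0) by apply Cexp_nonzero. assert (N2 : e2 <> RtoC 0) by apply Cexp_nonzero.
  assert (F : ((e1 - e2) * (1 + e1 * e2))%C = RtoC 0).
  { unfold Csin in E. rewrite I1, I2 in E. fold e1 e2 in E.
    replace ((e1 - e2) * (1 + e1 * e2))%C with
      (2 * Ci * e1 * e2 * ((e1 - / e1) / (2 * Ci) - (e2 - / e2) / (2 * Ci)))%C
      by (field; repeat split; auto; apply Ci_nz).
    rewrite E. ring. }
  assert (G : forall v, (Ci * v)%C = (- Im v, Re v)) by (intros [x y]; apply C_eq; simpl; ring).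
  destruct (Ceq_dec (e1 - e2)%C (RtoC 0)) as [Z|Z].
  - apply Ceq_minus in Z. unfold e1, e2, Cexp in Z. rewrite !G in Z. simpl in Z.
    injection Z as Z1 Z2.
    assert (P1 := exp_pos (- Im v1)). assert (P2 := exp_pos (- Im v2)).
    assert (Q : exp (- Im v1) = exp (- Im v2)).
    { assert (T1 := sin2_cos2 (Re v1)). assert (T2 := sin2_cos2 (Re v2)). unfold Rsqr in T1, T2.
      set (p := exp (- Im v1)) in *. set (q := exp (- Im v2)) in *.
      assert (p * p = q * q).
      { replace (p * p) with (p * p * (sin (Re v1) * sin (Re v1) + cos (Re v1) * cos (Re v1))) by (rewrite T1; ring).
        replace (q * q) with (q * q * (sin (Re v2) * sin (Re v2) + cos (Re v2) * cos (Re v2))) by (rewrite T2; ring).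
        replace (p * p * (sin (Re v1) * sin (Re v1) + cos (Re v1) * cos (Re v1)))
          with ((p * sin (Re v1)) * (p * sin (Re v1)) + (p * cos (Re v1)) * (p * cos (Re v1))) by ring.
        rewrite Z1, Z2. ring. }
      assert ((p - q) * (p + q) = 0) by lra.
      destruct (Rmult_integral _ _ H0); lra. }
    assert (Y := exp_inv _ _ Q). rewrite Q in Z2. apply Rmult_eq_reg_l in Z2; [|lra].
    apply C_eq; [|lra]. now apply sin_inj; lra.
  - exfalso. assert (W : (1 + e1 * e2)%C = RtoC 0).
    { destruct (Ceq_dec (1 + e1 * e2)%C (RtoC 0)) as [W|W]; [exact W|].
      now destruct (Cmult_neq_0 _ _ Z W). }
    unfold e1, e2 in W. rewrite <- Cexp_plus in W.
    unfold Cexp in W. rewrite re_plus, im_plus, !G in W. simpl in W.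
    set (p := exp (- Im v1 + - Im v2)) in *. assert (Hp : 0 < p) by apply exp_pos.
    assert (W1 := f_equal Re W). assert (W2 := f_equal Im W). simpl in W1, W2.
    assert (S0 : sin (Re v1 + Re v2) = 0).
    { apply (Rmult_eq_reg_l p); lra. }
    apply sin_zero_strip in S0; [|lra]. rewrite S0, cos_0 in W1. lra.
Qed.

Lemma Rpartial_le_Cseries (b : nat -> R) (l : C) (N : nat) :
  (forall n, 0 <= b n) -> Cseries (fun n => RtoC (b n)) l -> Rpartial b N <= Re l.
Proof.
  intros Hb H. apply le_epsilon. intros eps He. destruct (H eps He) as [N1 HN1].
  assert (E : forall n, Cpartial (fun n => RtoC (b n)) n = RtoC (Rpartial b n)).
  { induction n as [|n IH]; simpl; [reflexivity|]. now rewrite IH, RtoC_plus. }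
  assert (Mon : forall k, Rpartial b N <= Rpartial b (N + k)).
  { induction k as [|k IH]; [rewrite Nat.add_0_r; lra|]. rewrite Nat.add_succ_r. simpl.
    specialize (Hb (N + k)%nat). lra. }
  specialize (HN1 (N + N1)%nat ltac:(lia)). rewrite E in HN1.
  assert (T := re_le_Cmod (RtoC (Rpartial b (N + N1)) - l)). unfold Cminus in T, HN1.
  rewrite re_plus, re_opp, re_RtoC in T. apply Rabs_le_between in T. specialize (Mon N1). lra.
Qed.

Lemma arcsin_ps_real_terms (s : R) (n : nat) : (acoef n * RtoC s ^ n)%C = RtoC (aseq n * s ^ n).
Proof. unfold acoef. now rewrite <- RtoC_pow, <- RtoC_mult. Qed.

Lemma arcsin_ps_real_Im (s : R) : Im (arcsin_ps (RtoC s)) = 0.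
Proof.
  change (Im (arcsin_ps (RtoC s))) with (Series (fun n => Im (acoef n * RtoC s ^ n)%C)).
  rewrite (Series_ext _ (fun n => 0 * 0)).
  - rewrite (Series_scal_l 0 (fun _ => 0)). ring.
  - intros n. rewrite arcsin_ps_real_terms, im_RtoC. ring.
Qed.

Lemma sin_arcsin_ps_real (s : R) : 0 <= s < 1 -> sin (Re (arcsin_ps (RtoC s))) = s.
Proof.
  intros Hs. assert (E := f_equal Re (Csin_arcsin_ps (RtoC s) ltac:(rewrite Cmod_R, Rabs_pos_eq; lra))).
  rewrite Re_Csin, arcsin_ps_real_Im, cosh_0, re_RtoC in E. lra.
Qed.

(** On [[0, 1)] the value [PI / 2] is never taken, since its sine is 1; starting from 0, the
    function stays below by continuity. *)
Lemma arcsin_ps_real_lt (s : R) : 0 <= s < 1 -> Re (arcsin_ps (RtoC s)) < PI / 2.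
Proof.
  intros Hs. assert (HPI := PI_RGT_0).
  assert (NE : forall t, 0 <= t < 1 -> Re (arcsin_ps (RtoC t)) <> PI / 2).
  { intros t Ht E. assert (H := sin_arcsin_ps_real t Ht). rewrite E, sin_PI2 in H. lra. }
  destruct (Rle_lt_dec (PI / 2) (Re (arcsin_ps (RtoC s)))) as [H|H]; [exfalso|exact H].
  assert (H' : PI / 2 < Re (arcsin_ps (RtoC s))) by (specialize (NE s Hs); lra).
  assert (Hs0 : 0 < s).
  { destruct (Req_dec s 0) as [E|E]; [|lra]. rewrite E, arcsin_ps_0 in H'. simpl in H'. lra. }
  destruct (IVT_interv (fun t => Re (arcsin_ps (RtoC t)) - PI / 2) 0 s) as [t [Ht E]].
  - intros t Ht. apply continuity_pt_minus; [|apply continuity_pt_const; now intros ? ?].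
    apply continuity_pt_filterlim. apply Lip_continuous_Re.
    apply (Cdiff_Lip _ _ _ (Cdiff_arcsin_ps (RtoC t) ltac:(rewrite Cmod_R, Rabs_pos_eq; lra))).
  - exact Hs0.
  - rewrite arcsin_ps_0. simpl. lra.
  - lra.
  - apply (NE t); lra.
Qed.

Lemma Bernoulli_lower (x : R) (n : nat) : 0 <= x <= 1 -> 1 - INR n * x <= (1 - x) ^ n.
Proof.
  intros Hx. induction n as [|n IH]; [simpl; lra|]. rewrite S_INR. simpl.
  assert (0 <= INR n) by apply pos_INR. assert (0 <= INR n * x) by nra. nra.
Qed.

(** Nonnegativity bounds [s^N] times the partial sum by the arcsine of [s], hence by [PI / 2]; then
    [s] tends to 1. *)
Lemma aseq_sum_le (N : nat) : Rpartial aseq N <= PI / 2.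
Proof.
  set (P := Rpartial aseq N).
  assert (HP0 : 0 <= P).
  { unfold P. induction N as [|n IH]; simpl; [lra|]. assert (H := aseq_bound n). lra. }
  assert (K : forall s, 0 <= s < 1 -> s ^ N * P <= PI / 2).
  { intros s Hs.
    assert (H1 : Rpartial (fun n => aseq n * s ^ n) N <= Re (arcsin_ps (RtoC s))).
    { apply Rpartial_le_Cseries.
      - intros n. apply Rmult_le_pos; [apply aseq_bound|apply pow_le; lra].
      - eapply Cseries_ext; [intros n; apply arcsin_ps_real_terms|].
        apply (PS_correct acoef 1); [exact cvdisk_acoef|rewrite Cmod_R, Rabs_pos_eq; lra]. }
    assert (H2 : forall m, (m <= N)%nat -> s ^ N * Rpartial aseq m <= Rpartial (fun n => aseq n * s ^ n) m).
    { induction m as [|m IH]; intros Hm; simpl; [lra|]. specialize (IH ltac:(lia)).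
      assert (Hp : s ^ N <= s ^ m).
      { replace N with (m + (N - m))%nat by lia. rewrite pow_add.
        rewrite <- (Rmult_1_r (s ^ m)) at 2. apply Rmult_le_compat_l; [apply pow_le; lra|].
        rewrite <- (pow1 (N - m)). apply pow_incr. lra. }
      assert (Ha := aseq_bound m). nra. }
    specialize (H2 N (le_n N)). assert (H3 := arcsin_ps_real_lt s Hs). unfold P. lra. }
  apply le_epsilon. intros eps He.
  assert (HN := pos_INR N). assert (HNP : 0 <= INR N * P) by nra.
  (* With [s = 1 - x], Bernoulli's inequality loses at most [N x P <= eps]. *)
  set (x := Rmin (1 / 2) (eps / (INR N * P + 1))).
  assert (Hx : 0 < x) by (apply Rmin_pos; [lra|apply Rdiv_lt_0_compat; lra]).
  assert (Hx1 : x <= 1 / 2) by apply Rmin_l.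
  assert (Hx2 : x <= eps / (INR N * P + 1)) by apply Rmin_r.
  apply (Rmult_le_compat_r (INR N * P + 1)) in Hx2; [|lra].
  replace (eps / (INR N * P + 1) * (INR N * P + 1)) with eps in Hx2 by (field; lra).
  specialize (K (1 - x) ltac:(lra)). assert (B := Bernoulli_lower x N ltac:(lra)).
  apply (Rmult_le_compat_r P) in B; [|exact HP0]. nra.
Qed.

(** The constant coefficient is 0 and [|u|^n <= |u|] for [n >= 1], so the nonnegative coefficients
    just add up. *)
Lemma Cmod_arcsin_ps (u : C) : Cmod u < 1 -> Cmod (arcsin_ps u) <= PI / 2 * Cmod u.
Proof.
  intros Hu. apply (Cseries_bound _ _ _ (PS_correct acoef 1 u cvdisk_acoef Hu)). intros N.
  assert (Hu0 := Cmod_ge_0 u).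
  eapply Rle_trans; [apply (Cpartial_Rpartial _ (fun n => Cmod u * aseq n))|].
  - intros n. rewrite Cmod_mult, Cmod_pow. unfold acoef. assert (Ha := aseq_bound n).
    rewrite Cmod_R, Rabs_pos_eq by lra. destruct n as [|n]; [simpl; lra|].
    assert (Cmod u ^ n <= 1) by (rewrite <- (pow1 n); apply pow_incr; lra).
    assert (0 <= Cmod u ^ n) by now apply pow_le. simpl pow.
    assert (Cmod u * Cmod u ^ n <= Cmod u) by nra. nra.
  - rewrite Rpartial_scal. assert (H := aseq_sum_le N). nra.
Qed.

(** The series supplies a preimage in the strip, so the choice operator is constrained, and
    injectivity of the sine pins it down. *)
Lemma Carcsin_eq (u : C) : Cmod u < 1 -> Carcsin u = arcsin_ps u.
Proof.
  intros Hu.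
  assert (HB : - (PI / 2) < Re (arcsin_ps u) < PI / 2).
  { assert (HPI := PI_RGT_0). assert (H := Cmod_arcsin_ps u Hu). assert (R := re_le_Cmod (arcsin_ps u)).
    apply Rabs_le_between in R. nra. }
  assert (S := Csin_arcsin_ps u Hu).
  assert (P := epsilon_spec (inhabits (RtoC 0)) (fun w : C => - (PI / 2) <= Re w <= PI / 2 /\ Csin w = u)
    ltac:(exists (arcsin_ps u); split; [lra|exact S])).
  destruct P as [P1 P2]. fold (Carcsin u) in P1, P2.
  symmetry. apply Csin_injective; [exact HB|exact P1|]. now rewrite S.
Qed.

(** * Coefficients and bounds of the functional *)

Lemma PS_shift (c : nat -> C) (R0 : R) (z : C) : cvdisk c R0 -> Cmod z < R0 ->
  PS c z = (c 0%nat + z * PS (fun n => c (S n)) z)%C.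
Proof.
  intros H Hz. apply (Cseries_unique _ _ _ (PS_correct c R0 z H Hz)).
  apply Cseries_shift.
  replace (c 0%nat + z * PS (fun n => c (S n)) z - c 0%nat * z ^ 0)%C with (z * PS (fun n => c (S n)) z)%C
    by (simpl; ring).
  eapply Cseries_ext; [|apply (Cseries_scal z), (PS_correct _ R0 z (cvdisk_shift _ _ H) Hz)].
  intros n. simpl. ring.
Qed.

Lemma PS_expansion (c : nat -> C) (R0 : R) (n : nat) : 0 < R0 -> cvdisk c R0 ->
  bigO n (fun h => PS c h - Cpartial (fun k => c k * h ^ k) n)%C.
Proof.
  intros HR. revert c. induction n as [|n IH]; intros c H.
  - apply (bigO_ext 0 (fun h => PS c (0 + h))%C).
    + intros h. rewrite Cplus_0_l. simpl. ring.
    + apply Lip_bounded, (Cdiff_Lip _ _ _ (Cdiff_PS c R0 (RtoC 0) H ltac:(rewrite Cmod_0; exact HR))).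
  - apply (bigO_ext_loc (S n) (fun h => h * (PS (fun k => c (S k)) h - Cpartial (fun k => c (S k) * h ^ k) n))%C).
    + exists R0. split; [exact HR|]. intros h Hh. rewrite (PS_shift c R0 h H Hh), Cpartial_shift.
      replace (Cpartial (fun k => (c (S k) * h ^ S k)%C) n) with (h * Cpartial (fun k => (c (S k) * h ^ k)%C) n)%C.
      * simpl. ring.
      * rewrite <- Cpartial_scal. clear. induction n as [|n IH]; [reflexivity|].
        cbn [Cpartial]. rewrite IH. simpl. ring.
    + apply (bigO_mult 1 n); [apply bigO_id|]. apply IH, cvdisk_shift, H.
Qed.

Lemma Cseries_expansion (c : nat -> C) (f : C -> C) (R0 : R) (n : nat) : 0 < R0 ->
  (forall z, Cmod z < R0 -> Cseries (fun k => c k * z ^ k)%C (f z)) ->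
  bigO n (fun h => f h - Cpartial (fun k => c k * h ^ k) n)%C.
Proof.
  intros HR H. assert (Hc := Cseries_cvdisk c f R0 H).
  eapply bigO_ext_loc; [|exact (PS_expansion c R0 n HR Hc)].
  exists R0. split; [exact HR|]. intros h Hh. do 2 f_equal.
  apply (Cseries_unique (fun k => c k * h ^ k)%C); [now apply (PS_correct c R0)|now apply H].
Qed.

Lemma Cseries_at_0 (c : nat -> C) (f : C -> C) (R0 : R) : 0 < R0 ->
  (forall z, Cmod z < R0 -> Cseries (fun k => c k * z ^ k)%C (f z)) -> f (RtoC 0) = c 0%nat.
Proof.
  intros HR H. assert (Hc := Cseries_cvdisk c f R0 H). rewrite <- (PS_0 c R0 HR Hc).
  apply (Cseries_unique (fun k => c k * RtoC 0 ^ k)%C); [apply H|apply (PS_correct c R0); [exact Hc|]];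
    now rewrite Cmod_0.
Qed.

Lemma Cdiff_Cseries (c : nat -> C) (f : C -> C) (R0 : R) (z : C) :
  (forall z, Cmod z < R0 -> Cseries (fun k => c k * z ^ k)%C (f z)) -> Cmod z < R0 ->
  Cdiff f (PS (dcoef c)) z.
Proof.
  intros H Hz. assert (Hc := Cseries_cvdisk c f R0 H).
  eapply Cdiff_ext_loc; [|exact (Cdiff_PS c R0 z Hc Hz)].
  exists (R0 - Cmod z). split; [lra|]. intros h Hh. split; [|reflexivity].
  assert (T := Cmod_triangle z h).
  apply (Cseries_unique (fun k => c k * (z + h) ^ k)%C); [apply (PS_correct c R0); [exact Hc|]|apply H]; lra.
Qed.

Lemma C_derive2 (f f' f'' : C -> C) (R0 : R) (z : C) :
  (forall x, Cmod x < R0 -> Cdiff f f' x) -> (forall x, Cmod x < R0 -> Cdiff f' f'' x) -> Cmod z < R0 ->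
  C_derive f z = f' z /\ C_derive (C_derive f) z = f'' z.
Proof.
  intros H1 H2 Hz. split; [now apply Cdiff_C_derive, H1|]. apply Cdiff_C_derive.
  eapply Cdiff_ext_loc; [|exact (H2 z Hz)].
  exists (R0 - Cmod z). split; [lra|]. intros h Hh. split; [|reflexivity].
  symmetry. apply (Cdiff_C_derive f f'), H1. assert (T := Cmod_triangle z h). lra.
Qed.

Lemma bigO_coef2_zero (al be : C) : bigO 3 (fun h => al * h ^ 1 + be * h ^ 2)%C -> al = RtoC 0 /\ be = RtoC 0.
Proof.
  intros H. assert (Ha : al = RtoC 0).
  { apply (bigO_coef_zero 1).
    apply (bigO_ext 2 (fun h => (al * h ^ 1 + be * h ^ 2) - be * h ^ 2)%C); [intros; ring|].
    apply bigO_minus; [apply (bigO_weaken 2 3); [lia|exact H]|]. apply bigO_scal, bigO_pow. }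
  split; [exact Ha|]. apply (bigO_coef_zero 2). eapply bigO_ext; [|exact H].
  intros h. rewrite Ha. simpl. ring.
Qed.

(** The arcsine has no quadratic term, so [arcsin w] and [w] share the coefficients [c_1] and
    [c_2]. *)
Lemma arcsin_ps_expansion : bigO 3 (fun u => arcsin_ps u - u)%C.
Proof.
  eapply bigO_ext; [|exact (PS_expansion acoef 1 3 ltac:(lra) cvdisk_acoef)].
  intros h. unfold arcsin_ps. simpl Cpartial. unfold acoef, aseq, dseq. simpl.
  replace (1 / 1) with 1 by field. replace (0 / (1 + 1)) with 0 by field. ring.
Qed.

(** Compares the coefficients of [h] and [h^2] in [h f'' = f' (2/PI) arcsin w]. Near 0 the function
    [w] is small and [f'] is close to 1, so the arcsine series applies and the denominator may be
    cleared. *)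
Lemma class_coefficients (f w : C -> C) (a : nat -> C) (c1 c2 : C) :
  normalized_expansion f a ->
  bigO 3 (fun h => w h - (c1 * h + c2 * h ^ 2))%C ->
  (forall z, in_disk z -> 1 + z * C_derive (C_derive f) z / C_derive f z = 1 + 2 / PI * Carcsin (w z))%C ->
  a 2%nat = (c1 / PI)%C /\ a 3%nat = ((c2 + 2 * c1 ^ 2 / PI) / (3 * PI))%C.
Proof.
  intros [Ha0 [Ha1 Ha]] Hw Heq.
  assert (HPI := PI_RGT_0). assert (PIn : RtoC PI <> RtoC 0) by (intros E; apply RtoC_inj in E; lra).
  assert (HS : forall z, Cmod z < 1 -> Cseries (fun n => a n * z ^ n)%C (f z)).
  { intros z Hz. apply Cseries_is_pseries. now apply Ha. }
  assert (Hcv := Cseries_cvdisk a f 1 HS).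
  set (F1 := PS (dcoef a)). set (F2 := PS (dcoef (dcoef a))).
  assert (D1 : forall x, Cmod x < 1 -> Cdiff f F1 x) by (intros; now apply (Cdiff_Cseries a f 1)).
  assert (D2 : forall x, Cmod x < 1 -> Cdiff F1 F2 x) by (intros; now apply (Cdiff_PS _ 1), H; apply cvdisk_dcoef).
  assert (E1 : bigO 2 (fun h => F1 h - (1 + 2 * a 2%nat * h))%C).
  { eapply bigO_ext; [|exact (PS_expansion (dcoef a) 1 2 ltac:(lra) (cvdisk_dcoef _ _ Hcv))].
    intros h. unfold F1. simpl Cpartial. unfold dcoef. rewrite Ha1. simpl. rewrite !RtoC_plus. ring. }
  assert (E2 : bigO 2 (fun h => F2 h - (2 * a 2%nat + 6 * a 3%nat * h))%C).
  { eapply bigO_ext; [|exact (PS_expansion (dcoef (dcoef a)) 1 2 ltac:(lra) (cvdisk_dcoef _ _ (cvdisk_dcoef _ _ Hcv)))].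
    intros h. unfold F2. simpl Cpartial. unfold dcoef. simpl. rewrite !RtoC_plus. ring. }
  assert (W1 : bigO 1 w).
  { apply (bigO_ext 1 (fun h => (w h - (c1 * h + c2 * h ^ 2)) + (c1 * h ^ 1 + c2 * h ^ 2))%C); [intros; simpl; ring|].
    apply bigO_plus; [apply (bigO_weaken 1 3); [lia|exact Hw]|].
    apply bigO_plus; apply bigO_scal; [apply bigO_pow|apply (bigO_weaken 1 2); [lia|apply bigO_pow]]. }
  set (A := fun h => arcsin_ps (w h)).
  assert (EA : bigO 3 (fun h => A h - (c1 * h + c2 * h ^ 2))%C).
  { apply (bigO_ext 3 (fun h => (arcsin_ps (w h) - w h) + (w h - (c1 * h + c2 * h ^ 2)))%C); [intros; unfold A; ring|].
    apply bigO_plus; [|exact Hw]. apply (bigO_comp 3 (fun u => arcsin_ps u - u)%C w arcsin_ps_expansion W1). }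
  assert (A1 : bigO 1 A).
  { apply (bigO_ext 1 (fun h => (A h - (c1 * h + c2 * h ^ 2)) + (c1 * h ^ 1 + c2 * h ^ 2))%C); [intros; simpl; ring|].
    apply bigO_plus; [apply (bigO_weaken 1 3); [lia|exact EA]|].
    apply bigO_plus; apply bigO_scal; [apply bigO_pow|apply (bigO_weaken 1 2); [lia|apply bigO_pow]]. }
  assert (Z : bigO 3 (fun h => h * F2 h - F1 h * (2 / PI * A h))%C).
  { apply (bigO_ext_loc 3 (fun _ => RtoC 0)); [|apply bigO_zero].
    destruct (bigO_small w 1 W1 ltac:(lra)) as [d1 [Hd1 Hs1]].
    assert (L1 := Cdiff_Lip _ _ _ (D2 (RtoC 0) ltac:(rewrite Cmod_0; lra))).
    destruct (bigO_small _ 1 L1 ltac:(lra)) as [d2 [Hd2 Hs2]].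
    exists (Rmin 1 (Rmin d1 d2)). split; [apply Rmin_pos; [lra|apply Rmin_pos; lra]|].
    intros h Hh. assert (h1 : Cmod h < 1) by (eapply Rlt_le_trans; [exact Hh|apply Rmin_l]).
    assert (h2 : Cmod h < Rmin d1 d2) by (eapply Rlt_le_trans; [exact Hh|apply Rmin_r]).
    specialize (Hs1 h (Rlt_le_trans _ _ _ h2 (Rmin_l _ _))).
    specialize (Hs2 h (Rlt_le_trans _ _ _ h2 (Rmin_r _ _))).
    assert (F10 : F1 (RtoC 0) = RtoC 1).
    { unfold F1. rewrite (PS_0 _ 1 ltac:(lra) (cvdisk_dcoef _ _ Hcv)). unfold dcoef. rewrite Ha1. simpl. ring. }
    rewrite F10, Cplus_0_l in Hs2.
    assert (Fn : F1 h <> RtoC 0).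
    { intros E. rewrite E in Hs2. replace (0 - 1)%C with (- (1))%C in Hs2 by ring. rewrite Cmod_m1 in Hs2. lra. }
    assert (Q := Heq h h1). destruct (C_derive2 f F1 F2 1 h D1 D2 h1) as [Q1 Q2].
    rewrite Q1, Q2, (Carcsin_eq _ Hs1) in Q. fold (A h) in Q.
    assert (Q3 : (h * F2 h / F1 h)%C = (2 / PI * A h)%C).
    { replace (h * F2 h / F1 h)%C with ((1 + h * F2 h / F1 h) - 1)%C by ring. rewrite Q. ring. }
    rewrite <- Q3. field. exact Fn. }
  assert (T : bigO 3 (fun h => (2 / PI * c1 - 2 * a 2%nat) * h ^ 1
      + (2 / PI * (c2 + 2 * a 2%nat * c1) - 6 * a 3%nat) * h ^ 2)%C).
  { apply (bigO_ext 3 (fun h => h * (F2 h - (2 * a 2%nat + 6 * a 3%nat * h))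
      - (h * F2 h - F1 h * (2 / PI * A h))
      - (2 / PI * ((F1 h - (1 + 2 * a 2%nat * h)) * A h))
      - (2 / PI * ((1 + 2 * a 2%nat * h) * (A h - (c1 * h + c2 * h ^ 2)) + (2 * a 2%nat * c2) * h ^ 3)))%C).
    { intros h. simpl. ring. }
    apply bigO_minus; [apply bigO_minus; [apply bigO_minus|]|].
    - apply (bigO_mult 1 2); [apply bigO_id|exact E2].
    - exact Z.
    - apply bigO_scal. apply (bigO_mult 2 1); assumption.
    - apply bigO_scal, bigO_plus; [|apply bigO_scal, bigO_pow].
      apply (bigO_mult 0 3); [|exact EA].
      apply bigO_plus; [apply bigO_const|]. apply bigO_scal, (bigO_weaken 0 1); [lia|apply bigO_id]. }
  destruct (bigO_coef2_zero _ _ T) as [T1 T2].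
  assert (R2 : a 2%nat = (c1 / PI)%C).
  { replace (a 2%nat) with (c1 / PI - (2 / PI * c1 - 2 * a 2%nat) / 2)%C by (field; exact PIn).
    rewrite T1. field. exact PIn. }
  split; [exact R2|].
  replace (a 3%nat) with ((2 / PI * (c2 + 2 * a 2%nat * c1) - (2 / PI * (c2 + 2 * a 2%nat * c1) - 6 * a 3%nat)) / 6)%C
    by (field; exact PIn).
  rewrite T2, R2. field. exact PIn.
Qed.

Lemma functional_value (lambda : C) (mu : R) (a : nat -> C) (c1 c2 : C) :
  a 2%nat = (c1 / PI)%C -> a 3%nat = ((c2 + 2 * c1 ^ 2 / PI) / (3 * PI))%C ->
  F_functional lambda mu a =
    (Cmod (PI * c2 + (2 - 3 * lambda) * c1 ^ 2) - 3 * PI * mu * Cmod c1) / (3 * PI ^ 2).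
Proof.
  intros E2 E3. assert (HPI := PI_RGT_0).
  assert (PIn : RtoC PI <> RtoC 0) by (intros E; apply RtoC_inj in E; lra).
  unfold F_functional. rewrite E2, E3.
  replace ((c2 + 2 * c1 ^ 2 / PI) / (3 * PI) - lambda * (c1 / PI) ^ 2)%C
    with ((PI * c2 + (2 - 3 * lambda) * c1 ^ 2) / RtoC (3 * PI ^ 2))%C.
  - assert (0 < PI ^ 2) by (apply pow_lt; lra).
    rewrite Cmod_div, Cmod_div by (try assumption; intros E; apply RtoC_inj in E; lra).
    rewrite !Cmod_R, !Rabs_pos_eq by lra. field. lra.
  - rewrite RtoC_mult, RtoC_pow. field. exact PIn.
Qed.

(** * The optimisation in one variable *)

Lemma upper_bound_alt (lambda : C) (mu : R) :
  upper_bound lambda mu =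
    (if Rle_dec (PI * (1 + 3 * mu)) (Cmod (2 - 3 * lambda)) then Cmod (2 - 3 * lambda) - 3 * PI * mu else PI)
    / (3 * PI ^ 2).
Proof. assert (HPI := PI_RGT_0). unfold upper_bound. destruct Rle_dec; field; lra. Qed.

(** [3 PI^2] times [Theta1]: the minimum over [0 <= x <= 1] of
    [|PI (1 - x^2) - t x^2| - 3 PI mu x]. *)
Definition lower_bound (t mu : R) : R :=
  if Rle_dec t (PI / 2 * (3 * mu - 2)) then t - 3 * PI * mu
  else if Rle_dec (PI / 4 * (9 * mu ^ 2 - 4)) t then - (3 * PI * mu * sqrt (PI / (t + PI)))
  else - PI - 9 * PI ^ 2 * mu ^ 2 / (4 * (t + PI)).

Lemma Theta1_alt (lambda : C) (mu : R) :
  Theta1 lambda mu = lower_bound (Cmod (2 - 3 * lambda)) mu / (3 * PI ^ 2).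
Proof.
  assert (HPI := PI_RGT_0). assert (Ht := Cmod_ge_0 (2 - 3 * lambda)).
  unfold Theta1, lower_bound. destruct Rle_dec; [field; lra|]. destruct Rle_dec; field; lra.
Qed.

Lemma Cmod_quadratic_bounds (k c1 c2 : C) : Cmod c2 <= 1 - Cmod c1 ^ 2 ->
  Cmod (PI * c2 + k * c1 ^ 2) <= PI * (1 - Cmod c1 ^ 2) + Cmod k * Cmod c1 ^ 2 /\
  Cmod k * Cmod c1 ^ 2 - PI * (1 - Cmod c1 ^ 2) <= Cmod (PI * c2 + k * c1 ^ 2).
Proof.
  intros H. assert (HPI := PI_RGT_0).
  assert (E1 : Cmod (PI * c2) = PI * Cmod c2) by (rewrite Cmod_mult, Cmod_R, Rabs_pos_eq; lra).
  assert (E2 : Cmod (k * c1 ^ 2) = Cmod k * Cmod c1 ^ 2) by now rewrite Cmod_mult, Cmod_pow.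
  split.
  - eapply Rle_trans; [apply Cmod_triangle|]. rewrite E1, E2. nra.
  - rewrite Cplus_comm. eapply Rle_trans; [|apply Cmod_triangle_rev]. rewrite E1, E2. nra.
Qed.

(** The objective is [PI + x ((t - PI) x - 3 PI mu)], at most the larger of its values [PI] at
    [x = 0] and [t - 3 PI mu] at [x = 1]. The case split is where these two agree. *)
Lemma upper_optimum (t mu x : R) : 0 < mu -> 0 <= t -> 0 <= x <= 1 ->
  PI * (1 - x ^ 2) + t * x ^ 2 - 3 * PI * mu * x <=
  (if Rle_dec (PI * (1 + 3 * mu)) t then t - 3 * PI * mu else PI).
Proof.
  intros Hmu Ht Hx. assert (HPI := PI_RGT_0). destruct Rle_dec as [H|H].
  - assert (0 <= (1 - x) * ((t - PI) * (1 + x) - 3 * PI * mu)); [|nra].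
    apply Rmult_le_pos; [lra|]. assert (0 < PI * mu) by nra.
    assert (0 <= (t - PI) * x) by (apply Rmult_le_pos; lra). lra.
  - assert (x * ((t - PI) * x - 3 * PI * mu) <= 0); [|nra].
    assert ((t - PI) * x <= 3 * PI * mu); [|nra].
    assert (0 < PI * mu) by nra. destruct (Rle_lt_dec 0 (t - PI)); nra.
Qed.

(** [M] is at least 0 and at least [(t + PI) x^2 - PI], which changes sign at
    [s = sqrt (PI / (t + PI))]. Subtracting [3 PI mu x] gives a parabola with vertex
    [3 PI mu / (2 (t + PI))]. The cases are: vertex at least 1, minimum at 1; vertex at most [s],
    minimum at the corner [s]; otherwise the vertex itself. *)
Lemma lower_optimum (t mu x M : R) : 0 < mu -> 0 <= t -> 0 <= x <= 1 -> 0 <= M ->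
  t * x ^ 2 - PI * (1 - x ^ 2) <= M -> lower_bound t mu <= M - 3 * PI * mu * x.
Proof.
  intros Hmu Ht Hx HM0 HM. assert (HPI := PI_RGT_0). unfold lower_bound.
  destruct Rle_dec as [H|H]; [|destruct Rle_dec as [H'|H']].
  - assert (0 <= (1 - x) * (3 * PI * mu - (t + PI) * (1 + x))); [|nra].
    apply Rmult_le_pos; [lra|]. nra.
  - assert (Hq : 0 < PI / (t + PI)) by (apply Rdiv_lt_0_compat; lra).
    set (s := sqrt (PI / (t + PI))).
    assert (Hs : 0 < s) by now apply sqrt_lt_R0.
    assert (Es : (t + PI) * (s * s) = PI).
    { unfold s. rewrite sqrt_sqrt by lra. field. lra. }
    destruct (Rle_lt_dec x s) as [Hxs|Hxs].
    + assert (0 <= 3 * PI * mu) by nra. nra.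
    (* To the right of [s] the parabola increases, because its vertex is at most [s]. *)
    + assert (K : 3 * PI * mu <= 2 * (t + PI) * s).
      { apply Rsqr_incr_0_var; [|nra]. unfold Rsqr.
        replace (2 * (t + PI) * s * (2 * (t + PI) * s)) with (4 * (t + PI) * ((t + PI) * (s * s))) by ring.
        rewrite Es. assert (9 * mu ^ 2 * PI <= 4 * (t + PI)) by lra. nra. }
      assert (0 <= (x - s) * ((t + PI) * (x + s) - 3 * PI * mu)); [|nra].
      apply Rmult_le_pos; [lra|]. nra.
  - assert (E : M - 3 * PI * mu * x >= (t + PI) * x ^ 2 - 3 * PI * mu * x - PI) by nra.
    assert (Q : (t + PI) * x ^ 2 - 3 * PI * mu * x - PI - (- PI - 9 * PI ^ 2 * mu ^ 2 / (4 * (t + PI)))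
      = (t + PI) * (x - 3 * PI * mu / (2 * (t + PI))) ^ 2) by (field; lra).
    assert (0 <= (t + PI) * (x - 3 * PI * mu / (2 * (t + PI))) ^ 2).
    { apply Rmult_le_pos; [lra|apply pow2_ge_0]. }
    lra.
Qed.

(** * Extremal functions *)

(** The termwise primitive vanishing at 0, a right inverse of [dcoef]. *)
Definition icoef (c : nat -> C) (n : nat) : C :=
  match n with O => RtoC 0 | S m => (c m / RtoC (INR (S m)))%C end.

Lemma INR_S_nonzero (n : nat) : RtoC (INR (S n)) <> RtoC 0.
Proof. intros E. apply RtoC_inj in E. generalize (INR_S_pos n). lra. Qed.

Lemma dcoef_icoef (c : nat -> C) (n : nat) : dcoef (icoef c) n = c n.
Proof.
  unfold dcoef. change (icoef c (S n)) with (c n / RtoC (INR (S n)))%C. field. apply INR_S_nonzero.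
Qed.

Lemma cvdisk_icoef (c : nat -> C) (R0 : R) : cvdisk c R0 -> cvdisk (icoef c) R0.
Proof.
  intros H rho Hr. destruct (H rho Hr) as [M HM]. exists (M * rho).
  assert (HM0 : 0 <= M).
  { specialize (HM 0%nat). simpl in HM. generalize (Cmod_ge_0 (c 0%nat)). lra. }
  intros n. destruct n as [|n].
  - simpl. rewrite Cmod_0. nra.
  - change (icoef c (S n)) with (c n / RtoC (INR (S n)))%C.
    rewrite Cmod_div by apply INR_S_nonzero. assert (Hn := INR_S_pos n).
    rewrite Cmod_R, Rabs_pos_eq by lra.
    assert (H1 : 1 <= INR (S n)) by (rewrite S_INR; generalize (pos_INR n); lra).
    assert (H2 : Cmod (c n) / INR (S n) <= Cmod (c n)).
    { apply (Rmult_le_reg_r (INR (S n))); [lra|]. unfold Rdiv. rewrite Rmult_assoc, Rinv_l by lra.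
      generalize (Cmod_ge_0 (c n)). nra. }
    specialize (HM n). simpl pow. assert (0 <= rho ^ n) by (apply pow_le; lra).
    apply (Rle_trans _ (Cmod (c n) * rho ^ n * rho)); [|nra].
    replace (Cmod (c n) / INR (S n) * (rho * rho ^ n)) with (Cmod (c n) / INR (S n) * (rho ^ n * rho)) by ring.
    rewrite (Rmult_assoc (Cmod (c n))). apply Rmult_le_compat_r; [nra|exact H2].
Qed.

Lemma Cdiff_PS_icoef (c : nat -> C) (f : C -> C) (R0 : R) (z : C) :
  (forall x, Cmod x < R0 -> Cseries (fun n => c n * x ^ n)%C (f x)) -> Cmod z < R0 -> Cdiff (PS (icoef c)) f z.
Proof.
  intros H Hz. assert (Hc := Cseries_cvdisk c f R0 H).
  eapply Cdiff_ext_loc; [|exact (Cdiff_PS _ R0 z (cvdisk_icoef _ _ Hc) Hz)].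
  exists (R0 - Cmod z). split; [lra|]. intros h Hh. split; [reflexivity|].
  assert (T := Cmod_triangle z h).
  rewrite (PS_ext _ c) by apply dcoef_icoef.
  apply (Cseries_unique (fun n => c n * (z + h) ^ n)%C); [apply (PS_correct c R0); [exact Hc|]|apply H]; lra.
Qed.

(* The Noshiro--Warschawski criterion. *)
Lemma univalent_of_Re_pos (f f' : C -> C) :
  (forall z, Cmod z < 1 -> Cdiff f f' z) -> (forall z, Cmod z < 1 -> 0 < Re (f' z)) -> univalent f.
Proof.
  intros Hf Hp z w Hz Hw E. unfold in_disk in *.
  destruct (Ceq_dec (w - z)%C (RtoC 0)) as [H|H]; [symmetry; now apply Ceq_minus|exfalso].
  set (d := (w - z)%C) in *.
  assert (Hin : forall t, 0 <= t <= 1 -> Cmod (z + RtoC t * d) < 1).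
  { intros t Ht. replace (z + RtoC t * d)%C with (RtoC (1 - t) * z + RtoC t * w)%C
      by (unfold d; rewrite RtoC_minus; ring).
    eapply Rle_lt_trans; [apply Cmod_triangle|]. rewrite !Cmod_mult, !Cmod_R, !Rabs_pos_eq by lra.
    destruct (Req_dec t 0) as [->|Ht0]; [lra|]. generalize (Cmod_ge_0 z) (Cmod_ge_0 w). nra. }
  (* Along the segment from [z] to [w] the real part of [conj d * f] has derivative
     [|d|^2 Re f' > 0], so its end values differ. *)
  destruct (MVT_cor2 (fun t => Re (Cconj d * f (z + RtoC t * d))%C)
    (fun t => Re (Cconj d * (f' (z + RtoC t * d) * d))%C) 0 1) as [c [Hc Hc01]]; [lra| |].
  - intros t Ht. apply is_derive_Reals.
    apply (Cdiff_Re_derive (fun s => Cconj d * f (z + s * d))%C (fun s => Cconj d * (f' (z + s * d) * d))%C).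
    apply Cdiff_scal. eapply Cdiff_ext; [| |apply (Cdiff_comp f f' _ _ (RtoC t)
      (Cdiff_plus _ _ _ _ _ (Cdiff_const z (RtoC t)) (Cdiff_mult _ _ _ _ _ (Cdiff_id (RtoC t)) (Cdiff_const d (RtoC t)))))].
    + reflexivity.
    + intros; simpl; ring.
    + now apply Hf, Hin.
  - replace (z + RtoC 1 * d)%C with w in Hc by (unfold d; ring).
    replace (z + RtoC 0 * d)%C with z in Hc by ring. rewrite E in Hc.
    set (g := f' (z + RtoC c * d)%C) in *.
    assert (Hg : 0 < Re g) by (apply Hp, Hin; lra).
    replace (Cconj d * (g * d))%C with (RtoC (Cmod d ^ 2) * g)%C in Hc
      by (rewrite Cmod2_conj; ring).
    rewrite re_scal_l in Hc. assert (0 < Cmod d ^ 2) by (apply pow_lt; now apply Cmod_gt_0). nra.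
Qed.

(** Meant for quotients: [z L' = q] says nothing about [L'] at 0, where the bound comes by
    continuity. *)
Lemma Cmod_le_of_punctured (f : C -> C) (M : R) : Lip f (RtoC 0) ->
  (forall z, z <> RtoC 0 -> Cmod z < 1 -> Cmod (f z) <= M) -> Cmod (f (RtoC 0)) <= M.
Proof.
  intros L H. apply le_epsilon. intros eps He.
  destruct (bigO_small _ eps L He) as [d [Hd Hs]].
  set (s := Rmin (d / 2) (1 / 2)). assert (Hs0 : 0 < s) by (apply Rmin_pos; lra).
  assert (Hs1 : s <= d / 2) by apply Rmin_l. assert (Hs2 : s <= 1 / 2) by apply Rmin_r.
  assert (Es : Cmod (RtoC s) = s) by (rewrite Cmod_R; apply Rabs_pos_eq; lra).
  specialize (Hs (RtoC s) ltac:(lra)). rewrite Cplus_0_l in Hs.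
  specialize (H (RtoC s) ltac:(intros E; apply RtoC_inj in E; lra) ltac:(lra)).
  replace (f (RtoC 0)) with (f (RtoC s) - (f (RtoC s) - f (RtoC 0)))%C by ring.
  eapply Rle_trans; [apply Cmod_triangle_minus|]. lra.
Qed.

(** Assuming [|w z| <= |z|] gives [w 0 = 0] and keeps [w] in the open disk, where the arcsine is a
    power series. *)
Lemma class_C_arcsin_of_Schwarz (w w' : C -> C) (c1 c2 : C) :
  (forall z, Cmod z < 1 -> Cdiff w w' z) -> (forall z, Cmod z < 1 -> Cmod (w z) <= Cmod z) ->
  bigO 3 (fun h => w h - (c1 * h + c2 * h ^ 2))%C ->
  exists f a, class_C_arcsin f /\ normalized_expansion f a /\
    a 2%nat = (c1 / PI)%C /\ a 3%nat = ((c2 + 2 * c1 ^ 2 / PI) / (3 * PI))%C.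
Proof.
  intros Hw Hb Hexp.
  assert (HPI := PI_RGT_0). assert (PIn : RtoC PI <> RtoC 0) by (intros E; apply RtoC_inj in E; lra).
  assert (w0 : w (RtoC 0) = RtoC 0).
  { apply Cmod_eq_0. apply Rle_antisym; [|apply Cmod_ge_0]. rewrite <- Cmod_0 at 2. apply Hb. rewrite Cmod_0. lra. }
  assert (Hw1 : forall z, Cmod z < 1 -> Cmod (w z) < 1) by (intros z Hz; specialize (Hb z Hz); lra).
  set (q := fun z => (2 / PI * arcsin_ps (w z))%C).
  assert (Dq : forall z, Cmod z < 1 -> Cdiff q (fun z => 2 / PI * (rsqrt_ps (w z) * w' z))%C z).
  { intros z Hz. apply Cdiff_scal. apply Cdiff_comp; [now apply Hw|]. now apply Cdiff_arcsin_ps, Hw1. }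
  assert (Hq : forall z, Cmod z < 1 -> Cmod (q z) <= Cmod z).
  { intros z Hz. unfold q. rewrite Cmod_mult, Cmod_div, !Cmod_R, !Rabs_pos_eq by (try assumption; lra).
    assert (H := Cmod_arcsin_ps (w z) (Hw1 z Hz)). specialize (Hb z Hz).
    apply (Rle_trans _ (2 / PI * (PI / 2 * Cmod z))); [|right; field; lra].
    apply Rmult_le_compat_l; [apply Rdiv_le_0_compat; lra|]. nra. }
  (* With one series for [q] in the whole disk, dividing by [z] is an index shift and integrating is
     termwise. *)
  destruct (Cauchy_Taylor_global q _ 1 ltac:(lra) Dq) as [qn [Sq _]].
  assert (q0 : qn 0%nat = RtoC 0).
  { rewrite <- (Cseries_at_0 qn q 1 ltac:(lra) Sq). unfold q. rewrite w0, arcsin_ps_0. ring. }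
  set (L' := PS (fun n => qn (S n))).
  assert (Hqn := Cseries_cvdisk qn q 1 Sq). assert (Hqn1 := cvdisk_shift _ _ Hqn).
  assert (EL : forall z, Cmod z < 1 -> (z * L' z)%C = q z).
  { intros z Hz. unfold L'. assert (E := PS_shift qn 1 z Hqn Hz). rewrite q0, Cplus_0_l in E. rewrite <- E.
    apply (Cseries_unique (fun n => qn n * z ^ n)%C); [now apply (PS_correct qn 1)|now apply Sq]. }
  set (L := PS (icoef (fun n => qn (S n)))).
  assert (SL' : forall z, Cmod z < 1 -> Cseries (fun n => qn (S n) * z ^ n)%C (L' z)) by (intros; now apply (PS_correct _ 1)).
  assert (DL' : forall z, Cmod z < 1 -> Cdiff L' (PS (dcoef (fun n => qn (S n)))) z) by (intros; now apply (Cdiff_PS _ 1)).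
  assert (DL : forall z, Cmod z < 1 -> Cdiff L L' z) by (intros; now apply (Cdiff_PS_icoef _ _ 1)).
  assert (BL' : forall z, Cmod z < 1 -> Cmod (L' z) <= 1).
  { assert (P : forall z, z <> RtoC 0 -> Cmod z < 1 -> Cmod (L' z) <= 1).
    { intros z Hz0 Hz. assert (Hm := proj1 (Cmod_gt_0 z) Hz0). apply (Rmult_le_reg_l (Cmod z)); [exact Hm|].
      rewrite <- Cmod_mult, EL by exact Hz. specialize (Hq z Hz). lra. }
    intros z Hz. destruct (Ceq_dec z (RtoC 0)) as [->|Hz0]; [|now apply P].
    apply Cmod_le_of_punctured; [|exact P]. apply (Cdiff_Lip _ _ _ (DL' _ Hz)). }
  assert (L0 : L (RtoC 0) = RtoC 0) by (unfold L; rewrite (PS_0 _ 1 ltac:(lra) (cvdisk_icoef _ _ Hqn1)); reflexivity).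
  assert (BL : forall z, Cmod z < 1 -> Cmod (L z) < 1).
  { intros z Hz. assert (H := Cdiff_mean_value L L' 1 1 z DL BL' Hz). rewrite L0 in H.
    replace (L z - 0)%C with (L z) in H by ring. lra. }
  set (g := fun z => Cexp (L z)).
  assert (Dg : forall z, Cmod z < 1 -> Cdiff g (fun z => Cexp (L z) * L' z)%C z).
  { intros z Hz. apply (Cdiff_comp Cexp Cexp); [now apply DL|apply Cdiff_Cexp]. }
  (* The same for [exp L]; its termwise primitive is [f], with a normalized expansion in the whole
     disk. *)
  destruct (Cauchy_Taylor_global g _ 1 ltac:(lra) Dg) as [gn [Sg _]].
  assert (g0 : gn 0%nat = RtoC 1).
  { rewrite <- (Cseries_at_0 gn g 1 ltac:(lra) Sg). unfold g. rewrite L0. apply Cexp_0. }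
  set (f := PS (icoef gn)).
  assert (Df : forall z, Cmod z < 1 -> Cdiff f g z) by (intros; now apply (Cdiff_PS_icoef _ _ 1)).
  assert (Hgn := Cseries_cvdisk gn g 1 Sg).
  assert (Hn : normalized_expansion f (icoef gn)).
  { split; [reflexivity|split].
    - simpl. rewrite g0. field.
    - intros z Hz. apply Cseries_is_pseries. apply (PS_correct _ 1); [now apply cvdisk_icoef|exact Hz]. }
  assert (Heq : forall z, in_disk z ->
     (1 + z * C_derive (C_derive f) z / C_derive f z = 1 + 2 / PI * Carcsin (w z))%C).
  { intros z Hz. destruct (C_derive2 f g _ 1 z Df Dg Hz) as [E1 E2]. rewrite E1, E2.
    rewrite Carcsin_eq by now apply Hw1. fold (q z). rewrite <- (EL z Hz). unfold g. field. apply Cexp_nonzero. }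
  exists f, (icoef gn). split; [|split; [exact Hn|exact (class_coefficients f w _ c1 c2 Hn Hexp Heq)]].
  split; [split; [split|]|].
  - exact (analytic_of_Cdiff f g Df).
  - now exists (icoef gn).
  - apply (univalent_of_Re_pos f g Df). intros z Hz.
    change (0 < exp (Re (L z)) * cos (Im (L z))).
    apply Rmult_lt_0_compat; [apply exp_pos|]. specialize (BL z Hz).
    assert (I := im_le_Cmod (L z)). apply Rabs_le_between in I. assert (P2 := PI2_1).
    apply cos_gt_0; lra.
  - exists w. split; [|exact Heq]. split; [exact (analytic_of_Cdiff w w' Hw)|split; [exact w0|]].
    intros z Hz. left. now apply Hw1.
Qed.

(** The difference of the squared moduli is [(1 - x^2) (1 - |v|^2)]. *)
Lemma Blaschke_bound (x : R) (v : C) : 0 <= x <= 1 -> Cmod v <= 1 -> Cmod (RtoC x + v) <= Cmod (1 + RtoC x * v).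
Proof.
  intros Hx Hv. apply Rsqr_incr_0_var; [|apply Cmod_ge_0].
  rewrite !Rsqr_pow2, !Cmod_sqr.
  assert (H : Cmod v ^ 2 <= 1) by (rewrite <- (pow1 2); apply pow_incr; split; [apply Cmod_ge_0|exact Hv]).
  rewrite Cmod_sqr in H. rewrite !re_plus, !im_plus, re_scal_l, im_scal_l, !re_RtoC, !im_RtoC.
  assert (0 <= (1 - x ^ 2) * (1 - (Re v ^ 2 + Im v ^ 2))); [|nra].
  apply Rmult_le_pos; [nra|lra].
Qed.

(* The Schwarz functions [z (x + e z) / (1 + x e z)] are those with [|c_2| = 1 - |c_1|^2]. *)
Lemma class_C_arcsin_extremal (x : R) (e : C) : 0 <= x <= 1 -> Cmod e = 1 ->
  exists f a, class_C_arcsin f /\ normalized_expansion f a /\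
    a 2%nat = (x / PI)%C /\ a 3%nat = ((e * RtoC (1 - x ^ 2) + 2 * x ^ 2 / PI) / (3 * PI))%C.
Proof.
  intros Hx He.
  set (den := fun z => (1 + RtoC x * (e * z))%C). set (w := fun z => (z * (RtoC x + e * z) * / den z)%C).
  assert (Hez : forall z, Cmod (e * z) = Cmod z) by (intros; rewrite Cmod_mult, He; ring).
  assert (Hden : forall z, Cmod z < 1 -> den z <> RtoC 0).
  { intros z Hz. apply Cmod_gt_0. unfold den.
    eapply Rlt_le_trans; [|apply Cmod_triangle_rev]. rewrite Cmod_1, Cmod_mult, Hez, Cmod_R, Rabs_pos_eq by lra.
    generalize (Cmod_ge_0 z). nra. }
  assert (Dlin : forall k z, Cdiff (fun z => k * z)%C (fun _ => k * 1)%C z) by (intros k z; apply (Cdiff_scal k _ _ z (Cdiff_id z))).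
  assert (Dden : forall z, Cdiff den (fun _ => 0 + RtoC x * (e * 1))%C z).
  { intros z. apply (Cdiff_plus _ _ _ _ z (Cdiff_const _ z)). apply Cdiff_scal, Dlin. }
  assert (Dw : exists w', forall z, Cmod z < 1 -> Cdiff w w' z).
  { eexists. intros z Hz. apply Cdiff_mult; [apply Cdiff_mult; [apply Cdiff_id|]|].
    - apply Cdiff_plus; [apply Cdiff_const|apply Dlin].
    - apply (Cdiff_inv den (fun _ => 0 + RtoC x * (e * 1))%C z (Hden z Hz)), Dden. }
  destruct Dw as [w' Dw].
  apply (class_C_arcsin_of_Schwarz w w' (RtoC x) (e * RtoC (1 - x ^ 2))%C Dw).
  - intros z Hz. unfold w. rewrite !Cmod_mult, Cmod_inv by now apply Hden.
    assert (B := Blaschke_bound x (e * z) Hx ltac:(rewrite Hez; lra)). fold (den z) in B.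
    assert (Hd := proj1 (Cmod_gt_0 _) (Hden z Hz)).
    apply (Rmult_le_reg_r (Cmod (den z))); [exact Hd|].
    rewrite Rmult_assoc, Rinv_l, Rmult_1_r by lra. apply Rmult_le_compat_l; [apply Cmod_ge_0|exact B].
  (* This is the exact remainder of [w] after its terms of order 1 and 2. *)
  - apply (bigO_ext_loc 3 (fun h => (- (RtoC x * e ^ 2 * RtoC (1 - x ^ 2))) * (h ^ 3 * / den (0 + h)))%C).
    + exists 1. split; [lra|]. intros h Hh. rewrite Cplus_0_l. unfold w.
      assert (N := Hden h Hh). unfold den in *. rewrite RtoC_minus, RtoC_pow. field. exact N.
    + apply bigO_scal. apply (bigO_mult 3 0); [apply bigO_pow|].
      apply (Lip_bounded (fun z => / den z)%C).
      apply (Lip_comp Cinv den); [apply (Cdiff_Lip _ _ _ (Dden (RtoC 0)))|].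
      apply Lip_Cinv, Hden. rewrite Cmod_0. lra.
Qed.

(** If [u] rotates [2 - 3 lambda] to the positive axis, then [e = s * conj u] puts both terms on one
    line: they add for [s = 1] and oppose each other for [s = -1]. *)
Lemma F_functional_extremal (lambda : C) (mu x s : R) : 0 <= x <= 1 -> s = 1 \/ s = -1 ->
  exists f a,
    class_C_arcsin f /\ normalized_expansion f a /\
    F_functional lambda mu a =
      (Rabs (PI * (1 - x ^ 2) + s * (Cmod (2 - 3 * lambda) * x ^ 2)) - 3 * PI * mu * x) / (3 * PI ^ 2).
Proof.
  intros Hx Hs.
  destruct (exists_rotation (2 - 3 * lambda)) as [u [Hu Eu]].
  assert (Es : Cmod (RtoC s * Cconj u) = 1).
  { rewrite Cmod_mult, Cmod_conj, Hu, Cmod_R, Rmult_1_r. destruct Hs as [->| ->]; [apply Rabs_R1|].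
    rewrite Rabs_left; lra. }
  destruct (class_C_arcsin_extremal x _ Hx Es) as [f [a [Hf [Ha [E2 E3]]]]].
  exists f, a. split; [exact Hf|split; [exact Ha|]].
  rewrite (functional_value lambda mu a _ _ E2 E3). rewrite Cmod_R, Rabs_pos_eq by lra.
  do 2 f_equal.
  assert (G : forall z, Cmod z = Cmod (u * z)) by (intros; rewrite Cmod_mult, Hu; ring).
  rewrite G.
  assert (Huu : (u * Cconj u)%C = RtoC 1) by (rewrite <- Cmod2_conj, Hu; f_equal; ring).
  assert (Gs : forall y, Rabs y = Rabs (s * y)).
  { intros y. rewrite Rabs_mult. destruct Hs as [->| ->]; [rewrite Rabs_R1|rewrite (Rabs_left (-1))]; lra. }
  rewrite Gs, <- Cmod_R. f_equal.
  replace (u * (PI * (s * Cconj u * RtoC (1 - x ^ 2)) + (2 - 3 * lambda) * x ^ 2))%C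
    with (PI * s * (u * Cconj u) * RtoC (1 - x ^ 2) + (u * (2 - 3 * lambda)) * x ^ 2)%C by ring.
  rewrite Huu, Eu. rewrite !RtoC_mult, RtoC_plus, !RtoC_mult, RtoC_pow.
  assert (Hss : (RtoC s * RtoC s)%C = RtoC 1) by (rewrite <- RtoC_mult; f_equal; destruct Hs as [->| ->]; ring).
  replace (s * (PI * RtoC (1 - x ^ 2) + s * (Cmod (2 - 3 * lambda) * x ^ 2)))%C
    with (PI * s * RtoC (1 - x ^ 2) + (s * s) * (Cmod (2 - 3 * lambda) * x ^ 2))%C by ring.
  rewrite Hss. ring.
Qed.

(** * Bounds and sharpness *)

Lemma class_C_arcsin_bounds (lambda : C) (mu : R) (f : C -> C) (a : nat -> C) : 0 < mu ->
  class_C_arcsin f -> normalized_expansion f a ->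
  Theta1 lambda mu <= F_functional lambda mu a <= upper_bound lambda mu.
Proof.
  intros Hmu [_ [w [[Hw [w0 Hb]] Heq]]] Ha.
  assert (HPI := PI_RGT_0). assert (HPI2 : 0 < PI ^ 2) by (apply pow_lt; lra).
  assert (Dw := Cdiff_of_analytic w Hw).
  destruct (Cauchy_Taylor_global w _ 1 ltac:(lra) Dw) as [c [Sc Hc]].
  assert (c0 : c 0%nat = RtoC 0) by (rewrite <- (Cseries_at_0 c w 1 ltac:(lra) Sc); exact w0).
  assert (SP := Schwarz_Pick_coef w _ c Dw Hb Hc c0).
  assert (Hexp : bigO 3 (fun h => w h - (c 1%nat * h + c 2%nat * h ^ 2))%C).
  { eapply bigO_ext; [|exact (Cseries_expansion c w 1 3 ltac:(lra) Sc)].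
    intros h. simpl. rewrite c0. ring. }
  destruct (class_coefficients f w a _ _ Ha Hexp Heq) as [E2 E3].
  rewrite (functional_value lambda mu a _ _ E2 E3), upper_bound_alt, Theta1_alt.
  destruct (Cmod_quadratic_bounds (2 - 3 * lambda) _ _ SP) as [Q1 Q2].
  set (x := Cmod (c 1%nat)) in *. set (t := Cmod (2 - 3 * lambda)) in *.
  assert (Hx : 0 <= x <= 1).
  { assert (0 <= x) by apply Cmod_ge_0. assert (B := Cmod_ge_0 (c 2%nat)). split; [assumption|nra]. }
  assert (Ht : 0 <= t) by apply Cmod_ge_0.
  assert (U := upper_optimum t mu x Hmu Ht Hx).
  assert (V := lower_optimum t mu x _ Hmu Ht Hx (Cmod_ge_0 _) Q2).
  split; apply Rmult_le_compat_r; try (apply Rlt_le, Rinv_0_lt_compat; lra); lra.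
Qed.

(** The witnesses are the minimisers of [lower_optimum]: the endpoint 1, the zero of the modulus,
    and the vertex of the parabola. *)
Lemma lower_bound_attained (t mu : R) : 0 < mu -> 0 <= t -> exists x, 0 <= x <= 1 /\
  Rabs (PI * (1 - x ^ 2) + -1 * (t * x ^ 2)) - 3 * PI * mu * x = lower_bound t mu.
Proof.
  intros Hmu Ht. assert (HPI := PI_RGT_0). unfold lower_bound.
  destruct Rle_dec as [H|H]; [|destruct Rle_dec as [H'|H']].
  - exists 1. split; [lra|]. rewrite Rabs_left1 by nra. ring.
  - assert (Hq : 0 < PI / (t + PI)) by (apply Rdiv_lt_0_compat; lra).
    exists (sqrt (PI / (t + PI))). split.
    + split; [apply sqrt_pos|]. rewrite <- sqrt_1. apply sqrt_le_1_alt.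
      apply (Rmult_le_reg_r (t + PI)); [lra|]. unfold Rdiv. rewrite Rmult_assoc, Rinv_l; lra.
    + rewrite pow2_sqrt by lra.
      replace (PI * (1 - PI / (t + PI)) + -1 * (t * (PI / (t + PI)))) with 0 by (field; lra).
      rewrite Rabs_R0. ring.
  - exists (3 * PI * mu / (2 * (t + PI))).
    assert (Hpm : 0 < PI * mu) by nra.
    split; [split|].
    + apply Rdiv_le_0_compat; lra.
    + apply (Rmult_le_reg_r (2 * (t + PI))); [lra|]. unfold Rdiv. rewrite Rmult_assoc, Rinv_l by lra. nra.
    + rewrite Rabs_left1; [field; lra|].
      replace (PI * (1 - (3 * PI * mu / (2 * (t + PI))) ^ 2) + -1 * (t * (3 * PI * mu / (2 * (t + PI))) ^ 2))
        with (PI * (4 * (t + PI) - 9 * PI * mu ^ 2) / (4 * (t + PI))) by (field; lra).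
      assert (Hn : 4 * (t + PI) - 9 * PI * mu ^ 2 <= 0) by lra.
      assert (Hi : 0 < / (4 * (t + PI))) by (apply Rinv_0_lt_compat; lra).
      rewrite <- (Rmult_0_l (/ (4 * (t + PI)))). apply Rmult_le_compat_r; [lra|].
      set (y := 4 * (t + PI) - 9 * PI * mu ^ 2) in *. nra.
Qed.

Theorem theorem3p10 (lambda : C) (mu : R) (hmu : 0 < mu) :
  (forall (f : C -> C) (a : nat -> C),
      class_C_arcsin f -> normalized_expansion f a ->
      Theta1 lambda mu <= F_functional lambda mu a <= upper_bound lambda mu) /\
  (exists (f : C -> C) (a : nat -> C),
      class_C_arcsin f /\ normalized_expansion f a /\
      F_functional lambda mu a = upper_bound lambda mu) /\
  (exists (f : C -> C) (a : nat -> C),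
      class_C_arcsin f /\ normalized_expansion f a /\
      F_functional lambda mu a = Theta1 lambda mu).
Proof.
  assert (HPI := PI_RGT_0). assert (Ht := Cmod_ge_0 (2 - 3 * lambda)).
  split; [|split].
  - intros f a. now apply class_C_arcsin_bounds.
  - rewrite upper_bound_alt. destruct Rle_dec as [H|H].
    (* The endpoint [x = 1], that is [w = z]. *)
    + destruct (F_functional_extremal lambda mu 1 1 ltac:(lra) ltac:(now left)) as [f [a [Hf [Ha E]]]].
      exists f, a. split; [exact Hf|split; [exact Ha|]]. rewrite E. f_equal.
      rewrite Rabs_pos_eq by nra. ring.
    (* The endpoint [x = 0], that is [w = e z^2]. *)
    + destruct (F_functional_extremal lambda mu 0 1 ltac:(lra) ltac:(now left)) as [f [a [Hf [Ha E]]]].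
      exists f, a. split; [exact Hf|split; [exact Ha|]]. rewrite E. f_equal.
      rewrite Rabs_pos_eq by lra. ring.
  - destruct (lower_bound_attained _ mu hmu Ht) as [x [Hx Ex]].
    destruct (F_functional_extremal lambda mu x (-1) Hx ltac:(now right)) as [f [a [Hf [Ha E]]]].
    exists f, a. split; [exact Hf|split; [exact Ha|]]. rewrite E, Theta1_alt. now rewrite <- Ex.
Qed.
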